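(* Let $r>1$ and $\beta>0$, and let $\Omega_{\beta,r}\subset\mathbb{C}^2$ be the Diederich–Fornæss type worm domain. Then the $\overline{\partial}$-Neumann operator $N_1$ on $\Omega_{\beta,r}$ has the following essential norm estimate: $$\|N_1\|_e\geq \sup\left\{\left(\frac{\eta^2+1}{2}-\frac{\eta^2-1}{2\log\eta}\right)\frac{\pi-2\beta\log\eta}{\pi+2\beta\log\eta}\ :\ 1<\eta<\min\{e^{\pi/(2\beta)},r\}\right\}.$$
   Context: Worm domains: for $r>1$, $\beta>0$ let $$\rho_{\beta,r}(z_1,z_2)=\left|z_1-e^{i2\beta\log|z_2|}\right|^2-1+\sigma(|z_2|^2-r^2)+\sigma(1-|z_2|^2),$$ where $\sigma(t)=Me^{-1/t}$ for $t>0$ and $\sigma(t)=0$ for $t\le0$, and $M>0$ is a constant fixed large enough that $$\Omega_{\beta,r}=\{(z_1,z_2)\in\mathbb{C}^2:\rho_{\beta,r}(z_1,z_2)<0\}$$ is a smooth bounded pseudoconvex domain. $L^2_{(0,q)}(\Omega)$ is the Hilbert space of square integrable $(0,q)$-forms on $\Omega$. $\overline{\partial}:L^2_{(0,q)}(\Omega)\to L^2_{(0,q+1)}(\Omega)$ is the closed densely defined (maximal) operator with Hilbert space adjoint $\overline{\partial}^*$, and $N_1$ is the bounded self-adjoint inverse of $\Box_1=\overline{\partial}\,\overline{\partial}^*+\overline{\partial}^*\overline{\partial}$ on $L^2_{(0,1)}(\Omega)$, $\Omega$ bounded pseudoconvex. The essential norm of a bounded linear operator $T:X\to Y$ is $\|T\|_e=\inf\{\|T-K\|:K:X\to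 Y\text{ compact}\}$, with $\|\cdot\|$ the operator norm. *)

(* Defs.v *)
From HB Require Import structures.
From mathcomp Require Import all_boot all_order all_algebra.
From mathcomp Require Import complex.
From mathcomp Require Import all_classical all_reals all_analysis.
Set Implicit Arguments.
Unset Strict Implicit.
Unset Printing Implicit Defensive.
Import Order.TTheory GRing.Theory Num.Theory.
Import numFieldNormedType.Exports.
Import ComplexField.Normc.

Local Open Scope classical_set_scope.
Local Open Scope complex_scope.
Local Open Scope ring_scope.

(* A point ((x1, y1), (x2, y2)) of C2 R stands for (x1 + i y1, x2 + i y2); this
   real model of C^2 carries the product topology, norm and measurable
   structure of the library. *)
Notation C2 R := ((R * R) * (R * R))%type.

Section Calculus.
Context {R : realType}.
Local Notation X := (C2 R).
Implicit Types (x : X) (j k : 'I_2) (U : set X).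

Definition z1 x : R[i] := x.1.1 +i* x.1.2.
Definition z2 x : R[i] := x.2.1 +i* x.2.2.

Definition dirx j : X := if j == 0 then ((1, 0), (0, 0)) else ((0, 0), (1, 0)).
Definition diry j : X := if j == 0 then ((0, 1), (0, 0)) else ((0, 0), (0, 1)).

Definition cderive (v : X) (u : X -> R[i]) : X -> R[i] := fun x =>
  'D_v (fun y => complex.Re (u y)) x +i* 'D_v (fun y => complex.Im (u y)) x.

(* The Wirtinger derivatives d/dz_j and d/dzbar_j. *)
Definition dz j (u : X -> R[i]) : X -> R[i] := fun x =>
  2%:R^-1 * (cderive (dirx j) u x - (0 +i* 1) * cderive (diry j) u x).
Definition dzbar j (u : X -> R[i]) : X -> R[i] := fun x =>
  2%:R^-1 * (cderive (dirx j) u x + (0 +i* 1) * cderive (diry j) u x).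

(* C^n on the open set U. *)
Fixpoint Cn_on (n : nat) U (f : X -> R) : Prop :=
  if n is n'.+1 then
    (forall x, U x -> differentiable f x) /\ forall v, Cn_on n' U ('D_v f)
  else forall x, U x -> {for x, continuous f}.

Definition smooth_on U (f : X -> R) : Prop := forall n, Cn_on n U f.

Definition test_function U (phi : X -> R[i]) : Prop :=
  [/\ smooth_on setT (fun x => complex.Re (phi x)),
      smooth_on setT (fun x => complex.Im (phi x)) &
      exists K, [/\ compact K, K `<=` U & forall x, ~ K x -> phi x = 0]].

Definition frontier U : set X := closure U `\` interior U.

Definition defining_function (D U : set X) (rho : X -> R) : Prop :=
  [/\ open U, frontier D `<=` U, smooth_on U rho,
      D `&` U = [set x | U x /\ rho x < 0] &
      forall p, frontier D p -> exists v, 'D_v rho p != 0].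

Definition levi_form (rho : X -> R) (p : X) (w : 'I_2 -> R[i]) : R[i] :=
  \sum_(j < 2) \sum_(k < 2)
    dz j (dzbar k (fun x => (rho x)%:C)) p * w j * conjc (w k).

(* Pseudoconvexity of a domain with smooth boundary is taken in the sense of
   Levi; the condition does not depend on the defining function. *)
Definition smooth_bounded_pseudoconvex_domain (D : set X) : Prop :=
  [/\ D !=set0, open D, connected D, bounded_set D &
      exists U rho, defining_function D U rho /\
        forall p w, frontier D p ->
          \sum_(j < 2) dz j (fun x => (rho x)%:C) p * w j = 0 ->
          0 <= levi_form rho p w].

End Calculus.

Section Lebesgue.
Context {R : realType}.

(* Lebesgue measure on R^2 and on R^4 = C^2.  The sigma-finiteness instance is
   declared here because the one of the library for products is not found by
   inference. *)
Definition leb2 : set (measurableTypeR R * measurableTypeR R) -> \bar R :=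
  (lebesgue_measure \x lebesgue_measure)%E.

HB.instance Definition _ := Measure.on leb2.

Let leb2_sigma_finite : sigma_finite setT leb2.
Proof.
have /sigma_finiteP[F [TF ndF Foo]] := sigma_finiteT (@lebesgue_measure R).
exists (fun n => F n `*` F n).
  rewrite -setXTT TF predeqE => -[x y]; split.
    move=> [/= [n _ Fnx] [k _ Fky]]; exists (maxn n k) => //; split.
    - by move: x Fnx; exact/subsetPset/ndF/leq_maxl.
    - by move: y Fky; exact/subsetPset/ndF/leq_maxr.
  by move=> [n _ []/= ? ?]; split; exists n.
move=> k; have [? ?] := Foo k; split; first exact: measurableX.
by rewrite /leb2 product_measure1E// lte_mul_pinfty// ge0_fin_numE.
Qed.

HB.instance Definition _ :=
  Measure_isSigmaFinite.Build _ _ _ leb2 leb2_sigma_finite.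

Definition leb4 : set ((measurableTypeR R * measurableTypeR R) *
                       (measurableTypeR R * measurableTypeR R)) -> \bar R :=
  (leb2 \x leb2)%E.

HB.instance Definition _ := Measure.on leb4.

End Lebesgue.

Section Hilbert.
Context {R : realType}.
Local Notation X := (C2 R).

Variable D : set X.

(* Elements of L2 are represented by functions, identified when they agree
   almost everywhere on D.  With m = 1, 2, 1 these are the (0,0)-, (0,1)- and
   (0,2)-forms: components with respect to the orthonormal bases 1;
   dzbar_1, dzbar_2; dzbar_1 /\ dzbar_2. *)
Definition cform (m : nat) : Type := X -> 'rV[R[i]]_m.

Definition ae_eq_on m (f g : cform m) : Prop :=
  {ae leb4, forall x, D x -> f x = g x}.

Definition sqnorm m (f : cform m) (x : X) : R :=
  \sum_(i < m) normc (f x 0 i) ^+ 2.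

Definition L2 m (f : cform m) : Prop :=
  (forall i, measurable_fun D (fun x => complex.Re (f x 0 i)) /\
             measurable_fun D (fun x => complex.Im (f x 0 i))) /\
  (\int[leb4]_(x in D) (sqnorm f x)%:E < +oo)%E.

Definition cintegral (h : X -> R[i]) : R[i] :=
  (\int[leb4]_(x in D) complex.Re (h x)) +i*
  (\int[leb4]_(x in D) complex.Im (h x)).

Definition inner m (f g : cform m) : R[i] :=
  cintegral (fun x => \sum_(i < m) f x 0 i * conjc (g x 0 i)).

Definition L2norm m (f : cform m) : R :=
  Num.sqrt (\int[leb4]_(x in D) sqnorm f x).

(* Linearity is up to equality almost everywhere; boundedness makes T
   compatible with that equality. *)
Definition bounded_operator m n (T : cform m -> cform n) : Prop :=
  [/\ forall f, L2 f -> L2 (T f),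
      forall (a : R[i]) f g, L2 f -> L2 g ->
        ae_eq_on (T (fun x => a *: f x + g x)) (fun x => a *: T f x + T g x) &
      exists C : R, forall f, L2 f -> L2norm (T f) <= C * L2norm f].

Definition compact_operator m n (K : cform m -> cform n) : Prop :=
  bounded_operator K /\
  forall f_ : nat -> cform m,
    (forall k, L2 (f_ k)) -> (exists C : R, forall k, L2norm (f_ k) <= C) ->
    exists (s : nat -> nat) (g : cform n),
      [/\ {homo s : k l / (k < l)%N}, L2 g &
          (fun k => L2norm (fun x => K (f_ (s k)) x - g x)) @ \oo --> (0 : R)].

Definition opnorm m n (T : cform m -> cform n) : \bar R :=
  ereal_sup [set (L2norm (T f))%:E | f in [set f | L2 f /\ L2norm f <= 1]].

Definition essential_norm m n (T : cform m -> cform n) : \bar R :=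
  ereal_inf [set opnorm (fun f x => T f x - K f x) |
             K in [set K | compact_operator K]].

(* Unbounded operators are given by their graphs. *)
Definition adjoint m n (A : cform m -> cform n -> Prop) :
    cform n -> cform m -> Prop := fun f g =>
  [/\ L2 f, L2 g & forall u v, A u v -> inner v f = inner u g].

Definition dbar0 (u : cform 1) (f : cform 2) : Prop :=
  [/\ L2 u, L2 f & forall (j : 'I_2) phi, test_function D phi ->
      cintegral (fun x => u x 0 0 * dzbar j phi x) =
      - cintegral (fun x => f x 0 j * phi x)].

(* dbar (f_1 dzbar_1 + f_2 dzbar_2)
   = (d f_2 / dzbar_1 - d f_1 / dzbar_2) dzbar_1 /\ dzbar_2 *)
Definition dbar1 (f : cform 2) (g : cform 1) : Prop :=
  [/\ L2 f, L2 g & forall phi, test_function D phi ->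
      cintegral (fun x => f x 0 1 * dzbar 0 phi x - f x 0 0 * dzbar 1 phi x) =
      - cintegral (fun x => g x 0 0 * phi x)].

Definition box1 (f g : cform 2) : Prop :=
  exists u v a b,
    [/\ adjoint dbar0 f u /\ dbar0 u a,
        dbar1 f v /\ adjoint dbar1 v b,
        L2 g & ae_eq_on g (fun x => a x + b x)].

Definition dbar_Neumann_operator (N : cform 2 -> cform 2) : Prop :=
  [/\ bounded_operator N,
      forall f g, L2 f -> L2 g -> inner (N f) g = inner f (N g),
      forall f, L2 f -> box1 (N f) f &
      forall f g, box1 f g -> ae_eq_on (N g) f].

End Hilbert.

Section Worm.
Context {R : realType}.
Local Notation X := (C2 R).

Definition sigma (M t : R) : R := if 0 < t then M * expR (- t^-1) else 0.

Definition cis (t : R) : R[i] := cos t +i* sin t.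

Definition worm_rho (M beta r : R) (x : X) : R :=
  normc (z1 x - cis (2 * beta * ln (normc (z2 x)))) ^+ 2 - 1
  + sigma M (normc (z2 x) ^+ 2 - r ^+ 2) + sigma M (1 - normc (z2 x) ^+ 2).

(* worm_rho is meaningful only for z2 <> 0, where log |z2| is defined. *)
Definition worm (M beta r : R) : set X :=
  [set x | z2 x != 0 /\ worm_rho M beta r x < 0].

Definition worm_bound (beta eta : R) : R :=
  ((eta ^+ 2 + 1) / 2 - (eta ^+ 2 - 1) / (2 * ln eta)) *
  ((pi - 2 * beta * ln eta) / (pi + 2 * beta * ln eta)).

End Worm.

(* Main.v *)
Require Import Defs.
From HB Require Import structures.
From mathcomp Require Import all_boot all_order all_algebra.
From mathcomp Require Import complex.
From mathcomp Require Import all_classical all_reals all_analysis.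
From mathcomp Require Import ring lra measurable_realfun.
Import Order.TTheory GRing.Theory Num.Theory.
Import numFieldNormedType.Exports.
Import ComplexField.Normc.

Local Open Scope classical_set_scope.
Local Open Scope complex_scope.
Local Open Scope ring_scope.

Set Implicit Arguments.
Unset Strict Implicit.
Unset Printing Implicit Defensive.

(** Write [E = eta ^ 2] and [a = 2 beta ln eta], so that [0 < a < pi]. Over the
   annulus [1 < |z2|^2 < E] the slices of the worm are discs of radius 1 centred
   at [e^(i th)] with [0 <= th <= a] ([worm_slice]). All of them have 0 on their
   boundary, and all contain the lens [S] common to the two extreme discs
   ([extreme_discs_sub]).

   For [F] holomorphic on these discs consider the form [f = F(z1) dzbar_2] over
   the annulus, extended by 0. It is dbar-closed although it jumps, because the
   jump is in the variable z2 only ([holo_form_closed]). Two estimates hold for it.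
   Above, [|f|^2] is at most [pi (E - 1)], the area of the annulus, times a bound
   of the masses of [|F|^2] on the slices ([holo_form_size]). Below,
   [|f| |N f| >= (f, N f) = |u|^2] with [u = dbar^* N f] a weak solution of
   [dbar u = f] ([minimal_solution]); testing that equation with
   [chi(z1) g(z2) conj(F(z1))] gives, for cutoffs [chi] of the lens and [g] close
   to the torsion function [G] of the annulus, [|u|^2 >= T * (mass of |F|^2 on S)],
   where [T] is the integral of [2 G - |dG / dzbar_2|^2], that is, of [G]
   ([lens_lower_bound]).

   Now let [F] have a simple pole near 0, outside all the discs. The mass of
   [|F|^2] then concentrates at 0, where a disc looks like a half-plane, of
   opening [pi], and the lens like a sector of opening [pi - a]. The pole recedes
   from the discs in the direction opposite to their bisector. Seen from it, a
   disc lies in a half-plane ([disc_mass_le]) and the lens contains most of a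
   cone of any opening below [pi - a] ([cone_mass_ge]); the opening used here is
   [2 alpha = pi (pi - a) / (pi + a)]. With weights that normalise the
   logarithmic divergence, the mass on a disc is asymptotically at most [pi] and
   the mass on the lens at least [2 alpha], so that [|N f| / |f|] is
   asymptotically at least [T / (pi (E - 1)) * (2 alpha / pi)], which is the
   bound of the theorem.

   A compact operator cannot compensate this. Rather than identifying a weak
   limit, take differences [f_l - f_k] along a subsequence on which the compact
   operator converges ([essential_norm_ge]). For [l] large compared to [k] the
   two poles do not interact, and both bounds double ([pair_disc_mass],
   [pair_lens_mass]). *)

(** * Lebesgue measure in the plane *)

Section BorelC2.
Context {R : realType}.
Local Notation X := (C2 R).

Let I (q : rat * rat) : set R := `]ratr q.1, ratr q.2[.

Let I_nbhs (x e : R) : 0 < e -> exists q, I q x /\ I q `<=` ball x e.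
Proof.
move=> e0.
have /rat_in_itvoo[q1] : x - e < x by lra.
have /rat_in_itvoo[q2] : x < x + e by lra.
rewrite !in_itv/= => /andP[h3 h4] /andP[h1 h2].
exists (q1, q2); split; first by rewrite /I/= in_itv/= h2 h3.
move=> y; rewrite /I/= in_itv/= => /andP[h5 h6].
by rewrite -ball_normE/=; rewrite ltr_distlC; apply/andP; split; lra.
Qed.

Let mI q : measurable (I q).
Proof. exact: measurable_itv. Qed.

(** An open set is a countable union of boxes with rational corners, and these
   are measurable rectangles. *)
Lemma open_measurable_C2 (U : set X) : open U -> measurable U.
Proof.
move=> oU.
pose B (q : (rat * rat) * (rat * rat) * ((rat * rat) * (rat * rat))) : set X :=
  (I q.1.1 `*` I q.1.2) `*` (I q.2.1 `*` I q.2.2).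
have -> : U = \bigcup_(q in [set q | B q `<=` U]) B q.
  apply/seteqP; split => [x Ux|x [q qU Bqx]]; last exact: qU.
  have /nbhs_ballP[e /= e0 eU] : nbhs x U by exact: open_nbhs_nbhs.
  have [q11 [q11x q11s]] := I_nbhs x.1.1 e0.
  have [q12 [q12x q12s]] := I_nbhs x.1.2 e0.
  have [q21 [q21x q21s]] := I_nbhs x.2.1 e0.
  have [q22 [q22x q22s]] := I_nbhs x.2.2 e0.
  exists ((q11, q12), (q21, q22)) => // y [[y1 y2] [y3 y4]].
  by apply: eU; split; split; [exact: q11s|exact: q12s|exact: q21s|exact: q22s].
rewrite bigcup_mkcond; apply: countable_bigcupT_measurable => // q.
by case: ifP => // _; apply: measurableX; apply: measurableX.
Qed.

Lemma continuous_measurable_C2 (f : X -> R) :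
  continuous f -> measurable_fun [set: X] f.
Proof.
move=> cf; apply: (measurability _ (RGenOpens.measurableE R)).
move=> _ [_ [a [b ->] <-]]; rewrite setTI.
apply: open_measurable_C2; apply: open_comp => // x _; exact: cf.
Qed.

End BorelC2.

Section Affine.
Context {R : realType}.
Local Notation mu := (@lebesgue_measure R).
Local Open Scope ereal_scope.

Lemma measurable_fun_affine (a b : R) :
  measurable_fun [set: R] (fun t : R => (a * t + b)%R : measurableTypeR R).
Proof. by apply: measurable_funD => //; exact: measurable_funM. Qed.

Section AffineChange.
Variables (a b : R) (a0 : (0 < a)%R).

Let phi (t : R) : measurableTypeR R := (a * t + b)%R.

Let mphi : measurable_fun [set: measurableTypeR R] phi.
Proof. exact: measurable_fun_affine. Qed.

Let push : {measure set (measurableTypeR R) -> \bar R} :=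
  measure_function_pushforward__canonical__measure_function_Measure mu mphi.

Let m' : {measure set (measurableTypeR R) -> \bar R} :=
  mscale (NngNum (ltW a0)) push.

Let lebesgue_measure_affine (A : set R) : measurable A -> mu A = m' A.
Proof.
move=> mA; apply: lebesgue_measure_unique => // _ [[c d]] _ <-.
rewrite /m'/= /mscale/= /pushforward.
rewrite (_ : _ @^-1` _ = [set` `]((c - b) / a)%R, ((d - b) / a)%R]]); last first.
  apply/seteqP; split => t /=; rewrite !in_itv/= => /andP[h1 h2].
    by rewrite ltr_pdivrMr// ler_pdivlMr// ltrBlDr lerBrDr mulrC h1 h2.
  by move: h1 h2; rewrite /phi ltr_pdivrMr// ler_pdivlMr// ltrBlDr lerBrDr mulrC => -> ->.
rewrite !lebesgue_measure_itv/= !lte_fin ltr_pM2r ?invr_gt0// ltrD2r.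
case: ifPn => _; last by rewrite mule0.
rewrite -!EFinB -EFinM -mulrBl mulrC divfK ?gt_eqF//; congr _%:E; ring.
Qed.

(** Rescaling and translating Lebesgue measure gives a measure with the same
   values on intervals. *)
Lemma ge0_integral_affine (f : R -> \bar R) :
  measurable_fun setT f -> (forall x, 0 <= f x) ->
  \int[mu]_x f x = a%:E * \int[mu]_x f (a * x + b)%R.
Proof.
move=> mf f0; rewrite (eq_measure_integral m'); last first.
  by move=> A mA _; exact: lebesgue_measure_affine.
rewrite /m' ge0_integral_mscale//; congr (_ * _).
by rewrite ge0_integral_pushforward.
Qed.

End AffineChange.

Lemma ge0_integral_shift (b : R) (f : R -> \bar R) :
  measurable_fun setT f -> (forall x, 0 <= f x) ->
  \int[mu]_x f (x + b)%R = \int[mu]_x f x.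
Proof.
move=> mf f0; rewrite (ge0_integral_affine b (@ltr01 R) mf f0) mul1e.
by under [RHS]eq_integral do rewrite mul1r.
Qed.

End Affine.

Section Plane.
Context {R : realType}.
Local Notation mu := (@lebesgue_measure R).
Local Notation R1 := (measurableTypeR R).
Local Notation R2 := (R1 * R1)%type.
Local Notation leb2 := (@leb2 R).
Local Open Scope ereal_scope.

Implicit Type f : R2 -> \bar R.

Lemma leb2_tonelli1 f : measurable_fun setT f -> (forall z, 0 <= f z) ->
  \int[leb2]_z f z = \int[mu]_x \int[mu]_y f (x, y).
Proof. exact: (@fubini_tonelli1 _ _ R1 R1 R mu mu f). Qed.

Lemma leb2_tonelli2 f : measurable_fun setT f -> (forall z, 0 <= f z) ->
  \int[leb2]_z f z = \int[mu]_y \int[mu]_x f (x, y).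
Proof. exact: (@fubini_tonelli2 _ _ R1 R1 R mu mu f). Qed.

Lemma measurable_plane_map (a b c d e g : R) :
  measurable_fun [set: R2] (fun z : R2 =>
    ((a * z.1 + b * z.2 + e)%R, (c * z.1 + d * z.2 + g)%R) : R2).
Proof.
by apply/measurable_fun_pairP; split => /=; apply: measurable_funD => //;
  apply: measurable_funD => //; exact: measurable_funM.
Qed.

(** On each line [z.2 = y] the shear is a translation. *)
Lemma ge0_leb2_shear1 (k : R) f : measurable_fun setT f -> (forall z, 0 <= f z) ->
  \int[leb2]_z f ((z.1 + k * z.2)%R, z.2) = \int[leb2]_z f z.
Proof.
move=> mf f0.
have mg : measurable_fun setT (fun z : R2 => f ((z.1 + k * z.2)%R, z.2)).
  apply: (measurableT_comp mf); have := measurable_plane_map 1 k 0 1 0 0.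
  by apply: eq_measurable_fun => z _; rewrite !mul1r !mul0r add0r !addr0.
rewrite (leb2_tonelli2 mg) => [|z]; last exact: f0.
rewrite (leb2_tonelli2 mf f0); apply: eq_integral => y _ /=.
by rewrite (ge0_integral_shift (k * y) (f := fun x => f (x, y)))//;
  exact: measurableT_comp.
Qed.

Lemma ge0_leb2_shear2 (k : R) f : measurable_fun setT f -> (forall z, 0 <= f z) ->
  \int[leb2]_z f (z.1, (z.2 + k * z.1)%R) = \int[leb2]_z f z.
Proof.
move=> mf f0.
have mg : measurable_fun setT (fun z : R2 => f (z.1, (z.2 + k * z.1)%R)).
  apply: (measurableT_comp mf); have := measurable_plane_map 1 0 k 1 0 0.
  by apply: eq_measurable_fun => z _; rewrite !mul1r !mul0r !addr0 addrC.
rewrite (leb2_tonelli1 mg) => [|z]; last exact: f0.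
rewrite (leb2_tonelli1 mf f0); apply: eq_integral => x _ /=.
by rewrite (ge0_integral_shift (k * x) (f := fun y => f (x, y)))//;
  exact: measurableT_comp.
Qed.

Lemma ge0_leb2_translation (e : R2) f :
  measurable_fun setT f -> (forall z, 0 <= f z) ->
  \int[leb2]_z f ((z.1 + e.1)%R, (z.2 + e.2)%R) = \int[leb2]_z f z.
Proof.
move=> mf f0.
have mg : measurable_fun setT (fun z : R2 => f ((z.1 + e.1)%R, (z.2 + e.2)%R)).
  apply: (measurableT_comp mf); have := measurable_plane_map 1 0 0 1 e.1 e.2.
  by apply: eq_measurable_fun => z _; rewrite !mul1r !mul0r add0r !addr0.
rewrite (leb2_tonelli1 mg) => [|z]; last exact: f0.
rewrite (leb2_tonelli1 mf f0).
rewrite -[RHS](ge0_integral_shift e.1); last 2 first.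
- exact: (measurable_fun_fubini_tonelli_F f).
- by move=> x; exact: integral_ge0.
apply: eq_integral => x _ /=.
by rewrite (ge0_integral_shift e.2 (f := fun y => f ((x + e.1)%R, y)))//;
  exact: measurableT_comp.
Qed.

(** A rotation other than the half-turn is a product of three shears. *)
Lemma ge0_leb2_rotation (c s : R) f : (c ^+ 2 + s ^+ 2 = 1)%R -> (c != -1)%R ->
  measurable_fun setT f -> (forall z, 0 <= f z) ->
  \int[leb2]_z f ((c * z.1 - s * z.2)%R, (s * z.1 + c * z.2)%R) =
  \int[leb2]_z f z.
Proof.
move=> cs c1 mf f0; pose k := (- (s / (1 + c)))%R.
have c10 : (1 + c != 0)%R by rewrite addrC addr_eq0.
pose g1 (z : R2) := f ((z.1 + k * z.2)%R, z.2).
have mg1 : measurable_fun setT g1.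
  apply: (measurableT_comp mf); have := measurable_plane_map 1 k 0 1 0 0.
  by apply: eq_measurable_fun => z _; rewrite !mul1r !mul0r add0r !addr0.
pose g2 (z : R2) := g1 (z.1, (z.2 + s * z.1)%R).
have mg2 : measurable_fun setT g2.
  apply: (measurableT_comp mg1); have := measurable_plane_map 1 0 s 1 0 0.
  by apply: eq_measurable_fun => z _; rewrite !mul1r !mul0r !addr0 addrC.
rewrite -(ge0_leb2_shear1 k mf)// -(ge0_leb2_shear2 s mg1); last first.
  by move=> z; exact: f0.
rewrite -(ge0_leb2_shear1 k mg2); last by move=> z; exact: f0.
have kc : (k * (1 + c) = - s)%R by rewrite /k mulNr divfK.
have sk : (s * k = c - 1)%R.
  apply: (mulIf c10); rewrite -mulrA kc.
  have : (s * s = 1 - c * c)%R by rewrite -!expr2 -cs addrC addKr.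
  move=> ss; rewrite mulrN ss; ring.
apply: eq_integral => z _; rewrite /g2 /g1 /=; congr (f (_, _)).
  rewrite (_ : _ + k * _ = (1 + s * k) * (z.1 + k * z.2) + k * z.2)%R; last ring.
  rewrite sk (_ : s = - (k * (1 + c)))%R; [ring|by rewrite kc opprK].
rewrite (_ : _ + s * _ = (1 + s * k) * z.2 + s * z.1)%R; last ring.
by rewrite sk; ring.
Qed.

End Plane.

(** * Polar coordinates in the plane *)

Section Polar.
Context {R : realType}.
Local Notation mu := (@lebesgue_measure R).
Local Notation R1 := (measurableTypeR R).
Local Notation R2 := (R1 * R1)%type.
Local Notation leb2 := (@leb2 R).

Definition nsq (z : R * R) : R := z.1 ^+ 2 + z.2 ^+ 2.

Lemma nsq_ge0 z : 0 <= nsq z.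
Proof. by rewrite addr_ge0// sqr_ge0. Qed.

Lemma measurable_nsq : measurable_fun [set: R2] nsq.
Proof. by apply: measurable_funD; apply: measurable_funX. Qed.

Variables (k K : R -> R) (s0 s1 : R).
Hypotheses (s0_gt0 : 0 < s0) (s01 : s0 < s1).
Hypothesis dK : forall s, s0 <= s <= s1 -> is_derive s 1 K (k s).
Hypothesis ck : forall s, s0 <= s <= s1 -> {for s, continuous k}.
Hypothesis k_ge0 : forall s, s0 <= s <= s1 -> 0 <= k s.

Let in_sqrt_itv (q x : R) : 0 < q ->
  (Num.sqrt (s0 / q) <= x <= Num.sqrt (s1 / q)) =
  (0 < x) && (s0 <= x ^+ 2 * q <= s1).
Proof.
move=> q0; have s1_gt0 : 0 < s1 by apply: lt_trans s01.
have [x0|x0] := ltP 0 x; last first.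
  apply/negbTE; rewrite negb_and -ltNge (le_lt_trans x0)//.
  by rewrite sqrtr_gt0 divr_gt0.
have h u : 0 < u -> ((Num.sqrt u <= x) = (u <= x ^+ 2)) *
    ((x <= Num.sqrt u) = (x ^+ 2 <= u)).
  move=> u0; rewrite -{2 4}(sqr_sqrtr (ltW u0)).
  by split; rewrite ler_sqr ?nnegrE ?sqrtr_ge0// ltW.
by rewrite !h ?divr_gt0// ler_pdivrMr// ler_pdivlMr.
Qed.

(** The substitution [s = q x ^ 2], written with the antiderivative of the
   integrand. *)
Let radial_integral (q : R) : 0 < q ->
  (\int[mu]_(x in [set x : R | (0 < x)%R /\ (s0 <= x ^+ 2 * q <= s1)%R])
     (x * k (x ^+ 2 * q))%:E)%E = ((K s1 - K s0) / 2 / q)%:E.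
Proof.
move=> q0; have s1_gt0 : 0 < s1 by apply: lt_trans s01.
have -> : [set x : R | 0 < x /\ s0 <= x ^+ 2 * q <= s1] =
    `[Num.sqrt (s0 / q), Num.sqrt (s1 / q)]%classic.
  apply/seteqP; split => x /=; rewrite in_itv/= in_sqrt_itv//.
    by move=> [-> ->].
  by move=> /andP[].
pose F (x : R) := K (x ^+ 2 * q) / (2 * q).
have dF x : s0 <= x ^+ 2 * q <= s1 ->
    is_derive x 1 F (x * k (x ^+ 2 * q)).
  move=> xs; have dKx := dK xs.
  have dsq : is_derive x 1 (fun x : R => x ^+ 2 * q) (2 * x * q).
    apply: is_derive_eq; rewrite /GRing.scale/= !mulr1 mulr0 add0r; ring.
  have := @is_derive1_comp R K (fun x : R => x ^+ 2 * q) x _ _ dKx dsq.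
  move=> dc.
  have := @is_deriveZ _ _ _ (K \o (fun x => x ^+ 2 * q)) (2 * q)^-1 x 1 _ dc.
  rewrite (_ : _ \*: _ = F); last by apply/funext => y; exact: mulrC.
  move=> /is_derive_eq; apply; rewrite /GRing.scale/=.
  by field; rewrite gt_eqF.
have itvs x : x \in `[Num.sqrt (s0 / q), Num.sqrt (s1 / q)] ->
   0 < x /\ s0 <= x ^+ 2 * q <= s1.
  by rewrite in_itv/= in_sqrt_itv// => /andP[].
have cF x : s0 <= x ^+ 2 * q <= s1 -> {for x, continuous F}.
  move=> /dF dFx; apply: differentiable_continuous.
  by apply/derivable1_diffP; exact: ex_derive.
have ab : Num.sqrt (s0 / q) < Num.sqrt (s1 / q).
  by rewrite ltr_sqrt ?divr_gt0// ltr_pM2r ?invr_gt0.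
have ha := itvs (Num.sqrt (s0 / q)); have hb := itvs (Num.sqrt (s1 / q)).
move: ha hb; rewrite !in_itv/= !lexx (ltW ab)/= => /(_ isT)[_ ha] /(_ isT)[_ hb].
rewrite (@continuous_FTC2 _ _ F)//.
- rewrite -EFinB; congr _%:E; rewrite /F !sqr_sqrtr ?divr_ge0 ?ltW//.
  by rewrite !divfK ?gt_eqF//; field; rewrite gt_eqF.
- apply: continuous_in_subspaceT => x; rewrite inE/= => /itvs[_ xs].
  apply: continuousM; first exact: cvg_id.
  apply: continuous_comp; last exact: ck.
  apply: continuousM; last exact: cvg_cst.
  exact: exprn_continuous.
- split.
  + move=> x /subset_itv_oo_cc /itvs[_ /dF dFx]; exact: ex_derive.
  + by apply: cvg_at_right_filter; exact: cF.
  + by apply: cvg_at_left_filter; exact: cF.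
- move=> x /subset_itv_oo_cc /itvs[_ /dF dFx].
  by rewrite derive1E; apply: derive_val.
Qed.

(** Slope coordinates [y = x t] on the half-plane [x > 0]: the Jacobian is [x],
   and the radial variable [x^2 (1 + t^2)] then separates from [t]. *)
Lemma slope_radial_integral (B : set R) (S : set R2) :
  measurable B -> measurable S -> (forall z, S z -> 0 < z.1) ->
  (forall x t, 0 < x ->
     S (x, x * t) <-> B t /\ s0 <= x ^+ 2 * (1 + t ^+ 2) <= s1) ->
  (\int[leb2]_(z in S) (k (nsq z))%:E =
   \int[mu]_(t in B) ((K s1 - K s0) / 2 / (1 + t ^+ 2))%:E)%E.
Proof.
move=> mB mS S_gt0 SE.
have nsqE x t : nsq (x, x * t) = x ^+ 2 * (1 + t ^+ 2).
  by rewrite /nsq/= exprMn; ring.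
have S_nsq z : S z -> s0 <= nsq z <= s1.
  move=> Sz; have z1 := S_gt0 _ Sz; move: Sz.
  rewrite (_ : z = (z.1, z.1 * (z.2 / z.1))).
    by move=> /(SE _ _ z1)[_]; rewrite nsqE.
  by rewrite mulrCA divff ?gt_eqF// mulr1 -surjective_pairing.
pose f : R2 -> \bar R := (fun z => (k (nsq z))%:E) \_ S.
have f0 z : (0 <= f z)%E.
  rewrite /f patchE; case: ifPn => //; rewrite inE => /S_nsq zs.
  by rewrite lee_fin k_ge0.
have mf : measurable_fun setT f.
  apply/(measurable_restrictT _ mS)/measurable_EFinP.
  apply: (@measurable_comp _ _ _ _ _ _ `[s0, s1]%classic) => //.
  - by move=> _ [z /S_nsq zs <-]/=; rewrite in_itv.
  - apply: subspace_continuous_measurable_fun => //.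
    by apply: continuous_in_subspaceT => x; rewrite inE/= in_itv/=; exact: ck.
  - exact: measurable_funTS measurable_nsq.
pose g (z : R2) := ((Num.max z.1 0)%:E * f (z.1, (z.1 * z.2)%R))%E.
have g0 z : (0 <= g z)%E by rewrite mule_ge0// lee_fin le_max lexx orbT.
have mg : measurable_fun setT g.
  apply: emeasurable_funM.
    by apply/measurable_EFinP; apply: measurable_maxr.
  apply: (measurableT_comp mf); apply/measurable_fun_pairP; split.
    exact: measurable_fst.
  exact: (measurable_funM measurable_fst measurable_snd).
rewrite integral_mkcond -/f (leb2_tonelli1 mf f0).
transitivity (\int[mu]_x \int[mu]_t g (x, t))%E.
  apply: eq_integral => x _ /=.
  have [x0|x0] := ltP 0 x.
    rewrite (ge0_integral_affine 0 x0 (f := fun y => f (x, y)))//; last first.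
      exact: measurableT_comp.
    rewrite -ge0_integralZl//.
    - by apply: eq_integral => t _; rewrite /g/= addr0 max_l// ltW.
    - apply: (measurableT_comp mf); apply/measurable_fun_pairP; split.
        exact: measurable_cst.
      exact: measurable_fun_affine.
    - by rewrite lee_fin ltW.
  rewrite !integral0_eq// => t _; rewrite /g/=.
    by rewrite max_r// mul0e.
  rewrite /f patchE ifF//; apply/negbTE; rewrite notin_setE => /S_gt0/=.
  by rewrite ltNge x0.
rewrite (fubini_tonelli (m1 := mu) (m2 := mu) g mg g0) [RHS]integral_mkcond.
apply: eq_integral => t _ /=; rewrite patchE; case: ifPn; rewrite ?inE ?notin_setE => Bt.
  have q0 : 0 < 1 + t ^+ 2 by rewrite ltr_pwDl// sqr_ge0.
  rewrite -radial_integral// [RHS]integral_mkcond; apply: eq_integral => x _.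
  rewrite /g/= patchE /f patchE; have [x0|x0] := ltP 0 x; last first.
    rewrite mul0e ifF//; apply/negbTE; rewrite notin_setE/= => -[].
    by rewrite ltNge x0.
  have [xs|/negbTE xs] := boolP (s0 <= x ^+ 2 * (1 + t ^+ 2) <= s1).
    by rewrite !ifT ?inE// ?nsqE -?EFinM//; apply/SE.
  rewrite !ifF ?mule0//; apply/negbTE; rewrite notin_setE/=.
    by move=> [_]; rewrite xs.
  by move=> /(SE _ _ x0)[_]; rewrite xs.
rewrite integral0_eq// => x _; rewrite /g/= /f patchE.
have [x0|x0] := ltP 0 x; last by rewrite mul0e.
rewrite ifF ?mule0//; apply/negbTE; rewrite notin_setE.
by move=> /(SE _ _ x0)[].
Qed.

End Polar.

Section PlaneIntegrals.
Context {R : realType}.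
Local Notation mu := (@lebesgue_measure R).
Local Notation R1 := (measurableTypeR R).
Local Notation R2 := (R1 * R1)%type.
Local Notation leb2 := (@leb2 R).

Let ge0_integral_even (h : R -> \bar R) :
  measurable_fun setT h -> (forall x, 0 <= h x)%E -> (forall x, h (- x) = h x) ->
  (\int[mu]_x h x = \int[mu]_(x in `]0%R, +oo[) h x + \int[mu]_(x in `]0%R, +oo[) h x)%E.
Proof.
move=> mh h0 hN.
have TE : [set: R] = `]-oo, 0%R] `|` `]0%R, +oo[.
  apply/seteqP; split => x // _ /=; rewrite !in_itv/= andbT.
  by have [|] := leP x 0; [left|right].
rewrite TE ge0_integral_setU//=; last 2 first.
- by rewrite -TE.
- apply/disj_setPS => x [] /=; rewrite !in_itv/= andbT => x0.
  by rewrite ltNge x0.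
congr (_ + _)%E.
transitivity (\int[mu]_(x in `]-oo, 0%R]) h (- x)%R)%E.
  by apply: eq_integral => x _; rewrite hN.
rewrite -ge0_integration_by_substitution0// integral_itv_obnd_cbnd//.
exact: measurable_funTS.
Qed.

Let cOneDsqrV : continuous (fun t : R => (1 + t ^+ 2)^-1).
Proof. exact: continuous_oneDsqrV. Qed.

Let integral_oneDsqrV_T : (\int[mu]_t ((1 + t ^+ 2)^-1)%:E = pi%:E)%E.
Proof.
have m1 : measurable_fun setT (fun t : R => ((1 + t ^+ 2)^-1)%:E).
  by apply/measurable_EFinP; exact: continuous_measurable_fun cOneDsqrV.
rewrite ge0_integral_even//.
- rewrite integral_itv_obnd_cbnd; last exact: measurable_funTS.
  rewrite [X in (X + X)%E](_ : _ = (pi / 2)%:E); last exact: integral0y_oneDsqr.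
  by rewrite -EFinD; congr _%:E; field.
- by move=> x; rewrite lee_fin invr_ge0 addr_ge0// sqr_ge0.
- by move=> x; rewrite sqrrN.
Qed.

Let integral_oneDsqrV_sym (b : R) : 0 < b ->
  (\int[mu]_(t in `[(- b)%R, b]) ((1 + t ^+ 2)^-1)%:E = (2 * atan b)%:E)%E.
Proof.
move=> b0; rewrite (@continuous_FTC2 _ _ atan) ?gtrN//.
- by rewrite atanN -EFinB; congr _%:E; ring.
- exact: continuous_subspaceT cOneDsqrV.
- split.
  + by move=> x _; exact: derivable_atan.
  + by apply: cvg_at_right_filter; exact: continuous_atan.
  + by apply: cvg_at_left_filter; exact: continuous_atan.
- by move=> x _; rewrite derive1_atan.
Qed.

Lemma measurable_nsq_itv (s0 s1 : R) :
  measurable [set z : R2 | (s0 <= nsq z <= s1)%R].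
Proof.
rewrite (_ : mkset _ = nsq @^-1` `[s0, s1]%classic).
  by rewrite -[X in measurable X]setTI; apply: measurable_nsq.
by apply/seteqP; split => z /=; rewrite in_itv.
Qed.

Lemma measurable_right_half : measurable [set z : R2 | (0 < z.1)%R].
Proof.
rewrite (_ : mkset _ = fst @^-1` (`]0, +oo[%classic : set R1)).
  by rewrite -[X in measurable X]setTI; apply: measurable_fst.
by apply/seteqP; split => z /=; rewrite in_itv/= andbT.
Qed.

Variables (k K : R -> R) (s0 s1 : R).
Hypotheses (s0_gt0 : 0 < s0) (s01 : s0 < s1).
Hypothesis dK : forall s, s0 <= s <= s1 -> is_derive s 1 K (k s).
Hypothesis ck : forall s, s0 <= s <= s1 -> {for s, continuous k}.
Hypothesis k_ge0 : forall s, s0 <= s <= s1 -> 0 <= k s.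

Let nsqE x t : nsq (x, x * t) = x ^+ 2 * (1 + t ^+ 2) :> R.
Proof. by rewrite /nsq/= exprMn; ring. Qed.

Let dK_ge0 : 0 <= (K s1 - K s0) / 2.
Proof.
rewrite divr_ge0// subr_ge0.
apply: (@ger0_derive1_le_cc R K s0 s1); rewrite ?in_itv/= ?lexx ?ltW//.
- by move=> s /subset_itv_oo_cc/= /[!in_itv]/= /dK ?; exact: ex_derive.
- move=> s /subset_itv_oo_cc/= /[!in_itv]/= ss; have := dK ss => ?.
  by rewrite derive1E derive_val; exact: k_ge0.
- apply: continuous_in_subspaceT => s; rewrite inE/= in_itv/= => /dK ds.
  by apply: differentiable_continuous; apply/derivable1_diffP; exact: ex_derive.
Qed.

(** All slopes occur, and [1 / (1 + t ^ 2)] has integral [pi] over the line. *)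
Lemma half_plane_radial_integral :
  (\int[leb2]_(z in [set z | (0 < z.1)%R] `&` [set z | (s0 <= nsq z <= s1)%R])
     (k (nsq z))%:E = (pi / 2 * (K s1 - K s0))%:E)%E.
Proof.
rewrite (slope_radial_integral s0_gt0 s01 dK ck k_ge0 (B := setT))//; last 3 first.
- by apply: measurableI; [exact: measurable_right_half|exact: measurable_nsq_itv].
- by move=> z [].
- by move=> x t x0; rewrite -nsqE; split => [[]|[]].
under eq_integral do rewrite EFinM.
rewrite ge0_integralZl//.
- by rewrite integral_oneDsqrV_T -EFinM; congr _%:E; ring.
- apply/measurable_EFinP; exact: continuous_measurable_fun cOneDsqrV.
- by move=> x _; rewrite lee_fin invr_ge0 addr_ge0// sqr_ge0.
Qed.

Lemma measurable_cone (b : R) : measurable [set z : R2 | (`|z.2| <= b * z.1)%R].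
Proof.
rewrite (_ : mkset _ = (fun z : R2 => b * z.1 - `|z.2|)%R @^-1` `[0, +oo[%classic).
  rewrite -[X in measurable X]setTI.
  apply: (_ : measurable_fun _ _) => //.
  apply: measurable_funB; first exact: measurable_funM.
  exact: measurableT_comp.
by apply/seteqP; split => z /=; rewrite in_itv/= andbT subr_ge0.
Qed.

(** Only the slopes in [[- b, b]] occur. *)
Lemma cone_radial_integral (b : R) : 0 < b ->
  (\int[leb2]_(z in [set z | (0 < z.1)%R /\ (`|z.2| <= b * z.1)%R]
        `&` [set z | (s0 <= nsq z <= s1)%R])
     (k (nsq z))%:E = (atan b * (K s1 - K s0))%:E)%E.
Proof.
move=> b0.
rewrite (slope_radial_integral s0_gt0 s01 dK ck k_ge0 (B := `[- b, b]%classic))//; last 3 first.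
- apply: measurableI; last exact: measurable_nsq_itv.
  by apply: measurableI; [exact: measurable_right_half|exact: measurable_cone].
- by move=> z [[]].
- move=> x t x0; rewrite -nsqE /=.
  have -> : (`|x * t| <= b * x) = (t \in `[- b, b]).
    by rewrite normrM gtr0_norm// mulrC ler_pM2r// in_itv/= ler_norml.
  by split => [[[]]|[]].
under eq_integral do rewrite EFinM.
rewrite ge0_integralZl//.
- by rewrite integral_oneDsqrV_sym// -EFinM; congr _%:E; field.
- by apply: measurable_funTS; apply/measurable_EFinP; exact: continuous_measurable_fun cOneDsqrV.
- by move=> x _; rewrite lee_fin invr_ge0 addr_ge0// sqr_ge0.
Qed.

(** The two open half-planes contribute equally and the line between them is a
   null set. *)
Lemma annulus_radial_integral :
  (\int[leb2]_(z in [set z | (s0 <= nsq z <= s1)%R])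
     (k (nsq z))%:E = (pi * (K s1 - K s0))%:E)%E.
Proof.
pose S := [set z : R2 | (s0 <= nsq z <= s1)%R].
have mS : measurable S by exact: measurable_nsq_itv.
pose f : R2 -> \bar R := (fun z => (k (nsq z))%:E) \_ S.
have fE z : f z = if s0 <= nsq z <= s1 then (k (nsq z))%:E else 0%E.
  rewrite /f patchE; case: ifPn; rewrite ?inE ?notin_setE /S/=; first by move=> ->.
  by move=> /negP/negbTE ->.
have f0 z : (0 <= f z)%E.
  by rewrite /f patchE; case: ifPn => //; rewrite inE lee_fin => /k_ge0.
have mf : measurable_fun setT f.
  apply/(measurable_restrictT _ mS)/measurable_EFinP.
  apply: (@measurable_comp _ _ _ _ _ _ `[s0, s1]%classic) => //.
  - by move=> _ [z zs <-]/=; rewrite in_itv.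
  - apply: subspace_continuous_measurable_fun => //.
    by apply: continuous_in_subspaceT => x; rewrite inE/= in_itv/=; exact: ck.
  - exact: measurable_funTS measurable_nsq.
rewrite integral_mkcond -/f (leb2_tonelli1 mf f0) ge0_integral_even; last 3 first.
- exact: (measurable_fun_fubini_tonelli_F f).
- by move=> x; exact: integral_ge0.
- move=> x; apply: eq_integral => y _; rewrite !fE.
  have nE : nsq (- x, y) = nsq (x, y) by rewrite /nsq/= sqrrN.
  by rewrite nE.
suff -> : (\int[mu]_(x in `]0%R, +oo[) \int[mu]_y f (x, y) =
    (pi / 2 * (K s1 - K s0))%:E)%E.
  by rewrite -EFinD; congr _%:E; field.
rewrite -half_plane_radial_integral integral_mkcondr -/f [RHS]integral_mkcond.
have mH : measurable [set z : R2 | 0 < z.1] by exact: measurable_right_half.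
rewrite leb2_tonelli1; last 2 first.
- by apply/(measurable_restrictT _ mH); exact: measurable_funTS.
- by move=> z; rewrite patchE; case: ifPn.
rewrite integral_mkcond; apply: eq_integral => x _; rewrite patchE.
case: ifPn; rewrite ?inE ?notin_setE/= in_itv/= andbT => x0.
  by apply: eq_integral => y _; rewrite [RHS]patchE ifT// inE.
by rewrite integral0_eq// => y _; rewrite patchE ifF//; apply/negbTE; rewrite notin_setE.
Qed.

End PlaneIntegrals.

(** * Smooth functions on C^2 *)

Section Smooth.
Context {R : realType}.
Local Notation X := (C2 R).
Implicit Types (f g : X -> R) (U V : set X) (x v : X).

(** Differentiability is local; it is first seen for the difference of two
   functions that agree near [x]. *)
Lemma near0_differentiable f x : (\forall y \near x, f y = 0) -> differentiable f x.
Proof.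
move=> f0; have fx : f x = 0 by exact: (nbhs_singleton f0).
have fs : \forall y \near (0 : X), f (y + x) = 0.
  by move: f0; rewrite (near_shift 0) subr0.
have c0 : continuous (\0 : X -> R) by move=> y; exact: cvg_cst.
have D0 : 'd f x = \0 :> (X -> R).
  apply/diff_unique; first exact: c0.
  apply/eqaddoP => e e0; near=> y; rewrite !fctE fx /= add0r subr0 (near fs y)//.
  by rewrite normr0 mulr_ge0// ltW.
apply/diff_locallyP; split; rewrite D0//.
apply/eqaddoP => e e0; near=> y; rewrite !fctE fx /= add0r subr0 (near fs y)//.
by rewrite normr0 mulr_ge0// ltW.
Unshelve. all: by end_near. Qed.

Lemma near_eq_differentiable f g x : (\forall y \near x, f y = g y) ->
  differentiable f x -> differentiable g x.
Proof.
move=> fg df; rewrite (_ : g = f + (g - f)); last by rewrite addrC subrK.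
apply: differentiableD => //; apply: near0_differentiable.
by near=> y; rewrite !fctE -(near fg y)// subrr.
Unshelve. all: by end_near. Qed.

Lemma Cn_ext n U f g : open U -> (forall x, U x -> f x = g x) ->
  Cn_on n U f -> Cn_on n U g.
Proof.
move=> oU; have nU x (P : X -> Prop) : (forall y, U y -> P y) -> U x ->
    \forall y \near x, P y.
  by move=> UP Ux; near=> y; apply: UP; near: y; exact: open_nbhs_nbhs.
elim: n f g => [|n IH] f g fg /=.
  move=> cf x Ux; have cfx : f @ x --> f x := cf x Ux.
  rewrite /prop_for /continuous_at -fg//.
  by apply: cvg_trans cfx; apply: near_eq_cvg; apply: nU => // y /fg.
move=> [df Df]; split=> [x Ux|v].
  by apply: near_eq_differentiable (df x Ux); exact: nU.
apply: IH (Df v) => x Ux; apply: near_eq_derive; exact: nU.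
Unshelve. all: by end_near. Qed.

Lemma CnU n U V f : Cn_on n U f -> Cn_on n V f -> Cn_on n (U `|` V) f.
Proof.
elim: n f => [|n IH] f /=; first by move=> fU fV x [/fU|/fV].
move=> [dU DU] [dV DV]; split=> [x [/dU|/dV]//|v]; exact: IH.
Qed.

Lemma CnW n U f : Cn_on n.+1 U f -> Cn_on n U f.
Proof.
elim: n f => [|n IH] f [df Df].
  by move=> x /df; exact: differentiable_continuous.
by split => // v; apply: IH; exact: Df.
Qed.

Lemma Cn_subset n U V f : U `<=` V -> Cn_on n V f -> Cn_on n U f.
Proof.
move=> UV; elim: n f => [|n IH] f /=; first by move=> fV x /UV/fV.
by move=> [df Df]; split=> [x /UV/df//|v]; exact: IH.
Qed.

Lemma Cn_cst n U (a : R) : Cn_on n U (fun=> a).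
Proof.
elim: n a => [|n IH] a /=; first by move=> x _; exact: cvg_cst.
split=> [x _|v]; first exact: differentiable_cst.
rewrite (_ : 'D_v _ = fun=> 0); first exact: IH.
by apply/funext => x; rewrite derive_cst.
Qed.

Lemma CnD n U f g : open U -> Cn_on n U f -> Cn_on n U g ->
  Cn_on n U (fun x => f x + g x).
Proof.
move=> oU; elim: n f g => [|n IH] f g /=.
  by move=> cf cg x Ux; apply: continuousD; [exact: cf|exact: cg].
move=> [df Df] [dg Dg]; split=> [x Ux|v].
  by apply: differentiableD; [exact: df|exact: dg].
apply: (@Cn_ext _ _ (fun x => 'D_v f x + 'D_v g x)) => //; last first.
  by apply: IH; [exact: Df|exact: Dg].
move=> x Ux; apply/esym; apply: (@deriveD _ _ _ f g x v).
  by apply: diff_derivable; exact: df.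
by apply: diff_derivable; exact: dg.
Qed.

Lemma CnM n U f g : open U -> Cn_on n U f -> Cn_on n U g ->
  Cn_on n U (fun x => f x * g x).
Proof.
move=> oU; elim: n f g => [|n IH] f g.
  by move=> cf cg x Ux; apply: continuousM; [exact: cf|exact: cg].
move=> cf cg; have [df Df] := cf; have [dg Dg] := cg.
split=> [x Ux|v].
  by apply: differentiableM; [exact: df|exact: dg].
apply: (@Cn_ext _ _ (fun x => f x * 'D_v g x + g x * 'D_v f x)) => //.
  move=> x Ux; apply/esym; apply: (@deriveM _ _ f g x v).
    by apply: diff_derivable; exact: df.
  by apply: diff_derivable; exact: dg.
apply: CnD => //; apply: IH.
- exact: CnW.
- exact: Dg.
- exact: CnW.
- exact: Df.
Qed.

Lemma Cn_linear n U (f : {linear X -> R}) : continuous f -> Cn_on n U f.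
Proof.
move=> cf; elim: n => [|n _] /=; first by move=> x _; exact: cf.
split=> [x _|v]; first exact: linear_differentiable.
rewrite (_ : 'D_v f = fun=> f v); first exact: Cn_cst.
apply/funext => x; rewrite deriveE; last exact: linear_differentiable.
by rewrite diff_lin.
Qed.

(** A class of functions closed under differentiation on [V] consists of smooth
   functions; this is how concrete one-variable functions are proved smooth. *)
Definition smooth1 (V : set R) (h : R -> R) := exists2 P : (R -> R) -> Prop,
  P h & forall k, P k -> exists2 k', P k' & forall s, V s -> is_derive s 1 k (k' s).

Lemma derive_comp1 (h dh : R -> R) f x v : differentiable f x ->
  is_derive (f x) 1 h (dh (f x)) ->
  differentiable (h \o f) x /\ 'D_v (h \o f) x = dh (f x) * 'D_v f x.
Proof.
move=> df dhx; have dhx' : differentiable h (f x).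
  by apply/derivable1_diffP; exact: ex_derive.
split; first exact: differentiable_comp.
rewrite deriveE; last exact: differentiable_comp.
have dd : derivable h (f x) 1 by exact: ex_derive.
rewrite (diff_comp df dhx') /= (deriv1E dd) derive1E.
by rewrite (@derive_val _ _ _ _ _ _ _ dhx) -deriveE// /GRing.scale/= mulrC.
Qed.

Lemma Cn_comp1 n (V : set R) U h f : smooth1 V h -> open U ->
  (forall x, U x -> V (f x)) -> Cn_on n U f -> Cn_on n U (h \o f).
Proof.
move=> [P Ph PP] oU UV; elim: n h Ph => [|n IH] h Ph.
  move=> cf x Ux; apply: continuous_comp; first exact: cf.
  have [h' _ dh] := PP _ Ph; have dhx := dh _ (UV _ Ux).
  by apply: differentiable_continuous; apply/derivable1_diffP; exact: ex_derive.
have [h' Ph' dh] := PP _ Ph.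
move=> cf; have [df Df] := cf; split=> [x Ux|v].
  by have [] := derive_comp1 0 (df x Ux) (dh _ (UV _ Ux)).
apply: (@Cn_ext _ _ (fun x => (h' \o f) x * 'D_v f x)) => //.
  by move=> x Ux; have [_ ->] := derive_comp1 v (df x Ux) (dh _ (UV _ Ux)).
apply: CnM => //; last exact: Df.
by apply: IH => //; exact: CnW.
Qed.

End Smooth.

Section SmoothExamples.
Context {R : realType}.
Local Notation X := (C2 R).
Implicit Types (U : set X) (x v : X).

Let lin11 : linear (fun x : X => x.1.1). Proof. by []. Qed.
Let lin12 : linear (fun x : X => x.1.2). Proof. by []. Qed.
Let lin21 : linear (fun x : X => x.2.1). Proof. by []. Qed.
Let lin22 : linear (fun x : X => x.2.2). Proof. by []. Qed.

Lemma continuous_x1 : continuous (fun x : X => x.1.1).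
Proof. by move=> x; apply: continuous_comp; exact: cvg_fst. Qed.
Lemma continuous_y1 : continuous (fun x : X => x.1.2).
Proof. by move=> x; apply: continuous_comp; [exact: cvg_fst|exact: cvg_snd]. Qed.
Lemma continuous_x2 : continuous (fun x : X => x.2.1).
Proof. by move=> x; apply: continuous_comp; [exact: cvg_snd|exact: cvg_fst]. Qed.
Lemma continuous_y2 : continuous (fun x : X => x.2.2).
Proof. by move=> x; apply: continuous_comp; [exact: cvg_snd|exact: cvg_snd]. Qed.

Let coord (f : X -> R) (lf : linear f) : {linear X -> R} :=
  HB.pack f (GRing.isLinear.Build R X R _ f lf).

Lemma Cn_x1 n U : Cn_on n U (fun x => x.1.1).
Proof. exact: (@Cn_linear _ n U (coord lin11) continuous_x1). Qed.
Lemma Cn_y1 n U : Cn_on n U (fun x => x.1.2).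
Proof. exact: (@Cn_linear _ n U (coord lin12) continuous_y1). Qed.
Lemma Cn_x2 n U : Cn_on n U (fun x => x.2.1).
Proof. exact: (@Cn_linear _ n U (coord lin21) continuous_x2). Qed.
Lemma Cn_y2 n U : Cn_on n U (fun x => x.2.2).
Proof. exact: (@Cn_linear _ n U (coord lin22) continuous_y2). Qed.

Lemma is_derive_x1 x v : is_derive x v (fun x : X => x.1.1) v.1.1.
Proof.
have d : differentiable (fun x : X => x.1.1) x.
  exact: (linear_differentiable (f := coord lin11) x continuous_x1).
apply: DeriveDef; first exact: diff_derivable.
by rewrite deriveE// (diff_lin (f := coord lin11) x continuous_x1).
Qed.
Lemma is_derive_y1 x v : is_derive x v (fun x : X => x.1.2) v.1.2.
Proof.
have d : differentiable (fun x : X => x.1.2) x.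
  exact: (linear_differentiable (f := coord lin12) x continuous_y1).
apply: DeriveDef; first exact: diff_derivable.
by rewrite deriveE// (diff_lin (f := coord lin12) x continuous_y1).
Qed.
Lemma is_derive_x2 x v : is_derive x v (fun x : X => x.2.1) v.2.1.
Proof.
have d : differentiable (fun x : X => x.2.1) x.
  exact: (linear_differentiable (f := coord lin21) x continuous_x2).
apply: DeriveDef; first exact: diff_derivable.
by rewrite deriveE// (diff_lin (f := coord lin21) x continuous_x2).
Qed.
Lemma is_derive_y2 x v : is_derive x v (fun x : X => x.2.2) v.2.2.
Proof.
have d : differentiable (fun x : X => x.2.2) x.
  exact: (linear_differentiable (f := coord lin22) x continuous_y2).
apply: DeriveDef; first exact: diff_derivable.
by rewrite deriveE// (diff_lin (f := coord lin22) x continuous_y2).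
Qed.

Lemma is_derive_powN (a s : R) n : 0 < s ->
  is_derive s 1 (fun s => a * s ^- n) (- (a *+ n) * s ^- n.+1).
Proof.
move=> s0; have s1 : s ^+ n != 0 by rewrite expf_neq0// gt_eqF.
have d : is_derive s 1 (fun s => s ^- n) (- (s ^+ n) ^- 2 *: (n%:R * s ^+ n.-1)).
  apply: (@is_deriveV R (fun s : R => s ^+ n) s _ 1 s1).
  apply: DeriveDef; first exact: exprn_derivable.
  by rewrite -derive1E exp_derive1.
have := @is_deriveZ R R R (fun s : R => s ^- n) a s 1 _ d.
move=> /is_derive_eq; apply; rewrite /GRing.scale/=.
case: n s1 d => [|n] s1 d; first by rewrite mul0r mulr0 mulr0 mulr0n oppr0 mul0r.
by rewrite /= -mulr_natr !exprS; field; rewrite (gt_eqF s0) expf_neq0 ?gt_eqF.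
Qed.

Lemma smooth1_ln : smooth1 [set s : R | 0 < s] (@ln R).
Proof.
exists (fun g => g = @ln R \/ exists a n, g = fun s => a * s ^- n); first by left.
move=> _ [->|[a [n ->]]].
  exists (fun s => 1 * s ^- 1); first by right; exists 1, 1%N.
  by move=> s s0; rewrite mul1r; exact: is_derive1_ln.
exists (fun s => - (a *+ n) * s ^- n.+1); first by right; exists (- (a *+ n)), n.+1.
by move=> s s0; exact: is_derive_powN.
Qed.

Lemma smooth1_inv : smooth1 [set s : R | 0 < s] (fun s => s^-1).
Proof.
exists (fun g => exists a n, g = fun s => a * s ^- n).
  by exists 1, 1%N; apply/funext => s; rewrite mul1r.
move=> _ [a [n ->]].
exists (fun s => - (a *+ n) * s ^- n.+1); first by exists (- (a *+ n)), n.+1.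
by move=> s s0; exact: is_derive_powN.
Qed.

(** The flat function [exp (- d / y)] with a polynomial factor in [1 / y]; the
   factor makes the class closed under differentiation. *)
Definition flat_poly (d : R) (p : {poly R}) (y : R) : R :=
  if 0 < y then p.[y^-1] * expR (- (d / y)) else 0.

Let powM_expRN_le (d u : R) m : 0 < d -> 0 < u ->
  u ^+ m * expR (- (d * u)) <= m`!%:R / d ^+ m.
Proof.
move=> d0 u0; have du : 0 <= d * u by rewrite mulr_ge0 ?ltW.
have h : (d * u) ^+ m / m`!%:R <= expR (d * u).
  case: m => [|m]; first by rewrite expr0 divr1 -expR0 ler_expR.
  by rewrite (le_trans _ (expR_ge1Dxn m du))// lerDr.
rewrite expRN ler_pdivrMr ?expR_gt0// mulrAC ler_pdivlMr ?exprn_gt0//.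
move: h; rewrite ler_pdivrMr ?ltr0n ?fact_gt0// exprMn.
by rewrite [_ * m`!%:R]mulrC [d ^+ m * _]mulrC.
Qed.

(** The exponential absorbs every power of [u = 1 / y]; the power [u ^+ m] makes
   the induction on the polynomial go through. *)
Let flat_poly_bounded (d : R) (p : {poly R}) m : 0 < d ->
  exists C, forall u, 0 < u -> `|p.[u]| * u ^+ m * expR (- (d * u)) <= C.
Proof.
move=> d0; elim/poly_ind: p m => [|p c IH] m.
  by exists 0 => u u0; rewrite horner0 normr0 !mul0r.
have [C HC] := IH m.+1.
exists (C + `|c| * (m`!%:R / d ^+ m)) => u u0.
rewrite hornerMXaddC.
apply: le_trans (_ : (`|p.[u] * u| + `|c|) * u ^+ m * expR (- (d * u)) <= _).
  by rewrite ler_wpM2r ?expR_ge0// ler_wpM2r ?exprn_ge0 ?(ltW u0)// ler_normD.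
rewrite -mulrA mulrDl lerD//; last by rewrite ler_wpM2l// powM_expRN_le.
by rewrite normrM (gtr0_norm u0) mulrA -(mulrA _ u) -exprS HC.
Qed.

Let dflat (d : R) (p : {poly R}) : {poly R} := 'X^2 * (d *: p - p^`()).

Lemma is_derive_flat_poly (d : R) (p : {poly R}) (y : R) : 0 < d ->
  is_derive y 1 (flat_poly d p) (flat_poly d (dflat d p) y).
Proof.
move=> d0; have [y0|y0|y0] := ltgtP y 0.
- have -> : flat_poly d (dflat d p) y = 0 by rewrite /flat_poly ltNge (ltW y0).
  apply: (@near_eq_is_derive R R R (cst (0 : R))).
  near=> z; have z0 : z < 0 by near: z; exact: lt_nbhsl.
  by rewrite /flat_poly ltNge (ltW z0).
- have yn : y != 0 by rewrite gt_eqF.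
  have dV : is_derive y 1 (fun y : R => y^-1) (- y ^- 2).
    have := @is_derive_powN 1 y 1 y0; rewrite mulr1n mulN1r.
    by rewrite (_ : (fun s => 1 * s ^- 1) = (fun s => s^-1))//; apply/funext => s; rewrite mul1r.
  have dp : is_derive y 1 (fun y : R => p.[y^-1]) (p^`().[y^-1] * - y ^- 2).
    exact: (@is_derive1_comp R (horner p) (fun y => y^-1)).
  have dd : is_derive y 1 (fun y : R => - (d / y)) (d * y ^- 2).
    have := @is_deriveN R R R _ y 1 _ (@is_deriveZ R R R _ d y 1 _ dV).
    by move=> /is_derive_eq; apply; rewrite /GRing.scale/= mulrN opprK.
  have de : is_derive y 1 (fun y : R => expR (- (d / y))) (expR (- (d / y)) * (d * y ^- 2)).
    exact: (@is_derive1_comp R expR (fun y => - (d / y))).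
  have dm : is_derive y 1 (fun y => p.[y^-1] * expR (- (d / y))) (flat_poly d (dflat d p) y).
    have := @is_deriveM R R _ _ y 1 _ _ dp de.
    move=> /is_derive_eq; apply; rewrite /flat_poly y0 /GRing.scale/= /dflat.
    rewrite hornerM hornerXn hornerD hornerN hornerZ; field; exact: yn.
  apply: near_eq_is_derive dm; near=> z.
  have z0 : 0 < z by near: z; exact: lt_nbhsr.
  by rewrite /flat_poly z0.
- have -> : flat_poly d (dflat d p) y = 0 by rewrite /flat_poly y0 ltxx.
  rewrite y0.
  have [C HC] := flat_poly_bounded p 2 d0.
  have C0 : 0 <= C.
    by rewrite (le_trans _ (HC 1 ltr01))// !mulr_ge0 ?expR_ge0.
  (* The difference quotient is [h] times a bounded function of [1 / h]. *)
  have Hlim : (fun h : R => h^-1 *: (flat_poly d p (h *: 1 + 0) - flat_poly d p 0))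
      @ 0^' --> (0 : R).
    apply/cvgr0Pnorm_le => e e0; near=> h.
    rewrite /flat_poly ltxx subr0 addr0 /GRing.scale/= mulr1.
    case: ifPn => h0; last by rewrite mulr0 normr0 ltW.
    rewrite !normrM (gtr0_norm (expR_gt0 _)) gtr0_norm ?invr_gt0//.
    have hC : h * C <= e.
      have : `|h| <= e / (C + 1).
        near: h; apply: dnbhs0_le; rewrite divr_gt0//; lra.
      rewrite gtr0_norm// ler_pdivlMr; last lra.
      apply: le_trans; rewrite ler_wpM2l ?ltW//; lra.
    apply: le_trans hC; have := HC h^-1; rewrite invr_gt0 => /(_ h0).
    rewrite -(ler_pM2l h0); apply: le_trans.
    by rewrite le_eqVlt; apply/orP; left; apply/eqP; field; rewrite gt_eqF.
  apply: DeriveDef; first by apply/cvg_ex; exists 0.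
  by apply/cvg_lim.
Unshelve. all: by end_near. Qed.

Lemma smooth1_flat_poly (d : R) (p : {poly R}) : 0 < d ->
  smooth1 setT (flat_poly d p).
Proof.
move=> d0; exists (fun g => exists p, g = flat_poly d p); first by exists p.
move=> _ [q ->]; exists (flat_poly d (dflat d q)); first by exists (dflat d q).
by move=> s _; exact: is_derive_flat_poly.
Qed.

End SmoothExamples.

(** * Symmetry of second derivatives *)

Section Schwarz.
Context {R : realType}.

Let subrACA (a b c d : R) : a - b - (c - d) = a - c - (b - d).
Proof. ring. Qed.

Local Notation X := (C2 R).
Implicit Types (f : X -> R) (x v w p : X).

Lemma is_derive_line f p v (s : R) : derivable f (p + s *: v) v ->
  is_derive s 1 (fun s : R => f (p + s *: v)) ('D_v f (p + s *: v)).
Proof.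
move=> df.
have E : (fun h : R => h^-1 *: (((fun s : R => f (p + s *: v)) \o shift s) (h *: 1)
    - f (p + s *: v))) =
  (fun h : R => h^-1 *: ((f \o shift (p + s *: v)) (h *: v) - f (p + s *: v))).
  apply/funext => h /=; rewrite (_ : h *: (1 : R) = h); last exact: mulr1.
  by rewrite scalerDl addrCA.
by apply: DeriveDef; [rewrite /derivable E|rewrite /derive E].
Qed.

(** The mean value theorem, first along [v] and then along [w]. *)
Let second_difference f x v w (h : R) : 0 < h -> Cn_on 2 setT f ->
  exists s t : R, [/\ 0 < s < h, 0 < t < h &
    f (x + h *: v + h *: w) - f (x + h *: v) - (f (x + h *: w) - f x) =
    h ^+ 2 * 'D_w ('D_v f) (x + s *: v + t *: w)].
Proof.
move=> h0 [df Df].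
have dv p : derivable f p v by apply: diff_derivable; exact: df.
pose g (s : R) := f (x + h *: w + s *: v) - f (x + s *: v).
pose dg (s : R) := 'D_v f (x + h *: w + s *: v) - 'D_v f (x + s *: v).
have gd (s : R) : is_derive s 1 g (dg s).
  by apply: is_deriveB; exact: is_derive_line.
have gc : {within `[0, h], continuous g}.
  apply: derivable_within_continuous => s _; exact: ex_derive.
have [s] := MVT h0 (fun s _ => gd s) gc.
rewrite in_itv/= => sh; rewrite /g !scale0r !addr0 subr0 => gE.
have [dDf DDf] := Df v.
have dw p : derivable ('D_v f) p w by apply: diff_derivable; exact: dDf.
pose k (t : R) := 'D_v f (x + s *: v + t *: w).
pose dk (t : R) := 'D_w ('D_v f) (x + s *: v + t *: w).
have kd (t : R) : is_derive t 1 k (dk t) by exact: is_derive_line.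
have kc : {within `[0, h], continuous k}.
  apply: derivable_within_continuous => t _; exact: ex_derive.
have [t] := MVT h0 (fun t _ => kd t) kc.
rewrite in_itv/= => th; rewrite /k scale0r addr0 subr0 => kE.
exists s, t; split=> //.
rewrite -[in LHS](addrAC x) gE /dg addrAC kE /dk; ring.
Qed.

Let eq_at_limit (F G : X -> R) x : {for x, continuous F} -> {for x, continuous G} ->
  (forall d, 0 < d -> exists y y', [/\ ball x d y, ball x d y' & F y = G y']) ->
  F x = G x.
Proof.
move=> cF cG H; apply/eqP; rewrite -subr_eq0 -normr_le0; apply/ler_addgt0Pl => e e0.
rewrite addr0; have e20 : 0 < e / 2 by rewrite divr_gt0.
have /cvgrPdist_lt/(_ _ e20)/nbhs_ballP[d1 /= d10 H1] : F @ x --> F x := cF.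
have /cvgrPdist_lt/(_ _ e20)/nbhs_ballP[d2 /= d20 H2] : G @ x --> G x := cG.
have d0 : 0 < Num.min d1 d2 by rewrite lt_min d10.
have [y [y' [xy xy' E]]] := H _ d0.
have m1 : Num.min d1 d2 <= d1 by rewrite ge_min lexx.
have m2 : Num.min d1 d2 <= d2 by rewrite ge_min lexx orbT.
have b1 : `|F x - F y| < e / 2 := H1 _ (le_ball m1 xy).
have b2 : `|G x - G y'| < e / 2 := H2 _ (le_ball m2 xy').
rewrite (le_trans (ler_distD (G y') _ _))// [leRHS]splitr lerD//.
  by rewrite -E ltW.
by rewrite distrC ltW.
Qed.

(** The mixed second difference over a small parallelogram is, by the mean
   value theorem used in either order, a value of each iterated derivative. *)
Lemma derive_comm f x v w : Cn_on 2 setT f ->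
  'D_v ('D_w f) x = 'D_w ('D_v f) x.
Proof.
move=> cf; have [_ Df] := cf.
have c1 : {for x, continuous ('D_v ('D_w f))} by have [_ DD] := Df w; exact: DD.
have c2 : {for x, continuous ('D_w ('D_v f))} by have [_ DD] := Df v; exact: DD.
apply: eq_at_limit c1 c2 _ => d d0.
pose L := `|v| + `|w| + 1; have L0 : 0 < L by rewrite ltr_wpDl// addr_ge0.
pose h := d / L; have h0 : 0 < h by rewrite divr_gt0.
have B s t a b : 0 < s < h -> 0 < t < h -> `|a| + `|b| + 1 = L ->
    ball x d (x + s *: a + t *: b).
  move=> /andP[s0 sh] /andP[t0 th] ab.
  rewrite -ball_normE/= -addrA opprD addNKr normrN (le_lt_trans (ler_normD _ _))//.
  rewrite !normrZ !gtr0_norm//.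
  have -> : d = h * L by rewrite /h divfK// gt_eqF.
  rewrite -ab !mulrDr mulr1 -addrA ler_ltD//.
    by rewrite ler_wpM2r// ltW.
  by rewrite (le_lt_trans (_ : _ <= h * `|b|)) ?ltrDl// ler_wpM2r// ltW.
have [s [t [sh th E1]]] := second_difference x v w h0 cf.
have [s' [t' [sh' th' E2]]] := second_difference x w v h0 cf.
have Lwv : `|w| + `|v| + 1 = L by rewrite /L [`|w| + _]addrC.
exists (x + s' *: w + t' *: v), (x + s *: v + t *: w); split.
- exact: (B _ _ w v sh' th' Lwv).
- exact: (B _ _ v w sh th erefl).
apply: (mulfI (_ : h ^+ 2 != 0)); first by rewrite expf_neq0// gt_eqF.
apply: etrans (esym E2) (etrans _ E1); rewrite (addrAC x (h *: w)); exact: subrACA.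
Qed.

End Schwarz.

(** * Wirtinger derivatives of test functions *)

Section TestFunctions.
Context {R : realType}.
Local Notation X := (C2 R).
Local Notation Re := (@complex.Re R).
Local Notation Im := (@complex.Im R).
Implicit Types (phi : X -> R[i]) (D : set X) (x v : X) (j : 'I_2).

Lemma cplx_eq (a b : R[i]) : Re a = Re b -> Im a = Im b -> a = b.
Proof. by case: a b => [? ?] [? ?] /= -> ->. Qed.

Lemma cReM (a b : R[i]) : Re (a * b) = Re a * Re b - Im a * Im b.
Proof. by case: a b => [? ?] [? ?]. Qed.
Lemma cImM (a b : R[i]) : Im (a * b) = Re a * Im b + Im a * Re b.
Proof. by case: a b => [? ?] [? ?]. Qed.
Lemma cReD (a b : R[i]) : Re (a + b) = Re a + Re b.
Proof. by case: a b => [? ?] [? ?]. Qed.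
Lemma cImD (a b : R[i]) : Im (a + b) = Im a + Im b.
Proof. by case: a b => [? ?] [? ?]. Qed.
Lemma cReN (a : R[i]) : Re (- a) = - Re a. Proof. by case: a. Qed.
Lemma cImN (a : R[i]) : Im (- a) = - Im a. Proof. by case: a. Qed.

Let half_complex : (2%:R^-1 : R[i]) = 2^-1 +i* 0.
Proof.
apply: (mulfI (_ : (2%:R : R[i]) != 0)); first by rewrite pnatr_eq0.
rewrite divff ?pnatr_eq0//; apply: cplx_eq; rewrite ?cReM ?cImM.
  have -> : Re 2%:R = 2 by rewrite -(natr1 1) cReD.
  by rewrite mulr0 subr0 mulfV ?pnatr_eq0.
have -> : Im 2%:R = 0 by rewrite -(natr1 1) cImD addr0.
by rewrite mulr0 mul0r addr0.
Qed.

Lemma dzbar_Re j phi x : Re (dzbar j phi x) =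
  2^-1 * ('D_(dirx j) (fun y => Re (phi y)) x - 'D_(diry j) (fun y => Im (phi y)) x).
Proof.
by rewrite /dzbar half_complex cReM cReD cReM/= /cderive/= !mul0r subr0 mul1r sub0r.
Qed.

Lemma dzbar_Im j phi x : Im (dzbar j phi x) =
  2^-1 * ('D_(dirx j) (fun y => Im (phi y)) x + 'D_(diry j) (fun y => Re (phi y)) x).
Proof.
by rewrite /dzbar half_complex cImM cImD cImM/= /cderive/= !mul0r addr0 mul1r add0r.
Qed.

Let dzbar_ReE j phi : (fun x => Re (dzbar j phi x)) =
  fun x => 2^-1 * 'D_(dirx j) (fun y => Re (phi y)) x
      + - 2^-1 * 'D_(diry j) (fun y => Im (phi y)) x.
Proof. by apply/funext => x; rewrite dzbar_Re mulrBr mulNr. Qed.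

Let dzbar_ImE j phi : (fun x => Im (dzbar j phi x)) =
  fun x => 2^-1 * 'D_(dirx j) (fun y => Im (phi y)) x
      + 2^-1 * 'D_(diry j) (fun y => Re (phi y)) x.
Proof. by apply/funext => x; rewrite dzbar_Im mulrDr. Qed.

Lemma smooth_comb (a b : R) (f g : X -> R) : smooth_on setT f -> smooth_on setT g ->
  smooth_on setT (fun x => a * f x + b * g x).
Proof.
move=> sf sg n; apply: CnD; first exact: openT.
  by apply: CnM; [exact: openT|exact: Cn_cst|exact: sf].
by apply: CnM; [exact: openT|exact: Cn_cst|exact: sg].
Qed.

Lemma smooth_derive f v : smooth_on (setT : set X) f -> smooth_on setT ('D_v f).
Proof. by move=> sf n; have [_ H] := sf n.+1; exact: H. Qed.

Lemma smooth_differentiable f x : smooth_on (setT : set X) f -> differentiable f x.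
Proof. by move=> sf; have [H _] := sf 1%N; exact: H. Qed.

Lemma smooth_derivable f x v : smooth_on (setT : set X) f -> derivable f x v.
Proof. by move=> sf; apply/diff_derivable/smooth_differentiable. Qed.

Let derive_comb (a b : R) (f g : X -> R) v x : smooth_on setT f -> smooth_on setT g ->
  'D_v (fun x => a * f x + b * g x) x = a * 'D_v f x + b * 'D_v g x.
Proof.
move=> sf sg; have df : derivable f x v by exact: smooth_derivable.
have dg : derivable g x v by exact: smooth_derivable.
have dfa : derivable (a \*: f) x v by exact: derivableZ.
have dgb : derivable (b \*: g) x v by exact: derivableZ.
apply: etrans (deriveD dfa dgb) _; rewrite deriveZ// deriveZ//.
Qed.

Lemma smooth_continuous f : smooth_on (setT : set X) f -> continuous f.
Proof. by move=> sf x; exact: (sf 0%N). Qed.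

Lemma hausdorff_C2 : hausdorff_space X.
Proof. exact: norm_hausdorff. Qed.

Lemma test_function_dzbar D j phi : test_function D phi -> test_function D (dzbar j phi).
Proof.
move=> [sR sI [K [cK KD K0]]]; split.
- by rewrite dzbar_ReE; apply: smooth_comb; exact: smooth_derive.
- by rewrite dzbar_ImE; apply: smooth_comb; exact: smooth_derive.
- exists K; split=> // x Kx.
  have oK : open (~` K) by apply: closed_openC; exact: compact_closed hausdorff_C2 cK.
  have D0 (g : R[i] -> R) v : g 0 = 0 -> 'D_v (fun y => g (phi y)) x = 0.
    move=> g0; rewrite (@near_eq_derive _ _ _ _ (cst (0 : R))) ?derive_cst//.
    near=> y; rewrite K0//; near: y; exact: open_nbhs_nbhs.
  by apply: cplx_eq; rewrite ?dzbar_Re ?dzbar_Im !D0// ?addr0 ?subr0 mulr0.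
Unshelve. all: by end_near. Qed.

Let comb4_Re (a b c d : R) : 2^-1 * (2^-1 * a + - 2^-1 * b - (2^-1 * c + 2^-1 * d)) =
  4^-1 * (a - b - c - d).
Proof. by field. Qed.

Let comb4_Im (a b c d : R) : 2^-1 * (2^-1 * a + 2^-1 * b + (2^-1 * c + - 2^-1 * d)) =
  4^-1 * (a + b + c - d).
Proof. by field. Qed.

Let derive_dzbar_Re k phi v x : smooth_on setT (fun x => Re (phi x)) ->
  smooth_on setT (fun x => Im (phi x)) ->
  'D_v (fun x => Re (dzbar k phi x)) x =
  2^-1 * 'D_v ('D_(dirx k) (fun y => Re (phi y))) x +
  - 2^-1 * 'D_v ('D_(diry k) (fun y => Im (phi y))) x.
Proof.
move=> sR sI; apply: etrans (congr1 (fun F => 'D_v F x) (dzbar_ReE k phi)) _.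
exact: (derive_comb _ _ _ _ (smooth_derive (dirx k) sR) (smooth_derive (diry k) sI)).
Qed.

Let derive_dzbar_Im k phi v x : smooth_on setT (fun x => Re (phi x)) ->
  smooth_on setT (fun x => Im (phi x)) ->
  'D_v (fun x => Im (dzbar k phi x)) x =
  2^-1 * 'D_v ('D_(dirx k) (fun y => Im (phi y))) x +
  2^-1 * 'D_v ('D_(diry k) (fun y => Re (phi y))) x.
Proof.
move=> sR sI; apply: etrans (congr1 (fun F => 'D_v F x) (dzbar_ImE k phi)) _.
exact: (derive_comb _ _ _ _ (smooth_derive (dirx k) sI) (smooth_derive (diry k) sR)).
Qed.

Let comb4_sym (a b c d a' b' c' d' : R) : a = a' -> b = c' -> c = b' -> d = d' ->
  4^-1 * (a - b - c - d) = 4^-1 * (a' - b' - c' - d').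
Proof. by move=> -> -> -> ->; congr (_ * (_ - _)); exact: addrAC. Qed.

Let comb4_symP (a b c d a' b' c' d' : R) : a = a' -> b = c' -> c = b' -> d = d' ->
  4^-1 * (a + b + c - d) = 4^-1 * (a' + b' + c' - d').
Proof. by move=> -> -> -> ->; congr (_ * (_ - _)); exact: addrAC. Qed.

Let dzbar2_Re j k phi x (sR : smooth_on setT (fun x => Re (phi x)))
  (sI : smooth_on setT (fun x => Im (phi x))) :
  Re (dzbar j (dzbar k phi) x) = 4^-1 * (
    'D_(dirx j) ('D_(dirx k) (fun y => Re (phi y))) x -
    'D_(dirx j) ('D_(diry k) (fun y => Im (phi y))) x -
    'D_(diry j) ('D_(dirx k) (fun y => Im (phi y))) x -
    'D_(diry j) ('D_(diry k) (fun y => Re (phi y))) x).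
Proof.
apply: etrans (dzbar_Re j (dzbar k phi) x) _.
apply: etrans (congr2 (fun p q => 2^-1 * (p - q))
  (derive_dzbar_Re k (dirx j) x sR sI) (derive_dzbar_Im k (diry j) x sR sI)) _.
exact: comb4_Re.
Qed.

Let dzbar2_Im j k phi x (sR : smooth_on setT (fun x => Re (phi x)))
  (sI : smooth_on setT (fun x => Im (phi x))) :
  Im (dzbar j (dzbar k phi) x) = 4^-1 * (
    'D_(dirx j) ('D_(dirx k) (fun y => Im (phi y))) x +
    'D_(dirx j) ('D_(diry k) (fun y => Re (phi y))) x +
    'D_(diry j) ('D_(dirx k) (fun y => Re (phi y))) x -
    'D_(diry j) ('D_(diry k) (fun y => Im (phi y))) x).
Proof.
apply: etrans (dzbar_Im j (dzbar k phi) x) _.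
apply: etrans (congr2 (fun p q => 2^-1 * (p + q))
  (derive_dzbar_Im k (dirx j) x sR sI) (derive_dzbar_Re k (diry j) x sR sI)) _.
exact: comb4_Im.
Qed.

Lemma dzbar_comm D j k phi x : test_function D phi ->
  dzbar j (dzbar k phi) x = dzbar k (dzbar j phi) x.
Proof.
move=> [sR sI _].
have C u v (f : X -> R) : smooth_on setT f -> 'D_u ('D_v f) x = 'D_v ('D_u f) x.
  by move=> sf; apply: derive_comm; exact: sf.
apply: cplx_eq.
  apply: etrans (dzbar2_Re j k x sR sI) (etrans _ (esym (dzbar2_Re k j x sR sI))).
  by apply: comb4_sym; exact: C.
apply: etrans (dzbar2_Im j k x sR sI) (etrans _ (esym (dzbar2_Im k j x sR sI))).
by apply: comb4_symP; exact: C.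
Qed.

(** An identity between complex pairings follows from its real part, applied to
   a test function and to its multiples by powers of [i]. *)
Lemma test_function_mulI D phi : test_function D phi ->
  test_function D (fun x => (0 +i* 1) * phi x).
Proof.
move=> [sR sI [K [cK KD K0]]]; split.
- rewrite (_ : (fun x => _) = fun x => 0 * Re (phi x) + - 1 * Im (phi x)).
    exact: smooth_comb.
  by apply/funext => x; rewrite cReM/=; ring.
- rewrite (_ : (fun x => _) = fun x => 1 * Re (phi x) + 0 * Im (phi x)).
    exact: smooth_comb.
  by apply/funext => x; rewrite cImM/=; ring.
- by exists K; split=> // x /K0 ->; rewrite mulr0.
Qed.

Lemma dzbar_mulI j phi x : smooth_on setT (fun x => Re (phi x)) ->
  smooth_on setT (fun x => Im (phi x)) ->
  dzbar j (fun x => (0 +i* 1) * phi x) x = (0 +i* 1) * dzbar j phi x.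
Proof.
move=> sR sI.
have E1 : (fun y => Re ((0 +i* 1) * phi y)) = (fun y => - Im (phi y)).
  by apply/funext => y; rewrite cReM/=; ring.
have E2 : (fun y => Im ((0 +i* 1) * phi y)) = (fun y => Re (phi y)).
  by apply/funext => y; rewrite cImM/=; ring.
have EN v : 'D_v (fun y => - Im (phi y)) x = - 'D_v (fun y => Im (phi y)) x.
  by apply: deriveN; exact: smooth_derivable.
apply: cplx_eq.
  apply: etrans (dzbar_Re j _ x) (etrans _ (esym (cReM _ _))).
  rewrite E1 E2 EN /= mul0r mul1r sub0r.
  by apply: etrans (congr1 -%R (esym (dzbar_Im j phi x))); rewrite -mulrN opprD.
apply: etrans (dzbar_Im j _ x) (etrans _ (esym (cImM _ _))).
rewrite E1 E2 EN /= mul0r mul1r add0r.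
by apply: etrans (esym (dzbar_Re j phi x)); rewrite addrC.
Qed.

Lemma test_function_bounded D phi : test_function D phi ->
  exists C, forall x, `|Re (phi x)| <= C /\ `|Im (phi x)| <= C.
Proof.
move=> [sR sI [K [cK KD K0]]].
have B (f : X -> R) : continuous f -> (forall x, ~ K x -> f x = 0) ->
    exists C, forall x, `|f x| <= C.
  move=> cf f0.
  have cfK : compact (f @` K) by apply: continuous_compact => //; exact: continuous_subspaceT.
  have [M [_ HM]] := compact_bounded cfK.
  exists (`|M| + 1) => x; have [Kx|nK] := pselect (K x); last first.
    by rewrite f0// normr0 addr_ge0.
  apply: HM; last by exists x.
  by rewrite (le_lt_trans (ler_norm M))// ltrDl.
have [C1 H1] := B _ (smooth_continuous sR) (fun x nK => congr1 Re (K0 x nK)).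
have [C2 H2] := B _ (smooth_continuous sI) (fun x nK => congr1 Im (K0 x nK)).
by exists (Num.max C1 C2) => x; rewrite !le_max H1 H2 orbT.
Qed.

End TestFunctions.

(** * Square integrable forms as a real inner product space *)

Section RealInnerProduct.
Context {R : realType}.
Local Notation X := (C2 R).
Local Notation Re := (@complex.Re R).
Local Notation Im := (@complex.Im R).
Local Notation leb4 := (@leb4 R).
Variable D : set X.
Hypothesis mD : measurable D.

Lemma normc_sqr (a : R[i]) : normc a ^+ 2 = Re a ^+ 2 + Im a ^+ 2.
Proof. by case: a => a b /=; rewrite sqr_sqrtr// addr_ge0// sqr_ge0. Qed.

Lemma Re_sum (I : Type) (s : seq I) (F : I -> R[i]) :
  Re (\sum_(i <- s) F i) = \sum_(i <- s) Re (F i).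
Proof. by apply: (big_morph Re) => //; exact: cReD. Qed.

Section dim.
Variable m : nat.
Local Notation form := (@cform R m).
Implicit Types f g h : form.

Definition rdot f g (x : X) : R :=
  \sum_(i < m) (Re (f x 0 i) * Re (g x 0 i) + Im (f x 0 i) * Im (g x 0 i)).

(** The real part of the Hermitian inner product. Adjoints, orthogonality and
   norms below only need this part. *)
Definition ip f g : R := (\int[leb4]_(x in D) rdot f g x)%R.

Lemma Re_inner f g : Re (inner D f g) = ip f g.
Proof.
rewrite /inner /cintegral /ip /=; apply: eq_Rintegral => x _.
rewrite Re_sum; apply: eq_bigr => i _; rewrite cReM.
by case: (g x 0 i) => a b /=; rewrite mulrN opprK.
Qed.

Lemma sqnormE f x : sqnorm f x = rdot f f x.
Proof. by apply: eq_bigr => i _; rewrite normc_sqr !expr2. Qed.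

Lemma sqnorm_ge0 f x : 0 <= sqnorm f x.
Proof. by apply: sumr_ge0 => i _; rewrite sqr_ge0. Qed.

Lemma rdot_abs f g x : `|rdot f g x| <= sqnorm f x + sqnorm g x.
Proof.
rewrite !sqnormE /rdot -big_split/= (le_trans (ler_norm_sum _ _ _))//.
apply: ler_sum => i _; rewrite ler_norml.
set a := Re (f x 0 i); set b := Re (g x 0 i); set c := Im _; set d := Im _.
have := sqr_ge0 (a + b); have := sqr_ge0 (a - b).
have := sqr_ge0 (c + d); have := sqr_ge0 (c - d); have := sqr_ge0 a; have := sqr_ge0 b.
have := sqr_ge0 c; have := sqr_ge0 d; rewrite !expr2 => *.
by apply/andP; split; nra.
Qed.

Lemma rdotC f g x : rdot f g x = rdot g f x.
Proof. by apply: eq_bigr => i _; congr (_ + _); rewrite mulrC. Qed.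

Lemma rdotDl (a : R) f g h x :
  rdot (fun x => (a%:C)%C *: f x + g x) h x = a * rdot f h x + rdot g h x.
Proof.
rewrite /rdot mulr_sumr -big_split; apply: eq_bigr => i _ /=.
by rewrite !mxE cReD cImD cReM cImM /= !mul0r subr0 addr0; ring.
Qed.

Definition measurable_form f := forall i,
  measurable_fun D (fun x => Re (f x 0 i)) /\ measurable_fun D (fun x => Im (f x 0 i)).

Lemma measurable_rdot f g : measurable_form f -> measurable_form g ->
  measurable_fun D (rdot f g).
Proof.
move=> mf mg; rewrite /rdot; apply: measurable_sum => i.
have [? ?] := mf i; have [? ?] := mg i.
by apply: measurable_funD; exact: measurable_funM.
Qed.

Lemma measurable_sqnorm f : measurable_form f -> measurable_fun D (sqnorm f).
Proof.
move=> mf; rewrite (_ : sqnorm f = rdot f f); last by apply/funext => x; exact: sqnormE.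
exact: measurable_rdot.
Qed.

Lemma integrable_sqnorm f : L2 D f -> leb4.-integrable D (EFin \o sqnorm f).
Proof.
move=> Lf; apply/integrableP; split.
  by apply/measurable_EFinP; apply: measurable_sqnorm; have [] := Lf.
have [_] := Lf; apply: le_lt_trans; rewrite le_eqVlt; apply/orP; left; apply/eqP.
by apply: eq_integral => x _ /=; rewrite ger0_norm// sqnorm_ge0.
Qed.

Lemma integrable_rdot f g : L2 D f -> L2 D g ->
  leb4.-integrable D (EFin \o rdot f g).
Proof.
move=> Lf Lg.
have : leb4.-integrable D (EFin \o (fun x => sqnorm f x + sqnorm g x)).
  rewrite (_ : _ \o _ = (EFin \o sqnorm f) \+ (EFin \o sqnorm g))%E//.
  by apply: integrableD => //; exact: integrable_sqnorm.
apply: le_integrable => //.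
  by apply/measurable_EFinP; apply: measurable_rdot; [have [] := Lf|have [] := Lg].
move=> x _; rewrite lee_fin.
by rewrite [leRHS]ger0_norm ?addr_ge0 ?sqnorm_ge0// rdot_abs.
Qed.

Lemma L2_comb (a : R[i]) f g : L2 D f -> L2 D g -> L2 D (fun x => a *: f x + g x).
Proof.
move=> Lf Lg; have [mf If] := Lf; have [mg Ig] := Lg.
have mF : measurable_form (fun x => a *: f x + g x).
  move=> i; have [mf1 mf2] := mf i; have [mg1 mg2] := mg i; split.
    rewrite (_ : (fun x => _) = fun x => (Re a * Re (f x 0 i) - Im a * Im (f x 0 i))
        + Re (g x 0 i)); last by apply/funext => x; rewrite !mxE cReD cReM.
    by apply: measurable_funD => //; apply: measurable_funB; apply: measurable_funM.
  rewrite (_ : (fun x => _) = fun x => (Re a * Im (f x 0 i) + Im a * Re (f x 0 i))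
      + Im (g x 0 i)); last by apply/funext => x; rewrite !mxE cImD cImM.
  by apply: measurable_funD => //; apply: measurable_funD; apply: measurable_funM.
split=> //; pose C := 2 * (Re a ^+ 2 + Im a ^+ 2).
have iI : leb4.-integrable D (EFin \o (fun x => C * sqnorm f x + 2 * sqnorm g x)).
  rewrite (_ : _ \o _ = (fun x => C%:E * (sqnorm f x)%:E + 2%:E * (sqnorm g x)%:E))%E//.
  by apply: integrableD => //; apply: integrableZl => //; exact: integrable_sqnorm.
apply: (@le_lt_trans _ _ (\int[leb4]_(x in D) (C * sqnorm f x + 2 * sqnorm g x)%:E)%E).
  apply: ge0_le_integral => //.
  - by move=> x _; rewrite lee_fin sqnorm_ge0.
  - by apply/measurable_EFinP; exact: measurable_sqnorm.
  - by have /integrableP[] := iI.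
  - move=> x _; rewrite lee_fin /sqnorm !mulr_sumr -big_split; apply: ler_sum => i _ /=.
    rewrite !normc_sqr !mxE cReD cImD cReM cImM /C.
    move: (Re (f x 0 i)) (Im (f x 0 i)) (Re (g x 0 i)) (Im (g x 0 i)) (Re a) (Im a).
    move=> p q s t u v.
    have := sqr_ge0 (u * p - v * q - s); have := sqr_ge0 (u * q + v * p - t).
    rewrite !expr2 => *; nra.
have /integrableP[_] := iI; apply: le_lt_trans; apply: le_integral => //.
- exact: integrable_abse.
- by move=> x _; exact: lee_abs.
Qed.

End dim.
End RealInnerProduct.

Section L2Geometry.
Context {R : realType}.
Local Notation X := (C2 R).
Local Notation Re := (@complex.Re R).
Local Notation Im := (@complex.Im R).
Local Notation leb4 := (@leb4 R).
Variable D : set X.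
Hypothesis mD : measurable D.
Variable m : nat.
Local Notation form := (@cform R m).
Implicit Types f g h : form.
Local Notation ip := (ip D).

Lemma ipC f g : ip f g = ip g f.
Proof. by apply: eq_Rintegral => x _; rewrite rdotC. Qed.

Lemma ipDl (a : R) f g h : L2 D f -> L2 D g -> L2 D h ->
  ip (fun x => (a%:C)%C *: f x + g x) h = a * ip f h + ip g h.
Proof.
move=> Lf Lg Lh; rewrite /ip.
transitivity (\int[leb4]_(x in D) (a * rdot f h x + rdot g h x)).
  by apply: eq_Rintegral => x _; rewrite rdotDl.
rewrite RintegralD//; last 2 first.
- rewrite (_ : _ \o _ = (fun x => a%:E * (rdot f h x)%:E))%E//.
  by apply: integrableZl => //; exact: integrable_rdot.
- exact: integrable_rdot.
by rewrite RintegralZl//; exact: integrable_rdot.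
Qed.

Lemma ip_ge0 f : 0 <= ip f f.
Proof. by apply: Rintegral_ge0 => x _; rewrite -sqnormE sqnorm_ge0. Qed.

Lemma L2norm_ge0 f : 0 <= L2norm D f. Proof. exact: sqrtr_ge0. Qed.

Lemma L2norm_sqr f : L2norm D f ^+ 2 = ip f f.
Proof.
rewrite /L2norm sqr_sqrtr; last first.
  by apply: Rintegral_ge0 => x _; rewrite sqnorm_ge0.
by apply: eq_Rintegral => x _; rewrite sqnormE.
Qed.

Let quadratic_ge0 (A B C : R) : 0 <= C ->
  (forall t, 0 <= A + t * (2 * B) + t ^+ 2 * C) -> B ^+ 2 <= A * C.
Proof.
rewrite le_eqVlt => /predU1P[<-|C0] H.
  rewrite mulr0; have [->|B0] := eqVneq B 0; first by rewrite expr0n.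
  have := H (- (A + 1) / (2 * B)); rewrite mulr0 addr0 divfK ?mulf_neq0//.
  by rewrite opprD addrA subrr sub0r oppr_ge0 ler10.
have := H (- B / C).
have -> : A + - B / C * (2 * B) + (- B / C) ^+ 2 * C = (A * C - B ^+ 2) / C.
  by field; rewrite gt_eqF.
by rewrite pmulr_lge0 ?invr_gt0// subr_ge0.
Qed.

Lemma ip_expand (t : R) f g : L2 D f -> L2 D g ->
  ip (fun x => (t%:C)%C *: g x + f x) (fun x => (t%:C)%C *: g x + f x) =
  ip f f + t * (2 * ip f g) + t ^+ 2 * ip g g.
Proof.
move=> Lf Lg; have Lh := L2_comb mD (t%:C)%C Lg Lf.
rewrite ipDl// (ipC g) (ipC f) !ipDl// (ipC g f); ring.
Qed.

(** The quadratic polynomial [t |-> ip (f + t g) (f + t g)] is nonnegative. *)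
Lemma cauchy_schwarz f g : L2 D f -> L2 D g ->
  `|ip f g| <= L2norm D f * L2norm D g.
Proof.
move=> Lf Lg; rewrite -ler_sqr ?nnegrE ?mulr_ge0 ?L2norm_ge0//.
rewrite exprMn !L2norm_sqr real_normK ?num_real//.
apply: quadratic_ge0; first exact: ip_ge0.
by move=> t; rewrite -ip_expand// ip_ge0.
Qed.

Lemma L2norm_triangle (t : R) f g : L2 D f -> L2 D g ->
  L2norm D (fun x => (t%:C)%C *: g x + f x) <= L2norm D f + `|t| * L2norm D g.
Proof.
move=> Lf Lg; rewrite -ler_sqr ?nnegrE ?addr_ge0 ?mulr_ge0 ?L2norm_ge0//.
rewrite L2norm_sqr ip_expand// sqrrD exprMn !L2norm_sqr real_normK ?num_real//.
rewrite lerD2r lerD2l -[leRHS]mulr_natl [leLHS]mulrCA ler_pM2l// [leRHS]mulrCA.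
by rewrite (le_trans (ler_norm _))// normrM ler_wpM2l// cauchy_schwarz.
Qed.

Lemma ae_ip f f' g g' : L2 D f -> L2 D f' -> L2 D g -> L2 D g' ->
  ae_eq_on D f f' -> ae_eq_on D g g' -> ip f g = ip f' g'.
Proof.
move=> Lf Lf' Lg Lg' ff' gg'; rewrite /ip /Rintegral; congr fine.
have I1 := integrable_rdot mD Lf Lg; have I2 := integrable_rdot mD Lf' Lg'.
apply: ae_eq_integral => //.
- exact: (measurable_int _ I1).
- exact: (measurable_int _ I2).
- have FF := ae_filter_ringOfSetsType leb4.
  apply: filterS2 ff' gg' => x fx gx Dx /=; congr _%:E.
  by apply: eq_bigr => i _; rewrite fx// gx.
Qed.

Lemma ae_eq_on_refl f : ae_eq_on D f f.
Proof. by apply: aeW => x _. Qed.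

Lemma ae_L2norm f g : L2 D f -> L2 D g -> ae_eq_on D f g -> L2norm D f = L2norm D g.
Proof.
move=> Lf Lg fg; apply/eqP; rewrite -(eqrXn2 (n := 2))// ?L2norm_ge0//.
by rewrite !L2norm_sqr (ae_ip Lf Lg Lf Lg fg fg).
Qed.

Lemma ip_eq0 f g : L2 D f -> L2 D g -> L2norm D f = 0 -> ip f g = 0.
Proof.
move=> Lf Lg f0; have := cauchy_schwarz Lf Lg.
by rewrite f0 mul0r normr_le0 => /eqP.
Qed.

End L2Geometry.

(** * The minimal solution of the dbar equation *)

Section NeumannLowerBound.
Context {R : realType}.
Local Notation X := (C2 R).
Local Notation Re := (@complex.Re R).
Local Notation Im := (@complex.Im R).
Local Notation leb4 := (@leb4 R).
Variable D : set X.
Hypothesis mD : measurable D.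
Hypothesis finD : (leb4 D < +oo)%E.
Local Notation ip := (ip D).

Lemma bounded_L2 m (f : @cform R m) (C : R) : 0 <= C -> measurable_form D f ->
  (forall x, D x -> sqnorm f x <= C) -> L2 D f.
Proof.
move=> C0 mf fC; split=> //.
apply: (@le_lt_trans _ _ (\int[leb4]_(x in D) C%:E)%E); last first.
  by rewrite integral_cst// lte_mul_pinfty.
apply: ge0_le_integral => //.
- by move=> x _; rewrite lee_fin sqnorm_ge0.
- by apply/measurable_EFinP; exact: measurable_sqnorm.
Qed.

(** The conjugate compensates the one in the inner product, so that pairing with
   [slot j phi] is bilinear in the [j]-th component and [phi]. *)
Definition slot m (j : 'I_m) (phi : X -> R[i]) : @cform R m :=
  fun x => \row_i (if i == j then conjc (phi x) else 0).

Lemma rdot_slot m (f : @cform R m) j phi x : rdot f (slot j phi) x = Re (f x 0 j * phi x).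
Proof.
rewrite /rdot (bigD1 j)//= big1; last first.
  by move=> i /negbTE ij; rewrite !mxE ij/= !mulr0 addr0.
rewrite !mxE eqxx addr0 cReM; by case: (phi x) => a b /=; rewrite mulrN.
Qed.

Lemma measurable_slot m (j : 'I_m) phi :
  measurable_fun D (fun x => Re (phi x)) -> measurable_fun D (fun x => Im (phi x)) ->
  measurable_form D (slot j phi).
Proof.
move=> mR mI i; split.
  rewrite (_ : (fun x => _) = fun x => if i == j then Re (phi x) else 0).
    by case: (i == j).
  by apply/funext => x; rewrite !mxE; case: (i == j) => //; case: (phi x).
rewrite (_ : (fun x => _) = fun x => if i == j then - Im (phi x) else 0).
  by case: (i == j) => //; exact: measurableT_comp.
by apply/funext => x; rewrite !mxE; case: (i == j) => //; case: (phi x).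
Qed.

Lemma L2_slot m (j : 'I_m) phi : test_function D phi -> L2 D (slot j phi).
Proof.
move=> tphi; have [sR sI _] := tphi.
have [C HC] := test_function_bounded tphi.
apply: (@bounded_L2 _ _ (C ^+ 2 + C ^+ 2)); first by rewrite addr_ge0 ?sqr_ge0.
  apply: measurable_slot; apply: measurable_funTS; apply: continuous_measurable_C2;
    exact: smooth_continuous.
move=> x _; rewrite /sqnorm (bigD1 j)//= big1; last first.
  move=> i /negbTE ij; rewrite !mxE ij normc_sqr/= expr0n/= addr0 //.
have [h1 h2] := HC x.
rewrite mxE eqxx addr0 normc_sqr; move: h1 h2; case: (phi x) => a b /= h1 h2.
have C0 : 0 <= C by rewrite (le_trans _ h1).
by rewrite sqrrN -(real_normK (num_real a)) -(real_normK (num_real b)) lerD// ler_sqr.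
Qed.

Let Re_dbar1_pairing (f : @cform R 2) psi0 psi1 : L2 D f ->
  test_function D psi0 -> test_function D psi1 ->
  (\int[leb4]_(x in D) Re (f x 0 1 * psi0 x - f x 0 0 * psi1 x) =
  ip f (slot 1 psi0) - ip f (slot 0 psi1))%R.
Proof.
move=> Lf t0 t1; rewrite /ip -RintegralB//; last 2 first.
- by apply: integrable_rdot => //; exact: L2_slot.
- by apply: integrable_rdot => //; exact: L2_slot.
by apply: eq_Rintegral => x _; rewrite !rdot_slot cReD cReN.
Qed.

(** The imaginary part of the pairing with [phi] is the real part of the pairing
   with [i ^ 3 phi]. *)
Lemma dbar1_0P (f : @cform R 2) : L2 D f ->
  (forall phi, test_function D phi ->
     ip f (slot 1 (dzbar 0 phi)) = ip f (slot 0 (dzbar 1 phi))) ->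
  dbar1 D f (fun=> 0).
Proof.
move=> Lf H; split=> //.
  apply: (@bounded_L2 _ _ 0) => //.
  by move=> x _; rewrite /sqnorm big1// => i _; rewrite mxE normc_sqr/= expr0n addr0.
move=> phi tphi.
have HR psi : test_function D psi ->
    (\int[leb4]_(x in D) Re (f x 0 1 * dzbar 0 psi x - f x 0 0 * dzbar 1 psi x))%R = 0.
  move=> tpsi.
  have t0 := test_function_dzbar 0 tpsi; have t1 := test_function_dzbar 1 tpsi.
  apply: etrans (Re_dbar1_pairing Lf t0 t1) _.
  by apply/eqP; rewrite subr_eq0; apply/eqP; exact: H.
have -> : cintegral D (fun x => (0 : 'rV[R[i]]_1) 0 0 * phi x) = 0.
  rewrite /cintegral; apply: cplx_eq => /=; under eq_Rintegral do rewrite mxE mul0r/=;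
    by rewrite Rintegral_cst// mul0r.
rewrite oppr0; apply: cplx_eq; first exact: HR.
have [sR sI _] := tphi.
have tI := test_function_mulI tphi; have [sR1 sI1 _] := tI.
have tII := test_function_mulI tI; have [sR2 sI2 _] := tII.
apply: etrans (HR _ (test_function_mulI tII)); apply: eq_Rintegral => x _.
have E j : dzbar j (fun x => (0 +i* 1) * ((0 +i* 1) * ((0 +i* 1) * phi x))) x =
    (0 +i* 1) * ((0 +i* 1) * ((0 +i* 1) * dzbar j phi x)).
  by rewrite dzbar_mulI// dzbar_mulI// dzbar_mulI.
rewrite (E 0) (E 1).
move: (f x 0 1) (f x 0 0) (dzbar 0 phi x) (dzbar 1 phi x) => [a b] [c d] [p q] [s t] /=.
ring.
Qed.

Lemma ip0l m (w : @cform R m) : ip (fun=> 0) w = 0.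
Proof.
rewrite /ip (_ : rdot _ w = cst 0); first by rewrite Rintegral_cst// mul0r.
by apply/funext => x; rewrite /rdot big1// => i _; rewrite mxE/= !mul0r addr0.
Qed.

(** Take [u = dbar^* (N f)]. In [f = a + b] with [a = dbar u] and
   [b = dbar^* dbar (N f)], the form [b] is orthogonal to all closed forms, in
   particular to [f] and to [a]; hence [b = 0], and
   [|u|^2 = (dbar u, N f) = (f, N f)]. That [a] is closed is the commutation of
   the derivatives with respect to [dzbar_1] and [dzbar_2]. *)
Lemma minimal_solution (N : @cform R 2 -> @cform R 2) (f : @cform R 2) :
  dbar_Neumann_operator D N -> dbar1 D f (fun=> 0) ->
  exists u : @cform R 1, [/\ L2 D u,
    forall (j : 'I_2) phi, test_function D phi ->
      ip u (slot 0 (dzbar j phi)) = - ip f (slot j phi) &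
    L2norm D u ^+ 2 <= L2norm D f * L2norm D (N f)].
Proof.
move=> [[NL2 _ _] _ HN _] df0; have [Lf L0 _] := df0.
have [u [v [a [b [[Au ua] [_ Av] _ fab]]]]] := HN _ Lf.
have [Lu La ua'] := ua.
have LNf : L2 D (N f) by exact: NL2.
have [Lv Lb Avb] := Av; have [_ _ Auu] := Au.
have uE (j : 'I_2) phi : test_function D phi ->
    ip u (slot 0 (dzbar j phi)) = - ip a (slot j phi).
  move=> tphi; have := congr1 Re (ua' j phi tphi); rewrite /cintegral /= => H.
  apply: etrans (etrans H (congr1 -%R _)); apply: eq_Rintegral => x _.
    exact: rdot_slot.
  by rewrite rdot_slot.
have da0 : dbar1 D a (fun=> 0).
  apply: (dbar1_0P La) => phi tphi; apply: oppr_inj.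
  have t0 := test_function_dzbar 0 tphi; have t1 := test_function_dzbar 1 tphi.
  apply: etrans (esym (uE 1 _ t0)) (etrans _ (uE 0 _ t1)).
  have E : dzbar 1 (dzbar 0 phi) = dzbar 0 (dzbar 1 phi).
    by apply/funext => x; exact: dzbar_comm tphi.
  exact: (congr1 (fun F => ip u (slot 0 F)) E).
have fb0 : ip f b = 0 by rewrite -Re_inner -(Avb _ _ df0) Re_inner ip0l.
have ab0 : ip a b = 0 by rewrite -Re_inner -(Avb _ _ da0) Re_inner ip0l.
have abE : (fun x => a x + b x) = (fun x => (1%:C)%C *: a x + b x).
  by apply/funext => x; rewrite scale1r.
have Lab : L2 D (fun x => a x + b x) by rewrite abE; exact: L2_comb.
have fE w : L2 D w -> ip f w = ip a w + ip b w.
  move=> Lw; rewrite (ae_ip mD Lf Lab Lw Lw fab (ae_eq_on_refl D w)) abE.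
  by rewrite ipDl// mul1r.
have b0 : L2norm D b = 0.
  apply/eqP; rewrite -sqrf_eq0 L2norm_sqr; apply/eqP.
  by move: fb0; rewrite fE// ab0 add0r.
have faE w : L2 D w -> ip f w = ip a w.
  by move=> Lw; rewrite fE// (ip_eq0 mD Lb Lw b0) addr0.
exists u; split=> //.
- by move=> j phi tphi; rewrite faE ?uE//; exact: L2_slot.
have -> : L2norm D u ^+ 2 = ip f (N f).
  by rewrite faE// L2norm_sqr -Re_inner -(Auu _ _ ua) Re_inner.
by rewrite (le_trans (ler_norm _))// cauchy_schwarz.
Qed.

End NeumannLowerBound.

(** * Lower bounds for the essential norm *)

Section EssentialNorm.
Context {R : realType}.
Local Notation X := (C2 R).
Local Notation leb4 := (@leb4 R).
Variable D : set X.
Hypothesis mD : measurable D.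
Local Notation ip := (ip D).
Variable m : nat.
Local Notation form := (@cform R m).
Implicit Types (f g h : form) (T K : form -> form).

Lemma L2_scale (t : R) f : L2 D f -> L2 D (fun x => (t%:C)%C *: f x).
Proof.
move=> Lf; have := L2_comb mD ((t - 1)%:C)%C Lf Lf.
congr (L2 D _); apply/funext => x; rewrite -{2}(scale1r (f x)) -scalerDl; congr (_ *: _).
by apply: cplx_eq; rewrite ?cReD ?cImD/= ?subrK ?addr0.
Qed.

Lemma L2norm_scale (t : R) f : L2 D f ->
  L2norm D (fun x => (t%:C)%C *: f x) = `|t| * L2norm D f.
Proof.
move=> Lf; apply/eqP; rewrite -(eqrXn2 (n := 2))// ?mulr_ge0 ?L2norm_ge0//.
rewrite exprMn !L2norm_sqr real_normK ?num_real// /ip.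
rewrite -RintegralZl//; last exact: integrable_rdot.
apply/eqP; apply: eq_Rintegral => x _; rewrite /rdot mulr_sumr; apply: eq_bigr => i _.
by rewrite !mxE cReM cImM/= !mul0r subr0 addr0; ring.
Qed.

Let scale_ae T (t : R) f : bounded_operator D T -> L2 D f ->
  ae_eq_on D (T (fun x => (t%:C)%C *: f x)) (fun x => (t%:C)%C *: T f x).
Proof.
move=> [_ TL _] Lf; have := TL ((t - 1)%:C)%C f f Lf Lf.
have E (g : form) : (fun x => (((t - 1)%:C)%C *: g x + g x)) = (fun x => (t%:C)%C *: g x).
  apply/funext => x; rewrite -{2}(scale1r (g x)) -scalerDl; congr (_ *: _).
  by apply: cplx_eq; rewrite ?cReD ?cImD/= ?subrK ?addr0.
by rewrite !E.
Qed.

Let L2_diff f g : L2 D f -> L2 D g -> L2 D (fun x => f x - g x).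
Proof.
move=> Lf Lg; have := L2_comb mD (-1) Lg Lf.
by congr (L2 D _); apply/funext => x; rewrite scaleN1r addrC.
Qed.

Let L2norm_split f g : L2 D f -> L2 D g ->
  L2norm D f <= L2norm D (fun x => f x - g x) + L2norm D g.
Proof.
move=> Lf Lg; have := L2norm_triangle mD 1 (L2_diff Lf Lg) Lg.
rewrite normr1 mul1r; apply: le_trans; rewrite le_eqVlt; apply/orP; left; apply/eqP.
by congr (L2norm D _); apply/funext => x; rewrite scale1r addrC subrK.
Qed.

(** The operator norm is a supremum over the unit ball, so [h] is rescaled; if
   [h] vanishes almost everywhere, so do [T h] and [K h]. *)
Let opnorm_diff T K (o : R) h : bounded_operator D T -> bounded_operator D K ->
  (opnorm D (fun f x => (T f x - K f x)%R) <= o%:E)%E -> L2 D h ->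
  L2norm D (fun x => T h x - K h x) <= o * L2norm D h.
Proof.
move=> bT bK To Lh; have [TL2 _ [CT HT]] := bT; have [KL2 _ [CK HK]] := bK.
have LTh := TL2 _ Lh; have LKh := KL2 _ Lh.
have [h0|hn0] := eqVneq (L2norm D h) 0.
  rewrite h0 mulr0; have := HT _ Lh; have := HK _ Lh; rewrite h0 !mulr0 => k0 t0.
  have := L2norm_triangle mD (-1) LTh LKh; rewrite normrN1 mul1r.
  rewrite (_ : (fun x => _) = fun x => T h x - K h x); last first.
    by apply/funext => x; rewrite (_ : ((-1)%:C)%C = -1) ?scaleN1r 1?addrC// rmorphN1.
  by move=> /le_trans; apply; rewrite -(addr0 0) lerD.
have h_gt0 : 0 < L2norm D h by rewrite lt_neqAle eq_sym hn0 L2norm_ge0.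
pose t := (L2norm D h)^-1; have t0 : 0 < t by rewrite invr_gt0.
pose h' : form := fun x => (t%:C)%C *: h x.
have Lh' : L2 D h' by exact: L2_scale.
have nh' : L2norm D h' = 1 by rewrite L2norm_scale// gtr0_norm// mulVf.
have : ((L2norm D (fun x => T h' x - K h' x))%:E <= o%:E)%E.
  apply: le_trans To; apply: ereal_sup_ubound; exists h' => //=.
  by split=> //; rewrite nh'.
rewrite lee_fin => H.
have E : L2norm D (fun x => T h' x - K h' x) = t * L2norm D (fun x => T h x - K h x).
  rewrite -[in RHS](gtr0_norm t0) -L2norm_scale; last exact: L2_diff.
  apply: ae_L2norm => //.
  - by apply: L2_diff; [exact: TL2|exact: KL2].
  - by apply: L2_scale; exact: L2_diff.
  - have FF := ae_filter_ringOfSetsType leb4.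
    apply: filterS2 (scale_ae t bT Lh) (scale_ae t bK Lh) => x hT hK Dx.
    by rewrite hT// hK// scalerBr.
by move: H; rewrite E /t mulrC ler_pdivrMr.
Qed.

(** Along a subsequence a compact operator [K] nearly annihilates the differences
   [h = f_ l - f_ k] of a bounded sequence, so that [|(T - K) h|] is nearly [|T h|],
   and [|T h| / |h| = |T h| |h| / |h|^2] is nearly at least [A / B]. *)
Lemma essential_norm_ge T (f_ : nat -> form) (A B C : R) :
  bounded_operator D T -> 0 < B ->
  (forall k, L2 D (f_ k)) -> (forall k, L2norm D (f_ k) <= C) ->
  (forall e, 0 < e -> exists k0, forall k, (k0 <= k)%N -> exists l0, forall l, (l0 <= l)%N ->
    let h := fun x => ((-1)%:C)%C *: f_ k x + f_ l x in
    A - e <= L2norm D (T h) * L2norm D h /\ L2norm D h ^+ 2 <= B + e) ->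
  ((A / B)%:E <= essential_norm D T)%E.
Proof.
move=> bT B0 Lf fC H; apply: le_ereal_inf_tmp => _ [K [bK cK] <-].
have [TL2 _ _] := bT; have [KL2 KL _] := bK.
have [s [g [s_incr Lg Kg]]] := cK f_ Lf (ex_intro _ C fC).
have C0 : 0 <= C by rewrite (le_trans _ (fC 0%N))// L2norm_ge0.
have o_ge0 : (0 <= opnorm D (fun f x => (T f x - K f x)%R))%E.
  have Lz : L2 D (fun x => (0%:C)%C *: f_ 0%N x) by exact: L2_scale.
  apply: (@le_trans _ _ (L2norm D (fun x => (T (fun x => (0%:C)%C *: f_ 0%N x) x -
      K (fun x => (0%:C)%C *: f_ 0%N x) x)%R))%:E); first by rewrite lee_fin L2norm_ge0.
  apply: ereal_sup_ubound; exists (fun x => (0%:C)%C *: f_ 0%N x) => //=.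
  by split=> //; rewrite L2norm_scale// normr0 mul0r.
case E : (opnorm D (fun f x => (T f x - K f x)%R)) o_ge0 => [ o | | ]; last 2 first.
- by move=> _; rewrite leey.
- by [].
rewrite !lee_fin => o0; rewrite ler_pdivrMr//; apply/ler_addgt0Pr => e e0.
have diffT h : L2 D h -> L2norm D (fun x => T h x - K h x) <= o * L2norm D h.
  by move=> Lh; apply: opnorm_diff => //; rewrite E.
(* The errors add up to [o d] from the bound on [|h|^2], to [4 C d] from the two
   terms of [K h], and to [d] from the hypothesis. *)
pose d := e / (1 + o + 4 * C); have den0 : 0 < 1 + o + 4 * C by lra.
have d0 : 0 < d by rewrite divr_gt0.
have sk k : (k <= s k)%N.
  by elim: k => // k IH; rewrite (leq_ltn_trans IH)// s_incr.
have [k0 Hk0] := H _ d0.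
have /cvgrPdist_le/(_ _ d0)[n0 _ Hn0] := Kg.
pose k := maxn k0 n0.
have [l0 Hl0] := Hk0 (s k) (leq_trans (leq_maxl _ _) (sk k)).
pose l := maxn l0 n0.
have := Hl0 (s l) (leq_trans (leq_maxl _ _) (sk l)).
set h := (fun x => _) => -[hA hB].
have near_g j : (n0 <= j)%N -> L2norm D (fun x => K (f_ (s j)) x - g x) <= d.
  by move=> /Hn0/=; rewrite sub0r normrN ger0_norm// L2norm_ge0.
have Kk := near_g k (leq_maxr _ _); have Kl := near_g l (leq_maxr _ _).
have Lh : L2 D h by exact: L2_comb.
have LKh := KL2 _ Lh.
have Kh : L2norm D (K h) <= d + d.
  have LKk := L2_diff (KL2 _ (Lf (s k))) Lg; have LKl := L2_diff (KL2 _ (Lf (s l))) Lg.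
  have := L2norm_triangle mD (-1) LKl LKk; rewrite normrN1 mul1r => tri.
  have -> : L2norm D (K h) = L2norm D (fun x => ((-1)%:C)%C *: (K (f_ (s k)) x - g x) +
      (K (f_ (s l)) x - g x)).
    apply: (ae_L2norm mD LKh (L2_comb mD _ LKk LKl)).
    have FF := ae_filter_ringOfSetsType leb4.
    apply: filterS (KL ((-1)%:C)%C _ _ (Lf (s k)) (Lf (s l))) => x hx Dx.
    rewrite hx// scalerBr (_ : ((-1)%:C)%C = -1); last by rewrite rmorphN1.
    by rewrite !scaleN1r opprK addrACA subrr addr0.
  by rewrite (le_trans tri)// lerD.
have hC : L2norm D h <= C + C.
  have := L2norm_triangle mD (-1) (Lf (s l)) (Lf (s k)); rewrite normrN1 mul1r.
  by move=> /le_trans; apply; rewrite lerD.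
have Th : L2norm D (T h) <= o * L2norm D h + (d + d).
  by rewrite (le_trans (L2norm_split (TL2 _ Lh) LKh))// lerD// diffT.
have nh0 := L2norm_ge0 D h.
have H1 : L2norm D (T h) * L2norm D h <= (o * L2norm D h + (d + d)) * L2norm D h.
  by rewrite ler_wpM2r.
have H2 : o * L2norm D h ^+ 2 <= o * (B + d) by rewrite ler_wpM2l.
have H3 : (d + d) * L2norm D h <= (d + d) * (C + C).
  by rewrite ler_wpM2l// addr_ge0 ?ltW.
have -> : e = d * (1 + o + 4 * C) by rewrite /d divfK// gt_eqF.
rewrite expr2 in H2; lra.
Qed.

End EssentialNorm.

(** * Poles at the common boundary point of the slices *)

Section Inverse.
Context {R : realType}.

Lemma measurable_inv : measurable_fun [set: R] (fun s : R => s^-1).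
Proof.
have -> : [set: R] = `]-oo, 0[ `|` ([set 0] `|` `]0, +oo[).
  apply/seteqP; split => // x _ /=; rewrite !in_itv/= andbT.
  by have [h|h|->] := ltgtP x 0; [left|right; right|right; left].
have c (D : set R) : open D -> (forall x, D x -> x != 0) -> measurable_fun D (fun s : R => s^-1).
  move=> oD D0; apply: open_continuous_measurable_fun => // x /set_mem /D0 x0.
  exact: inv_continuous.
apply/measurable_funU => //; first exact: measurableU.
split; first by apply: c => // x /=; rewrite in_itv/= => /ltr0_neq0.
apply/measurable_funU => //; split; first exact: measurable_fun_set1.
by apply: c => // x /=; rewrite in_itv/= andbT => /lt0r_neq0.
Qed.

End Inverse.

Section DiscMass.
Context {R : realType}.
Local Notation R1 := (measurableTypeR R).
Local Notation R2 := (R1 * R1)%type.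
Local Notation leb2 := (@leb2 R).

(** The disc of radius 1 about [e^(i th)]; its boundary contains 0. *)
Definition disc (th : R) : set (R * R) :=
  [set z | nsq z < 2 * (cos th * z.1 + sin th * z.2)].

Definition dsq (p z : R * R) : R := (z.1 - p.1) ^+ 2 + (z.2 - p.2) ^+ 2.

Lemma measurable_dsq p : measurable_fun [set: R2] (dsq p).
Proof.
by apply: measurable_funD; apply: measurable_funX; apply: measurable_funB.
Qed.

Lemma measurable_disc th : measurable (disc th : set R2).
Proof.
rewrite (_ : disc th = (fun z : R2 => 2 * (cos th * z.1 + sin th * z.2) - nsq z)
    @^-1` `]0, +oo[%classic).
  rewrite -[X in measurable X]setTI; apply: (_ : measurable_fun _ _) => //.
  apply: measurable_funB; last exact: measurable_nsq.
  by apply: measurable_funM => //; apply: measurable_funD; exact: measurable_funM.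
by apply/seteqP; split => z /=; rewrite /disc/= in_itv/= andbT subr_gt0.
Qed.

Variables (a t : R).
Hypotheses (a_gt0 : 0 < a) (a_pi : a < pi) (t_gt0 : 0 < t) (t_le1 : t <= 1).
Let ca := cos (a / 2).
Let sa := sin (a / 2).

(** A pole outside all the discs [disc th] with [0 <= th <= a], on the line
   through 0 that is opposite to their bisector. *)
Definition pole : R * R := (- (t * cos (a / 2)), - (t * sin (a / 2))).

Let pi0 : 0 < pi :> R. Proof. exact: pi_gt0. Qed.

Let ca_gt0 : 0 < ca.
Proof.
have h1 := a_gt0; have h2 := a_pi; have h3 := pi0.
by apply: cos_gt0_pihalf; apply/andP; split; lra.
Qed.

Let sa_gt0 : 0 < sa.
Proof.
have h1 := a_gt0; have h2 := a_pi; have h3 := pi0.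
by apply: sin_gt0_pi; apply/andP; split; lra.
Qed.

Let ca1 : ca <= 1. Proof. exact: cos_le1. Qed.

Let cs1 (x : R) : cos x ^+ 2 + sin x ^+ 2 = 1.
Proof. exact: cos2Dsin2. Qed.

Let cos_neqN1 (th : R) : 0 <= th <= a -> cos th != -1.
Proof.
move=> /andP[]; rewrite le_eqVlt => /predU1P[<- _|th0 tha].
  by rewrite cos0; apply/eqP; lra.
have s0 : 0 < sin th by apply: sin_gt0_pi; rewrite th0 (le_lt_trans tha).
apply/eqP => c1; have := cs1 th; rewrite c1 sqrrN expr1n => h.
by have := exprn_gt0 2 s0; lra.
Qed.

(** No [e^(i th)] with [0 <= th <= a] makes an angle of more than [a / 2] with the
   bisector direction [e^(i a / 2)]. *)
Lemma cos_bisector_le (th : R) : 0 <= th <= a -> ca <= cos (th - a / 2).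
Proof.
move=> /andP[th0 tha]; rewrite /ca; have h1 := a_gt0; have h2 := a_pi.
have -> : cos (th - a / 2) = cos `|th - a / 2|.
  by case: (ger0P (th - a / 2)) => _ //; rewrite cosN.
rewrite leNgt ltr_cos ?in_itv/=; first by rewrite -leNgt ler_norml; apply/andP; split; lra.
- by rewrite ltW ?divr_gt0//=; lra.
- by rewrite normr_ge0/= ler_norml; apply/andP; split; lra.
Qed.

Section radial.
Variables (k K : R -> R).
Hypothesis dK : forall s : R, 0 < s -> is_derive s 1 K (k s).
Hypothesis ck : forall s : R, 0 < s -> {for s, continuous k}.
Hypothesis k_ge0 : forall s, 0 <= k s.
Hypothesis mk : measurable_fun [set: R] k.

Let h (S : set R2) : R2 -> \bar R := (fun z => (k (dsq pole z))%:E) \_ S.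

Let mh (S : set R2) : measurable S -> measurable_fun setT (h S).
Proof.
move=> mS; apply/(measurable_restrictT _ mS); apply: measurable_funTS.
by apply/measurable_EFinP; apply: measurableT_comp => //; exact: measurable_dsq.
Qed.

Let h_ge0 (S : set R2) z : (0 <= h S z)%E.
Proof. by rewrite /h patchE; case: ifPn => // _; rewrite lee_fin. Qed.

Let rot th (z : R2) : R2 := (cos th * z.1 - sin th * z.2, sin th * z.1 + cos th * z.2).

Let move_to th (z : R2) : R2 := ((rot th z).1 + pole.1, (rot th z).2 + pole.2).

Let dsq_move th z : dsq pole (move_to th z) = nsq z.
Proof.
rewrite /dsq /move_to /= !addrK /nsq.
transitivity ((cos th ^+ 2 + sin th ^+ 2) * (z.1 ^+ 2 + z.2 ^+ 2)); first by ring.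
by rewrite cs1 mul1r.
Qed.

Let integral_move (S : set R2) th : measurable S -> 0 <= th <= a ->
  (\int[leb2]_(z in S) (k (dsq pole z))%:E =
   \int[leb2]_z (h S (move_to th z)))%E.
Proof.
move=> mS tha; rewrite integral_mkcond -/(h S).
rewrite -(ge0_leb2_translation pole (mh mS))//.
rewrite -(@ge0_leb2_rotation _ (cos th) (sin th))//.
- exact: cos_neqN1.
- apply: (measurableT_comp (mh mS)); have := measurable_plane_map 1 0 0 1 pole.1 pole.2.
  by apply: eq_measurable_fun => z _; rewrite !mul1r !mul0r add0r !addr0.
Qed.

Let m_move (S : set R2) th : measurable S -> measurable_fun setT (fun z => h S (move_to th z)).
Proof.
move=> mS; apply: (measurableT_comp (mh mS)).
have := measurable_plane_map (cos th) (- sin th) (sin th) (cos th) pole.1 pole.2.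
by apply: eq_measurable_fun => z _; rewrite mulNr.
Qed.

(** Translate the pole to 0 and rotate by [- th]: the disc then lies in the right
   half-plane, at distance between [t cos (a / 2)] and 3 from 0. *)
Lemma disc_mass_le th : 0 <= th <= a ->
  (\int[leb2]_(z in disc th) (k (dsq pole z))%:E <=
   (pi / 2 * (K 9 - K ((t * ca) ^+ 2)))%:E)%E.
Proof.
move=> tha; rewrite (integral_move (measurable_disc th) tha).
have tca : 0 < t * ca by rewrite mulr_gt0.
have s0 : 0 < (t * ca) ^+ 2 by rewrite exprn_gt0.
have s01 : (t * ca) ^+ 2 < 9.
  have h1 : t * ca <= 1 by apply: mulr_ile1 => //; exact: ltW.
  have : (t * ca) ^+ 2 <= 1 by rewrite expr_le1// ltW.
  by move=> h2; lra.
have pos s : (t * ca) ^+ 2 <= s <= 9 -> 0 < s by move=> /andP[+ _]; exact: lt_le_trans.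
rewrite -(@half_plane_radial_integral _ k K _ _ s0 s01 (fun s h => dK (pos s h))
  (fun s h => ck (pos s h)) (fun s _ => k_ge0 s)).
rewrite [leRHS]integral_mkcond.
apply: ge0_le_integral => //.
- exact: m_move (measurable_disc th).
- apply/(measurable_restrictT _ (measurableI _ _ measurable_right_half (measurable_nsq_itv _ _))).
  apply: measurable_funTS; apply/measurable_EFinP; apply: measurableT_comp => //.
  exact: measurable_nsq.
move=> z _; rewrite /h !patchE; case: ifPn => [/set_mem|_]; last first.
  by case: ifPn => // _; rewrite lee_fin.
rewrite /disc/= dsq_move => zd; rewrite ifT// inE/=.
set X := cos th * z.1 - sin th * z.2 + - (t * cos (a / 2)) in zd *.
set Y := sin th * z.1 + cos th * z.2 + - (t * sin (a / 2)) in zd *.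
have E : cos th * X + sin th * Y = z.1 - t * cos (th - a / 2).
  rewrite cosB.
  transitivity ((cos th ^+ 2 + sin th ^+ 2) * z.1 - t * (cos th * cos (a / 2) + sin th * sin (a / 2))).
    by rewrite /X /Y; ring.
  by rewrite cs1 mul1r.
have W : (cos th * X + sin th * Y) ^+ 2 <= nsq (X, Y).
  have : 0 <= (cos th * Y - sin th * X) ^+ 2 by exact: sqr_ge0.
  have : (cos th * X + sin th * Y) ^+ 2 + (cos th * Y - sin th * X) ^+ 2 =
      (cos th ^+ 2 + sin th ^+ 2) * nsq (X, Y) by rewrite /nsq/=; ring.
  by rewrite cs1 mul1r; lra.
have n4 : nsq (X, Y) < 4.
  have w0 : 0 < cos th * X + sin th * Y by have := nsq_ge0 (X, Y); lra.
  move: W zd w0; rewrite expr2; set w := _ + _ => W zd w0.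
  have : w * w < 2 * w by lra.
  by rewrite ltr_pM2r//; lra.
have nz : nsq z = (X + t * cos (a / 2)) ^+ 2 + (Y + t * sin (a / 2)) ^+ 2.
  by rewrite -(dsq_move th z) /dsq /= !opprK.
rewrite E in zd.
have p0 := nsq_ge0 (X, Y).
have c0 := cos_bisector_le tha.
have tc : t * ca <= t * cos (th - a / 2) by rewrite ler_pM2l.
have z1 : t * ca < z.1 by move: (le_lt_trans p0 zd) tc => h1 h2; lra.
split; first by rewrite (lt_trans tca).
apply/andP; split.
  rewrite /nsq (le_trans (_ : _ <= z.1 ^+ 2)) ?lerDl ?sqr_ge0//.
  by rewrite ler_sqr ?nnegrE ?ltW// (lt_trans tca).
have t2 : (t * cos (a / 2)) ^+ 2 + (t * sin (a / 2)) ^+ 2 <= 1.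
  rewrite !exprMn -mulrDr cs1 mulr1 expr_le1//; exact: ltW.
rewrite nz; move: n4 t2; rewrite /nsq/=.
move: (t * cos (a / 2)) (t * sin (a / 2)) => u v.
have := sqr_ge0 (X - 2 * u); have := sqr_ge0 (Y - 2 * v); rewrite !expr2 => *; lra.
Qed.

(** Seen from the pole, a cone around the bisector direction of opening less
   than [pi - a] lies in both extreme discs, once points too close to the pole
   or too far from it are removed. *)
Lemma cone_mass_ge (b g : R) : 0 < b -> g = ca - b * sa -> 0 < g ->
  let s0 := 4 * (1 + b ^+ 2) * t ^+ 2 / g ^+ 2 in
  let s1 := (g / (1 + b ^+ 2)) ^+ 2 in
  s0 < s1 ->
  ((atan b * (K s1 - K s0))%:E <=
   \int[leb2]_(z in disc 0 `&` disc a) (k (dsq pole z))%:E)%E.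
Proof.
move=> b0 gE g0 s0 s1 s01.
have b2 : 0 < 1 + b ^+ 2 by rewrite ltr_pwDl// sqr_ge0.
have s0_gt0 : 0 < s0 by rewrite !(mulr_gt0, exprn_gt0, invr_gt0).
have pos s : s0 <= s <= s1 -> 0 < s by move=> /andP[+ _]; exact: lt_le_trans.
have mS : measurable (disc 0 `&` disc a : set R2).
  by apply: measurableI; exact: measurable_disc.
have a2 : 0 <= a / 2 <= a by have h1 := a_gt0; apply/andP; split; lra.
rewrite (integral_move mS a2) .
rewrite -(@cone_radial_integral _ k K _ _ s0_gt0 s01 (fun s h => dK (pos s h))
  (fun s h => ck (pos s h)) (fun s _ => k_ge0 s) b b0).
rewrite [leLHS]integral_mkcond.
apply: ge0_le_integral => //.
- by move=> z _; rewrite patchE; case: ifPn => // _; rewrite lee_fin.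
- apply/(measurable_restrictT _ (measurableI _ _ (measurableI _ _
    measurable_right_half (measurable_cone _)) (measurable_nsq_itv _ _))).
  apply: measurable_funTS; apply/measurable_EFinP; apply: measurableT_comp => //.
  exact: measurable_nsq.
- exact: m_move.
move=> z _; rewrite [leLHS]patchE; case: ifPn => [/set_mem|_]; last exact: h_ge0.
move=> [[/= z1 z2] /andP[zs0 zs1]].
rewrite /h patchE dsq_move ifT// inE.
have bz : 0 <= b * z.1 by rewrite mulr_ge0// ltW.
have z10 := ltW z1; have g00 := ltW g0; have t00 := ltW t_gt0.
have X2 : 4 * t ^+ 2 / g ^+ 2 <= z.1 ^+ 2.
  have : nsq z <= (1 + b ^+ 2) * z.1 ^+ 2.
    rewrite /nsq mulrDl mul1r lerD2l -exprMn -(real_normK (num_real z.2)).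
    by rewrite ler_sqr ?nnegrE.
  move=> /(le_trans zs0); rewrite /s0.
  have -> : 4 * (1 + b ^+ 2) * t ^+ 2 / g ^+ 2 = (1 + b ^+ 2) * (4 * t ^+ 2 / g ^+ 2).
    by field; rewrite gt_eqF.
  by rewrite ler_pM2l.
have Xt : 2 * t <= g * z.1.
  rewrite -ler_sqr ?nnegrE ?mulr_ge0//.
  move: X2; rewrite ler_pdivrMr ?exprn_gt0// => X2.
  by rewrite !exprMn [g ^+ 2 * _]mulrC (_ : 2 ^+ 2 = 4 :> R)// expr2; ring.
have Xd : (1 + b ^+ 2) * z.1 <= g.
  rewrite -ler_pdivlMl// mulrC -ler_sqr ?nnegrE ?divr_ge0// ?(ltW b2)//.
  by apply: le_trans zs1; rewrite /nsq lerDl sqr_ge0.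
have nz : nsq z <= g * z.1.
  have : nsq z <= (1 + b ^+ 2) * z.1 ^+ 2.
    rewrite /nsq mulrDl mul1r lerD2l -exprMn -(real_normK (num_real z.2)).
    by rewrite ler_sqr ?nnegrE.
  by move=> /le_trans; apply; rewrite expr2 mulrA ler_pM2r.
have ca1' := ca1; have ca0 := ca_gt0; have sa0 := sa_gt0; have t0 := t_gt0.
have Ysa : `|z.2| * sa <= b * z.1 * sa by rewrite ler_pM2r.
have Y1 : z.2 * sa <= b * z.1 * sa by rewrite (le_trans _ Ysa)// ler_pM2r// ler_norm.
have Y2 : - z.2 * sa <= b * z.1 * sa.
  by rewrite (le_trans _ Ysa)// ler_pM2r// -normrN ler_norm.
have tca : ca * t <= t by rewrite ler_piMl// ltW.
have bsa : 0 < b * sa by rewrite mulr_gt0.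
have g1 : g <= 1 by rewrite gE; lra.
have gz : g * z.1 <= z.1 by rewrite ler_piMl// ltW.
have nX : nsq (z.1 - t, z.2) < nsq z.
  rewrite /nsq/= ltrD2r ltr_sqr ?nnegrE//; lra.
have key : nsq (z.1 - t, z.2) < 2 * (ca * (z.1 - t) - b * z.1 * sa).
  have -> : 2 * (ca * (z.1 - t) - b * z.1 * sa) = 2 * (g * z.1) - 2 * (ca * t).
    by rewrite gE; ring.
  lra.
have nE : nsq (move_to (a / 2) z) = nsq (z.1 - t, z.2).
  rewrite /move_to /rot /pole /nsq /= -/ca -/sa.
  transitivity ((ca ^+ 2 + sa ^+ 2) * ((z.1 - t) ^+ 2 + z.2 ^+ 2)); first by ring.
  by rewrite cs1 mul1r.
have caE : cos a = ca ^+ 2 - sa ^+ 2.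
  by rewrite [in LHS](splitr a) cosD !expr2.
have saE : sin a = 2 * (sa * ca).
  by rewrite [in LHS](splitr a) sinD; rewrite -/ca -/sa; ring.
split; rewrite /disc/= -/(move_to _ _) nE.
  rewrite cos0 sin0 mul0r addr0 mul1r (lt_le_trans key)// ler_pM2l//.
  rewrite -/ca -/sa; lra.
rewrite caE saE -/ca -/sa (lt_le_trans key)// ler_pM2l//.
have -> : (ca ^+ 2 - sa ^+ 2) * (ca * z.1 - sa * z.2 + - (t * ca)) +
   2 * (sa * ca) * (sa * z.1 + ca * z.2 + - (t * sa)) =
   (ca ^+ 2 + sa ^+ 2) * (ca * (z.1 - t) + sa * z.2) by ring.
rewrite cs1; lra.
Qed.

End radial.
End DiscMass.

(** * Divergences with compact support *)

Lemma continuous_pairl (T U : topologicalType) (y : U) :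
  continuous (fun x : T => (x, y)).
Proof. by move=> x; apply: (@cvg_pair _ _ _ _ (nbhs x) (nbhs y)); [exact: cvg_id|exact: cvg_cst]. Qed.

Lemma continuous_pairr (T U : topologicalType) (x : T) :
  continuous (fun y : U => (x, y)).
Proof. by move=> y; apply: (@cvg_pair _ _ _ _ (nbhs x) (nbhs y)); [exact: cvg_cst|exact: cvg_id]. Qed.

Section PlaneDivergence.
Context {R : realType}.
Local Notation X := (C2 R).
Local Notation R1 := (measurableTypeR R).
Local Notation R2 := (R1 * R1)%type.
Local Notation leb2 := (@leb2 R).
Local Notation mu := (@lebesgue_measure R).

Lemma continuous_measurable_plane (g : R * R -> R) : continuous g ->
  measurable_fun [set: R2] g.
Proof.
move=> cg; have mG : measurable_fun setT (fun x : X => g x.1).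
  apply: continuous_measurable_C2 => x.
  by apply: continuous_comp; [exact: cvg_fst|exact: cg].
have -> : g = (fun x : X => g x.1) \o (fun z : R2 => (z, (0, 0))) by [].
apply: measurableT_comp => //; by apply/measurable_fun_pairP; split.
Qed.

Let box (m : R) : set (R * R) := `[- m, m]%classic `*` `[- m, m]%classic.

Let measurable_box m : measurable (box m : set R2).
Proof. by apply: measurableX; exact: measurable_itv. Qed.

Let box_lty m : (leb2 (box m) < +oo)%E.
Proof.
rewrite /Defs.leb2 product_measure1E//.
rewrite /= !lebesgue_measure_itv/=; case: ifPn => _; last by rewrite mule0.
by rewrite -EFinB -EFinM ltry.
Qed.

Lemma continuous_box_integrable (g : R * R -> R) (m : R) : continuous g ->
  (forall z, ~ box m z -> g z = 0) -> leb2.-integrable setT (EFin \o g).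
Proof.
move=> cg g0.
have cK : compact (box m) by apply: compact_setX; exact: segment_compact.
have : compact (g @` box m).
  by apply: continuous_compact => //; exact: continuous_subspaceT.
move=> /compact_bounded[M [_ HM]].
pose C := `|M| + 1.
have gC z : box m z -> `|g z| <= C.
  by move=> Kz; apply: HM; [rewrite (le_lt_trans (ler_norm M))// ltrDl|exists z].
have mg := continuous_measurable_plane cg.
have : leb2.-integrable setT (EFin \o (fun z => C * \1_(box m) z)).
  rewrite (_ : _ \o _ = (fun z => C%:E * (\1_(box m) z)%:E))%E//.
  apply: integrableZl => //; apply/integrableP; split.
    by apply/measurable_EFinP; exact: measurable_indic.
  under eq_integral do rewrite gee0_abs ?lee_fin//.
  rewrite integral_indic// setIT; exact: box_lty.
apply: le_integrable => //; first exact/measurable_EFinP.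
move=> z _; rewrite lee_fin indicE.
have [bz|nb] := pselect (box m z); last by rewrite g0// normr0.
by rewrite mem_set// mulr1 (le_trans (gC _ bz))// ler_norm.
Qed.

(** The fundamental theorem of calculus on an interval that contains the
   support of the derivative. *)
Let integral_line (s g : R -> R) (m : R) : 0 < m ->
  (forall x : R, is_derive x 1 s (g x)) -> continuous g ->
  (forall x, ~ `[- m, m]%classic x -> s x = 0 /\ g x = 0) ->
  (\int[mu]_x (g x)%:E = 0)%E.
Proof.
move=> m0 ds cg s0; pose M := m + 1.
(* Strictly beyond the support, so that the endpoint values vanish. *)
have out x : M <= `|x| -> s x = 0 /\ g x = 0.
  move=> Mx; apply: s0; rewrite /= in_itv/= -ler_norml => h.
  by have := le_trans Mx h; rewrite /M; lra.
have M0 : - M < M by rewrite /M; lra.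
transitivity (\int[mu]_(x in `[(- M)%R, M]) (g x)%:E)%E.
  rewrite [RHS]integral_mkcond; apply: eq_integral => x _; rewrite patchE.
  case: ifPn => //; rewrite notin_setE /= in_itv/= -ler_norml => /negP; rewrite -ltNge.
  by move=> /ltW/out[_ ->].
rewrite (@continuous_FTC2 _ _ s)//.
- have nM : M <= `|M| by exact: ler_norm.
  have [-> _] := out _ nM; have [] := out (- M); first by rewrite normrN.
  by move=> -> _; rewrite sube0.
- exact: continuous_subspaceT.
- have cs x : {for x, continuous s}.
    apply: differentiable_continuous; apply/derivable1_diffP.
    by have := ds x => ?; exact: ex_derive.
  split.
  + by move=> x _; have := ds x => ?; exact: ex_derive.
  + by apply: cvg_at_right_filter; exact: cs.
  + by apply: cvg_at_left_filter; exact: cs.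
- by move=> x _; have := ds x => ?; rewrite derive1E derive_val.
Qed.

Lemma integral_partial_x (s g : R * R -> R) (m : R) : 0 < m -> continuous g ->
  (forall x y : R, is_derive x 1 (fun x => s (x, y)) (g (x, y))) ->
  (forall z, ~ box m z -> s z = 0 /\ g z = 0) ->
  (\int[leb2]_z (g z)%:E = 0)%E.
Proof.
move=> m0 cg ds s0.
have ig := continuous_box_integrable cg (fun z h => (s0 z h).2).
rewrite -(@integral21_prod_meas1 _ _ R1 R1 R mu mu _ ig).
apply: integral0_eq => y _; apply: (integral_line m0 (s := fun x => s (x, y))) => //.
  move=> x; apply: (continuous_comp (f := fun x : R => (x, y))); last exact: cg.
  exact: continuous_pairl.
by move=> x xm; apply: s0 => -[].
Qed.

Lemma integral_partial_y (s g : R * R -> R) (m : R) : 0 < m -> continuous g ->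
  (forall x y : R, is_derive y 1 (fun y => s (x, y)) (g (x, y))) ->
  (forall z, ~ box m z -> s z = 0 /\ g z = 0) ->
  (\int[leb2]_z (g z)%:E = 0)%E.
Proof.
move=> m0 cg ds s0.
have ig := continuous_box_integrable cg (fun z h => (s0 z h).2).
rewrite -(@integral12_prod_meas1 _ _ R1 R1 R mu mu _ ig).
apply: integral0_eq => x _; apply: (integral_line m0 (s := fun y => s (x, y))) => //.
  move=> y; apply: (continuous_comp (f := fun y : R => (x, y))); last exact: cg.
  exact: continuous_pairr.
by move=> y ym; apply: s0 => -[].
Qed.

End PlaneDivergence.

(** * Closed forms with a holomorphic coefficient *)

Section HolomorphicFactor.
Context {R : realType}.
Local Notation X := (C2 R).
Implicit Types (W : set (R * R)) (P Q : R * R -> R) (x v : X) (p : R * R).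

(** [P + i Q] is a smooth solution of the Cauchy-Riemann equations on [W], seen
   as a function of the first complex coordinate of a point of [C2]. *)
Definition holo W P Q : Prop :=
  [/\ open [set x : X | W x.1],
      forall n, Cn_on n [set x : X | W x.1] (fun x => P x.1),
      forall n, Cn_on n [set x : X | W x.1] (fun x => Q x.1),
      forall x, W x.1 -> 'D_(dirx 0) (fun x => P x.1) x = 'D_(diry 0) (fun x => Q x.1) x &
      forall x, W x.1 -> 'D_(diry 0) (fun x => P x.1) x = - 'D_(dirx 0) (fun x => Q x.1) x].

(** [invRe p + i invIm p] is the function [1 / (z - p)]. *)
Definition invRe p (z : R * R) : R := (z.1 - p.1) * (dsq p z)^-1.
Definition invIm p (z : R * R) : R := - (z.2 - p.2) * (dsq p z)^-1.

Let dX p x v : is_derive x v (fun x : X => x.1.1 - p.1) v.1.1.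
Proof.
have h := is_derive_x1 x v; have h2 := @is_derive_cst R X R p.1 x v.
have := @is_deriveB R X R _ _ x v _ _ h h2; rewrite subr0; exact.
Qed.

Let dY p x v : is_derive x v (fun x : X => x.1.2 - p.2) v.1.2.
Proof.
have h := is_derive_y1 x v; have h2 := @is_derive_cst R X R p.2 x v.
have := @is_deriveB R X R _ _ x v _ _ h h2; rewrite subr0; exact.
Qed.

Let dD p x v : is_derive x v (fun x : X => dsq p x.1)
  (2 * (x.1.1 - p.1) * v.1.1 + 2 * (x.1.2 - p.2) * v.1.2).
Proof.
have hX := @is_deriveM R X _ _ x v _ _ (dX p x v) (dX p x v).
have hY := @is_deriveM R X _ _ x v _ _ (dY p x v) (dY p x v).
have := @is_deriveD R X R _ _ x v _ _ hX hY.
have -> : (fun x : X => x.1.1 - p.1) * (fun x : X => x.1.1 - p.1) +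
   (fun x : X => x.1.2 - p.2) * (fun x : X => x.1.2 - p.2) = (fun x : X => dsq p x.1).
  by apply/funext => y.
by move=> /is_derive_eq; apply; rewrite /GRing.scale/=; ring.
Qed.

Let dV p x v : 0 < dsq p x.1 -> is_derive x v (fun x : X => (dsq p x.1)^-1)
  (- (dsq p x.1) ^- 2 * (2 * (x.1.1 - p.1) * v.1.1 + 2 * (x.1.2 - p.2) * v.1.2)).
Proof.
move=> d0; have h := dD p x v; have dn : dsq p x.1 != 0 by rewrite gt_eqF.
apply: DeriveDef; first by apply: derivableV => //; exact: ex_derive.
by rewrite deriveV// derive_val.
Qed.

Let dRe p x v : 0 < dsq p x.1 -> is_derive x v (fun x : X => invRe p x.1)
  ((x.1.1 - p.1) * (- (dsq p x.1) ^- 2 * (2 * (x.1.1 - p.1) * v.1.1 + 2 * (x.1.2 - p.2) * v.1.2))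
   + (dsq p x.1)^-1 * v.1.1).
Proof. by move=> d0; exact: (@is_deriveM R X _ _ x v _ _ (dX p x v) (dV v d0)). Qed.

Let dIm p x v : 0 < dsq p x.1 -> is_derive x v (fun x : X => invIm p x.1)
  (- (x.1.2 - p.2) * (- (dsq p x.1) ^- 2 * (2 * (x.1.1 - p.1) * v.1.1 + 2 * (x.1.2 - p.2) * v.1.2))
   + (dsq p x.1)^-1 * - v.1.2).
Proof.
move=> d0; have hN := @is_deriveN R X R _ x v _ (dY p x v).
exact: (@is_deriveM R X _ _ x v _ _ hN (dV v d0)).
Qed.

Lemma Cn_subX (c : R) n U : open U -> Cn_on n U (fun x : X => x.1.1 - c).
Proof. by move=> oU; apply: CnD => //; [exact: Cn_x1|exact: Cn_cst]. Qed.

Lemma Cn_subY (c : R) n U : open U -> Cn_on n U (fun x : X => x.1.2 - c).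
Proof. by move=> oU; apply: CnD => //; [exact: Cn_y1|exact: Cn_cst]. Qed.

Lemma Cn_dsq p n U : open U -> Cn_on n U (fun x : X => dsq p x.1).
Proof.
move=> oU; rewrite (_ : (fun x : X => _) = fun x : X => (x.1.1 - p.1) * (x.1.1 - p.1)
  + (x.1.2 - p.2) * (x.1.2 - p.2)); last by apply/funext => x; rewrite /dsq !expr2.
by apply: CnD => //; apply: CnM => //; (exact: Cn_subX || exact: Cn_subY).
Qed.

Lemma open_dsq_gt0 p : open [set x : X | 0 < dsq p x.1].
Proof.
have c : continuous (fun x : X => dsq p x.1).
  by move=> x; have := @Cn_dsq p 0 setT openT; exact.
by apply: (open_comp (f := fun x : X => dsq p x.1)) (@open_gt R 0) => x _; exact: c.
Qed.

Lemma holo_inv p : holo [set z | 0 < dsq p z] (invRe p) (invIm p).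
Proof.
have oW := @open_dsq_gt0 p.
have cV n : Cn_on n [set x : X | 0 < dsq p x.1] (fun x : X => (dsq p x.1)^-1).
  exact: (Cn_comp1 smooth1_inv oW (fun x h => h) (Cn_dsq p n oW)).
split=> //.
- by move=> n; apply: CnM => //; exact: Cn_subX.
- move=> n; apply: CnM => //.
  rewrite (_ : (fun x : X => _) = fun x : X => (-1) * (x.1.2 - p.2)).
    by apply: CnM => //; [exact: Cn_cst|exact: Cn_subY].
  by apply/funext => x; rewrite mulN1r.
- move=> x d0; have d1 := dRe (dirx 0) d0; have d2 := dIm (diry 0) d0.
  rewrite (@derive_val _ _ _ _ _ _ _ d1) (@derive_val _ _ _ _ _ _ _ d2) /=.
  by rewrite /dsq; field; rewrite -/(dsq p x.1) gt_eqF.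
- move=> x d0; have d1 := dRe (diry 0) d0; have d2 := dIm (dirx 0) d0.
  rewrite (@derive_val _ _ _ _ _ _ _ d1) (@derive_val _ _ _ _ _ _ _ d2) /=.
  by rewrite /dsq; field; rewrite -/(dsq p x.1) gt_eqF.
Qed.

Lemma holo_comb (a b : R) W1 W2 P1 Q1 P2 Q2 : holo W1 P1 Q1 -> holo W2 P2 Q2 ->
  holo (W1 `&` W2) (fun z => a * P1 z + b * P2 z) (fun z => a * Q1 z + b * Q2 z).
Proof.
move=> [ o1 cP1 cQ1 r1 i1] [ o2 cP2 cQ2 r2 i2].
have oW : open [set x : X | (W1 `&` W2) x.1] by exact: openI.
have comb (f g : X -> R) : (forall n, Cn_on n [set x : X | W1 x.1] f) ->
    (forall n, Cn_on n [set x : X | W2 x.1] g) -> forall n,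
    Cn_on n [set x : X | (W1 `&` W2) x.1] (fun x => a * f x + b * g x).
  move=> cf cg n; apply: CnD => //; apply: CnM => //; try exact: Cn_cst.
    by apply: Cn_subset (cf n) => x [].
  by apply: Cn_subset (cg n) => x [].
have dc (f g : X -> R) v x : (forall n, Cn_on n [set x : X | W1 x.1] f) ->
    (forall n, Cn_on n [set x : X | W2 x.1] g) -> (W1 `&` W2) x.1 ->
    'D_v (fun x => a * f x + b * g x) x = a * 'D_v f x + b * 'D_v g x.
  move=> cf cg [w1 w2].
  have [df _] := cf 1%N; have [dg _] := cg 1%N.
  have dfx : derivable f x v by apply/diff_derivable/df.
  have dgx : derivable g x v by apply/diff_derivable/dg.
  have dfa : derivable (a \*: f) x v by exact: derivableZ.
  have dgb : derivable (b \*: g) x v by exact: derivableZ.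
  apply: etrans (deriveD dfa dgb) _.
  exact: (congr2 +%R (deriveZ a dfx) (deriveZ b dgx)).
split=> //.
- by apply: comb.
- by apply: comb.
- move=> x [w1 w2]; rewrite (dc _ _ _ _ cP1 cP2)// (dc _ _ _ _ cQ1 cQ2)//.
  by rewrite r1// r2.
- move=> x [w1 w2]; rewrite (dc _ _ _ _ cP1 cP2)// (dc _ _ _ _ cQ1 cQ2)//.
  by rewrite i1// i2// !mulrN opprD.
Qed.

End HolomorphicFactor.

Section ClosedForm.
Context {R : realType}.
Local Notation X := (C2 R).
Local Notation Re := (@complex.Re R).
Local Notation Im := (@complex.Im R).
Local Notation R1 := (measurableTypeR R).
Local Notation R2 := (R1 * R1)%type.
Local Notation leb2 := (@leb2 R).
Local Notation leb4 := (@leb4 R).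

Definition annulus (E : R) : set (R * R) := [set z | 1 < nsq z < E].

(** The form [(P + i Q)(z1) dzbar_2] over the annulus, extended by 0. Its
   coefficient jumps only in the variable z2. *)
Definition holo_form (E : R) (P Q : R * R -> R) : @cform R 2 := fun x =>
  \row_i (if (i == 1) && (1 < nsq x.2 < E) then P x.1 +i* Q x.1 else 0).

Variables (D : set X) (E : R) (W : set (R * R)) (P Q : R * R -> R).
Hypothesis hW : holo W P Q.
Hypothesis DW : forall x, D x -> annulus E x.2 -> W x.1.

Let line_x (y : R) (z2 : R * R) (t : R) :
  ((0, y), z2) + t *: dirx 0 = ((t, y), z2) :> X.
Proof.
case: z2 => p q; congr ((_, _), (_, _)).
- by apply: etrans (add0r _) _; exact: mulr1.
- by apply: etrans (congr1 (+%R _) (mulr0 t)) (addr0 _).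
- by apply: etrans (congr1 (+%R _) (mulr0 t)) (addr0 _).
- by apply: etrans (congr1 (+%R _) (mulr0 t)) (addr0 _).
Qed.

Let line_y (x : R) (z2 : R * R) (t : R) :
  ((x, 0), z2) + t *: diry 0 = ((x, t), z2) :> X.
Proof.
case: z2 => p q; congr ((_, _), (_, _)).
- by apply: etrans (congr1 (+%R _) (mulr0 t)) (addr0 _).
- by apply: etrans (add0r _) _; exact: mulr1.
- by apply: etrans (congr1 (+%R _) (mulr0 t)) (addr0 _).
- by apply: etrans (congr1 (+%R _) (mulr0 t)) (addr0 _).
Qed.

Section slice.
Variables (phi : X -> R[i]) (K : set X).
Hypotheses (sR : smooth_on setT (fun x => Re (phi x)))
  (sI : smooth_on setT (fun x => Im (phi x)))
  (cK : compact K) (KD : K `<=` D) (K0 : forall x, ~ K x -> phi x = 0).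

Let S (x : X) := P x.1 * Re (phi x) + - Q x.1 * Im (phi x).
Let T (x : X) := P x.1 * Im (phi x) + Q x.1 * Re (phi x).

Let S0 x : ~ K x -> S x = 0.
Proof. by move=> nK; rewrite /S K0//= !mulr0 addr0. Qed.

Let T0 x : ~ K x -> T x = 0.
Proof. by move=> nK; rewrite /T K0//= !mulr0 addr0. Qed.

Let O : set X := [set x | W x.1] `|` ~` K.

Let oK : open (~` K).
Proof. by apply: closed_openC; exact: compact_closed hausdorff_C2 cK. Qed.

Let oW : open [set x : X | W x.1]. Proof. by have [] := hW. Qed.

Let oO : open O. Proof. exact: openU. Qed.

(** The coefficient is smooth on [W] only, but its products with [phi] are smooth
   on the larger open set [O], which contains whole slices. *)
Let VO x : annulus E x.2 -> O x.
Proof. by move=> Vx; have [/KD Dx|nK] := pselect (K x); [left; exact: DW|right]. Qed.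

Let CnO n f : Cn_on n [set x : X | W x.1] f -> (forall x, ~ K x -> f x = 0) -> Cn_on n O f.
Proof.
move=> cf f0; apply: CnU => //; apply: (@Cn_ext _ _ _ (fun=> 0)) => //.
  by move=> x /f0 ->.
exact: Cn_cst.
Qed.

Let CnN n U f : open U -> Cn_on n U f -> Cn_on n U (fun x : X => - f x).
Proof.
move=> oU cf; rewrite (_ : (fun x => _) = fun x => (-1) * f x).
  by apply: CnM => //; exact: Cn_cst.
by apply/funext => x; rewrite mulN1r.
Qed.

Let CS n : Cn_on n O S.
Proof.
have [_ cP cQ _ _] := hW.
apply: CnO => [|x nK]; last exact: S0.
apply: CnD => //; apply: CnM => //.
- by apply: Cn_subset (sR n).
- exact: CnN.
- by apply: Cn_subset (sI n).
Qed.

Let CT n : Cn_on n O T.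
Proof.
have [_ cP cQ _ _] := hW.
apply: CnO => [|x nK]; last exact: T0.
apply: CnD => //; apply: CnM => //.
- by apply: Cn_subset (sI n).
- by apply: Cn_subset (sR n).
Qed.

Let near0 (f : X -> R) v x : (forall x, ~ K x -> f x = 0) -> ~ K x -> 'D_v f x = 0.
Proof.
move=> f0 nK; rewrite (@near_eq_derive _ _ _ _ (cst (0 : R))) ?derive_cst//.
by near=> y; apply: f0; near: y; exact: open_nbhs_nbhs.
Unshelve. all: by end_near. Qed.

Let deriveMD (f1 f2 g1 g2 : X -> R) v x : derivable f1 x v -> derivable f2 x v ->
  derivable g1 x v -> derivable g2 x v ->
  'D_v (fun x => f1 x * g1 x + f2 x * g2 x) x =
  (f1 x * 'D_v g1 x + g1 x * 'D_v f1 x) + (f2 x * 'D_v g2 x + g2 x * 'D_v f2 x).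
Proof.
move=> d1 d2 e1 e2.
apply: etrans (deriveD (derivableM d1 e1) (derivableM d2 e2)) _.
exact: (congr2 +%R (deriveM d1 e1) (deriveM d2 e2)).
Qed.

(** The Cauchy-Riemann equations turn the integrand into a divergence. *)
Let divergence x : annulus E x.2 ->
  P x.1 * Re (dzbar 0 phi x) - Q x.1 * Im (dzbar 0 phi x) =
  2^-1 * ('D_(dirx 0) S x - 'D_(diry 0) T x).
Proof.
move=> Vx; rewrite dzbar_Re dzbar_Im; have [/KD Dx|nK] := pselect (K x); last first.
  have R0 y : ~ K y -> Re (phi y) = 0 by move=> nKy; rewrite K0.
  have I0 y : ~ K y -> Im (phi y) = 0 by move=> nKy; rewrite K0.
  rewrite (near0 (dirx 0) S0 nK) (near0 (diry 0) T0 nK).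
  rewrite (near0 (dirx 0) R0 nK) (near0 (diry 0) I0 nK).
  rewrite (near0 (dirx 0) I0 nK) (near0 (diry 0) R0 nK).
  by rewrite subrr addr0 !mulr0 subrr.
have Wx := DW Dx Vx; have [_ cP cQ rPQ iPQ] := hW.
have [dP _] := cP 1%N; have [dQ _] := cQ 1%N.
have dA v : derivable (fun y => Re (phi y)) x v by exact: smooth_derivable.
have dB v : derivable (fun y => Im (phi y)) x v by exact: smooth_derivable.
have dPx v : derivable (fun y : X => P y.1) x v by apply/diff_derivable/dP.
have dQx v : derivable (fun y : X => Q y.1) x v by apply/diff_derivable/dQ.
have dNQ v : derivable (fun y : X => - Q y.1) x v by exact: derivableN.
have ES := @deriveMD (fun y => P y.1) (fun y => - Q y.1) _ _ (dirx 0) x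
   (dPx _) (dNQ _) (dA _) (dB _).
have ET := @deriveMD (fun y => P y.1) (fun y => Q y.1) _ _ (diry 0) x
   (dPx _) (dQx _) (dB _) (dA _).
have EN : 'D_(dirx 0) (fun y : X => - Q y.1) x = - 'D_(dirx 0) (fun y : X => Q y.1) x.
  by apply: deriveN.
have alg (p q a b ax ay bx by_ px py qx qy : R) : px = qy -> py = - qx ->
   p * (2^-1 * (ax - by_)) - q * (2^-1 * (bx + ay)) =
   2^-1 * ((p * ax + a * px + (- q * bx + b * - qx)) - (p * by_ + b * py + (q * ay + a * qy))).
  by move=> -> ->; field.
apply: etrans (alg _ _ (Re (phi x)) (Im (phi x)) _ _ _ _ _ _ _ _ (rPQ _ Wx) (iPQ _ Wx)) _.
congr (_ * (_ - _)); last by exact: esym ET.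
by apply: etrans (esym ES); rewrite EN.
Qed.

Let bounded_support : exists2 m, 0 < m & forall x, K x ->
  `|x.1.1| <= m /\ `|x.1.2| <= m.
Proof.
have [M [_ HM]] := compact_bounded cK.
have M1 : M < `|M| + 1 by rewrite (le_lt_trans (ler_norm M))// ltrDl.
exists (`|M| + 1); first by rewrite ltr_wpDl.
move=> x /(HM _ M1) /=; rewrite {1}/Num.norm/= ge_max => /andP[+ _].
by rewrite {1}/Num.norm/= ge_max => /andP[].
Qed.

Lemma slice_integral0 (z2 : R * R) : annulus E z2 ->
  (\int[leb2]_z (P z * Re (dzbar 0 phi (z, z2)) - Q z * Im (dzbar 0 phi (z, z2)))%:E = 0)%E.
Proof.
move=> Vz.
have [m m0 Hm] := bounded_support.
have out (f : X -> R) z : (forall x, ~ K x -> f x = 0) ->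
    ~ (`[- m, m]%classic `*` `[- m, m]%classic) z -> ~ K (z, z2).
  move=> f0 zm Kz; apply: zm; have [h1 h2] := Hm _ Kz.
  by split; rewrite /= in_itv/= -ler_norml.
have cont (F : X -> R) v : (forall n, Cn_on n O F) -> continuous (fun z => 'D_v F (z, z2)).
  move=> cF z; apply: (@continuous_comp _ _ _ (fun z : R * R => (z, z2) : X) ('D_v F)); first exact: continuous_pairl.
  by have [_ DF] := cF 1%N; apply: DF; exact: VO.
have der (F : X -> R) v z : (forall n, Cn_on n O F) -> derivable F (z, z2) v.
  by move=> cF; have [dF _] := cF 1%N; apply/diff_derivable/dF; exact: VO.
have IS : (\int[leb2]_z ('D_(dirx 0) S (z, z2))%:E = 0)%E.
  apply: (@integral_partial_x _ (fun z => S (z, z2)) _ m) => //.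
  - exact: cont.
  - move=> x y.
    have dl := @is_derive_line R S ((0, y), z2) (dirx 0) x.
    have pE t := line_x y z2 t.
    rewrite pE in dl; have := dl (der _ _ _ CS).
    by congr (is_derive x 1 _ _); apply/funext => t; rewrite pE.
  - move=> z zm; have nK := out _ _ S0 zm.
    by split; [exact: S0|exact: near0 S0 nK].
have IT : (\int[leb2]_z ('D_(diry 0) T (z, z2))%:E = 0)%E.
  apply: (@integral_partial_y _ (fun z => T (z, z2)) _ m) => //.
  - exact: cont.
  - move=> x y.
    have dl := @is_derive_line R T ((x, 0), z2) (diry 0) y.
    have pE t := line_y x z2 t.
    rewrite pE in dl; have := dl (der _ _ _ CT).
    by congr (is_derive y 1 _ _); apply/funext => t; rewrite pE.
  - move=> z zm; have nK := out _ _ T0 zm.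
    by split; [exact: T0|exact: near0 T0 nK].
have iS : leb2.-integrable setT (EFin \o (fun z => 'D_(dirx 0) S (z, z2))).
  apply: (@continuous_box_integrable _ _ m); first exact: cont.
  by move=> z zm; apply: near0 S0 (out _ _ S0 zm).
have iT : leb2.-integrable setT (EFin \o (fun z => 'D_(diry 0) T (z, z2))).
  apply: (@continuous_box_integrable _ _ m); first exact: cont.
  by move=> z zm; apply: near0 T0 (out _ _ T0 zm).
pose gS z := 'D_(dirx 0) S (z, z2); pose gT z := 'D_(diry 0) T (z, z2).
transitivity (\int[leb2]_z ((2^-1)%R%:E * ((EFin \o gS) z - (EFin \o gT) z)))%E.
  by apply: eq_integral => z _; exact: (congr1 EFin (@divergence (z, z2) Vz)).
rewrite integralZl//; last exact: integrableB.
rewrite (_ : (\int[leb2]_z _ = 0)%E) ?mule0//.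
by rewrite integralB// IS IT sube0.
Qed.

End slice.

(** The component of the form along [dzbar_2] is paired with a derivative in
   [dzbar_1], which does not see the jump in z2. For each fixed z2 in the annulus
   the integral over z1 is that of a divergence with compact support. *)
Lemma holo_form_closed : measurable D -> (leb4 D < +oo)%E ->
  L2 D (holo_form E P Q) -> dbar1 D (holo_form E P Q) (fun=> 0).
Proof.
move=> mD finD Lf; apply: (dbar1_0P mD finD Lf) => phi tphi.
have [sR sI [K [cK KD K0]]] := tphi.
have t0 := test_function_dzbar 0 tphi.
have R0 : ip D (holo_form E P Q) (slot 0 (dzbar 1 phi)) = 0.
  rewrite /ip (_ : rdot _ _ = cst 0); first by rewrite Rintegral_cst// mul0r.
  apply/funext => x; rewrite rdot_slot.
  have -> : holo_form E P Q x 0 0 = 0 by rewrite mxE.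
  by rewrite mul0r.
apply: etrans _ (esym R0); rewrite /ip /Rintegral.
pose J x := rdot (holo_form E P Q) (slot 1 (dzbar 0 phi)) x.
have iJ : leb4.-integrable D (EFin \o J).
  by apply: integrable_rdot => //; exact: L2_slot.
suff E0 : (\int[leb4]_(x in D) (EFin \o J) x = 0)%E by exact: (congr1 fine E0).
pose J' := (EFin \o J) \_ D.
have iJ' : leb4.-integrable setT J' := (integrable_mkcond (mu := leb4) (EFin \o J) mD).1 iJ.
rewrite integral_mkcond -/J'.
rewrite -(@integral21_prod_meas1 _ _ R2 R2 R leb2 leb2 J' iJ').
rewrite (_ : (\int[leb2]_x _ = 0)%E)//; apply: integral0_eq => z2 _.
have JE z : J' (z, z2) = if 1 < nsq z2 < E then
   (P z * Re (dzbar 0 phi (z, z2)) - Q z * Im (dzbar 0 phi (z, z2)))%:E else 0%E.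
  rewrite /J' patchE; case: ifPn => [_|/negP nD].
    rewrite /J /= rdot_slot mxE /=; case: ifPn => _; last by rewrite mul0r.
    by rewrite cReM.
  have d0 : dzbar 0 phi (z, z2) = 0.
    have [_ _ [K' [_ K'D K'0]]] := t0.
    by apply: K'0 => /K'D Dz; apply: nD; rewrite inE.
  by rewrite d0 /= !mulr0 subrr; case: ifP.
rewrite /fubini_G; case: (boolP (1 < nsq z2 < E)) => Vz.
  by under eq_integral do rewrite JE Vz; apply: (slice_integral0 sR sI cK KD K0 Vz).
by apply: integral0_eq => z _; rewrite JE (negbTE Vz).
Qed.

End ClosedForm.

(** * Slices of the worm domain *)

Section WormGeometry.
Context {R : realType}.
Local Notation X := (C2 R).
Implicit Types (z : R * R) (x : X) (a th : R).

(** The pole is at distance at least [t cos (a / 2)] from every line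
   [Re (e^(- i th) z) = 0] with [0 <= th <= a], on the side away from the disc. *)
Lemma disc_pole_dist a t th z : 0 < a -> a < pi -> 0 < t -> 0 <= th <= a ->
  disc th z -> (t * cos (a / 2)) ^+ 2 <= dsq (pole a t) z.
Proof.
move=> a0 api t0 tha; rewrite /disc/= => zd.
have c0 := cos_bisector_le a0 api tha.
have n0 := nsq_ge0 z; have p0 := pi_gt0 R.
have ca : 0 < cos (a / 2) by apply: cos_gt0_pihalf; apply/andP; split; lra.
set u := z.1 - (pole a t).1; set v := z.2 - (pole a t).2.
have E : cos th * u + sin th * v = cos th * z.1 + sin th * z.2 + t * cos (th - a / 2).
  by rewrite cosB /u /v /pole/=; ring.
have le : t * cos (a / 2) <= cos th * u + sin th * v.
  rewrite E; have : t * cos (a / 2) <= t * cos (th - a / 2) by rewrite ler_pM2l.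
  lra.
have tc : 0 <= t * cos (a / 2) by rewrite mulr_ge0// ltW.
apply: (@le_trans _ _ ((cos th * u + sin th * v) ^+ 2)).
  by rewrite ler_sqr ?nnegrE// (le_trans tc).
rewrite /dsq -/u -/v -[leRHS]mul1r -(cos2Dsin2 th).
rewrite -subr_ge0 (_ : _ - _ = (cos th * v - sin th * u) ^+ 2) ?sqr_ge0//; ring.
Qed.

(** [e^(i th)] is a combination of [1] and [e^(i a)] with nonnegative
   coefficients of sum at least 1. *)
Lemma extreme_discs_sub a th z : 0 < a -> a < pi -> 0 <= th <= a ->
  (disc 0 `&` disc a) z -> disc th z.
Proof.
move=> a0 api /andP[th0 tha] [].
rewrite /disc/= cos0 sin0 mul1r mul0r addr0 => h0 ha.
have sa : 0 < sin a by apply: sin_gt0_pi; rewrite a0.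
have s1 : 0 <= sin th by apply: sin_ge0_pi; apply/andP; split; lra.
have s2 : 0 <= sin (a - th) by apply: sin_ge0_pi; apply/andP; split; lra.
have E : sin a = sin (a - th) * cos th + cos (a - th) * sin th by rewrite -sinD subrK.
have sge : sin a <= sin (a - th) + sin th.
  by rewrite E lerD// ?ler_piMr ?ler_piMl// cos_le1.
have n0 := nsq_ge0 z.
have Ed : sin a * (2 * (cos th * z.1 + sin th * z.2)) =
    sin (a - th) * (2 * z.1) + sin th * (2 * (cos a * z.1 + sin a * z.2)).
  rewrite sinB; ring.
rewrite -(ltr_pM2l sa) Ed.
apply: (@le_lt_trans _ _ ((sin (a - th) + sin th) * nsq z)); first by rewrite ler_wpM2r.
rewrite mulrDl; have [s10|s10] := ltrP 0 (sin th).
  by rewrite ler_ltD ?ltr_pM2l// ler_wpM2l// ltW.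
have -> : sin th = 0 by apply/eqP; rewrite eq_le s10 s1.
by rewrite !mul0r !addr0 ltr_pM2l//; lra.
Qed.

(** The argument of the centre of the slice over [z]. *)
Definition wind (beta : R) (z : R * R) : R := 2 * beta * ln (Num.sqrt (nsq z)).

Lemma wind_itv (beta eta : R) z : 0 < beta -> 1 < eta -> annulus (eta ^+ 2) z ->
  0 <= wind beta z <= 2 * beta * ln eta.
Proof.
move=> b0 e1 /andP[n1 n2]; have b2 : 0 <= 2 * beta by lra.
have s1 : 1 < Num.sqrt (nsq z) by rewrite -sqrtr1 ltr_sqrt//; lra.
have s2 : Num.sqrt (nsq z) < eta.
  by rewrite -[ltRHS]ger0_norm; [rewrite -sqrtr_sqr ltr_sqrt//; lra|lra].
apply/andP; split; first by rewrite mulr_ge0// ln_ge0// ltW.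
by rewrite ler_wpM2l// ler_ln ?posrE; lra.
Qed.

Lemma worm_slice (M beta r E : R) x : E <= r ^+ 2 -> annulus E x.2 ->
  worm M beta r x <-> disc (wind beta x.2) x.1.
Proof.
move=> Er /andP[n1 n2].
have z2E : normc (z2 x) = Num.sqrt (nsq x.2) by [].
have z20 : z2 x != 0.
  rewrite /z2; apply/eqP => -[h1 h2]; move: n1; rewrite /nsq h1 h2 expr0n/= addr0; lra.
have n0 := nsq_ge0 x.2.
have rE : worm_rho M beta r x =
    nsq x.1 - 2 * (cos (wind beta x.2) * x.1.1 + sin (wind beta x.2) * x.1.2).
  rewrite /worm_rho z2E sqr_sqrtr// /sigma !ifF ?addr0; last 2 first.
  - by apply/negbTE; rewrite -leNgt; lra.
  - by apply/negbTE; rewrite -leNgt; lra.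
  rewrite normc_sqr cReD cImD cReN cImN /z1/= -/(wind beta x.2) /nsq.
  have := cos2Dsin2 (wind beta x.2); set c := cos _; set s := sin _ => cs.
  transitivity (x.1.1 ^+ 2 + x.1.2 ^+ 2 - 2 * (c * x.1.1 + s * x.1.2) + (c ^+ 2 + s ^+ 2 - 1)).
    by ring.
  by rewrite cs subrr addr0.
rewrite /worm /disc/= rE; split; first by case=> _; rewrite subr_lt0.
by move=> h; split=> //; rewrite subr_lt0.
Qed.

End WormGeometry.

Section OpenAnnulus.
Context {R : realType}.
Local Notation R1 := (measurableTypeR R).
Local Notation R2 := (R1 * R1)%type.
Local Notation leb2 := (@leb2 R).

Lemma measurable_annulus (E : R) : measurable (annulus E : set R2).
Proof.
rewrite (_ : annulus E = @nsq R @^-1` `]1, E[%classic).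
  by rewrite -[X in measurable X]setTI; apply: measurable_nsq.
by apply/seteqP; split => z; rewrite /annulus/= in_itv.
Qed.

Lemma closed_annulus_area (s0 s1 : R) : 0 < s0 -> s0 < s1 ->
  leb2 [set z | s0 <= nsq z <= s1] = (pi * (s1 - s0))%:E.
Proof.
move=> s00 s01.
have := @annulus_radial_integral R (fun=> 1) (fun s : R => s) s0 s1 s00 s01
  (fun s _ => is_derive_id s 1) (fun s _ => @cst_continuous R R 1 s) (fun s _ => ler01).
by rewrite integral_cst ?mul1e//; exact: measurable_nsq_itv.
Qed.

(** The circle lies in annuli of arbitrarily small area. *)
Let circle_null (s : R) : 0 < s -> leb2 [set z | s <= nsq z <= s] = 0%E.
Proof.
move=> s0; apply/eqP; rewrite eq_le measure_ge0 andbT.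
apply/lee_addgt0Pr => e e0; rewrite add0e.
have pe : 0 < e / pi by rewrite divr_gt0// pi_gt0.
have lt : s < s + e / pi by rewrite ltrDl.
have := closed_annulus_area s0 lt; rewrite addrAC subrr add0r mulrCA divff ?mulr1; last first.
  by rewrite gt_eqF// pi_gt0.
move=> <-; apply: le_measure; rewrite ?inE; try exact: measurable_nsq_itv.
by move=> z /= /andP[-> h]; rewrite (le_trans h)// ltW.
Qed.

Lemma annulus_integral (k K : R -> R) (E : R) : 1 < E ->
  (forall s, 1 <= s <= E -> is_derive s 1 K (k s)) ->
  (forall s, 1 <= s <= E -> {for s, continuous k}) ->
  (forall s, 1 <= s <= E -> 0 <= k s) -> measurable_fun [set: R] k ->
  (\int[leb2]_(z in annulus E) (k (nsq z))%:E = (pi * (K E - K 1))%:E)%E.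
Proof.
move=> E1 dK ck k0 mk.
rewrite -(annulus_radial_integral ltr01 E1 dK ck k0).
pose N : set R2 := [set z | 1 <= nsq z <= 1] `|` [set z | E <= nsq z <= E].
have mN : measurable N by apply: measurableU; exact: measurable_nsq_itv.
have mC := @measurable_nsq_itv R 1 E.
rewrite [RHS](@ge0_negligible_integral _ _ _ leb2 _ N)//.
- congr (integral _ _ _); apply/seteqP; split=> z; rewrite /annulus /N/=.
    move=> /andP[h1 h2]; split; first by rewrite !ltW.
    by case=> /andP[h3 h4]; lra.
  move=> [/andP[h1 h2] h3]; apply/andP; split; rewrite lt_neqAle ?h1 ?h2 ?andbT;
    apply/negP => /eqP h; apply: h3; [left|right]; rewrite h lexx//.
- by apply: measurable_funTS; apply/measurable_EFinP; apply: measurableT_comp => //;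
    exact: measurable_nsq.
- by move=> z /k0 h; rewrite lee_fin.
have E0 : 0 < E by rewrite (lt_trans _ E1).
apply/eqP; rewrite eq_le measure_ge0 andbT.
apply: (@le_trans _ _ (leb2 [set z | (1 <= nsq z <= 1)%R] + leb2 [set z | (E <= nsq z <= E)%R])%E).
  exact: (@measureU2 _ _ _ leb2 _ _ (@measurable_nsq_itv R 1 1) (@measurable_nsq_itv R E E)).
by rewrite !circle_null// adde0.
Qed.

Lemma annulus_area (E : R) : 1 < E -> leb2 (annulus E) = (pi * (E - 1))%:E.
Proof.
move=> E1.
rewrite -(@annulus_integral (fun=> 1) (fun s : R => s) _ E1
  (fun s _ => is_derive_id s 1) (fun s _ => @cst_continuous R R 1 s) (fun s _ => ler01))//.
by rewrite integral_cst ?mul1e//; exact: measurable_annulus.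
Qed.

End OpenAnnulus.

Section FormSize.
Context {R : realType}.
Local Notation X := (C2 R).
Local Notation Re := (@complex.Re R).
Local Notation Im := (@complex.Im R).
Local Notation R1 := (measurableTypeR R).
Local Notation R2 := (R1 * R1)%type.
Local Notation leb2 := (@leb2 R).
Local Notation leb4 := (@leb4 R).

Lemma bounded_finite_leb4 (D : set X) : measurable D -> bounded_set D ->
  (leb4 D < +oo)%E.
Proof.
move=> mD [M0 [_ /(_ (M0 + 1)) DM0]]; pose M := M0 + 1.
have DM x : D x -> `|x| <= M by move=> Dx; apply: DM0 => //; rewrite ltrDl.
pose I : set R1 := `[(- M)%R, M]%classic; pose Q : set R2 := I `*` I.
pose B : set (R2 * R2) := Q `*` Q.
have mI : measurable I by exact: measurable_itv.
have mQ : measurable Q by exact: measurableX.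
have mB : measurable B by exact: measurableX.
have DB : D `<=` B.
  move=> x Dx; have : `|x| <= M by exact: DM.
  have le2 (p : R * R) : `|p| <= M -> Q p.
    rewrite prod_normE ge_max => /andP[]; rewrite !ler_norml => h1 h2.
    by split; rewrite /I/= in_itv.
  by rewrite prod_normE ge_max => /andP[/le2 h1 /le2 h2].
apply: (@le_lt_trans _ _ (leb4 B)); first by apply: le_measure; rewrite ?inE.
have I_fin : ((@lebesgue_measure R) I < +oo)%E.
  by rewrite /I lebesgue_measure_itv/=; case: ifP; rewrite -?EFinB ltry.
have Q_fin : (leb2 Q < +oo)%E.
  by rewrite /leb2 product_measure1E// lte_mul_pinfty// ge0_fin_numE.
by rewrite /leb4 product_measure1E// lte_mul_pinfty// ge0_fin_numE.
Qed.

Variables (D : set X) (E : R) (P Q : R * R -> R).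
Hypotheses (mD : measurable D) (finD : (leb4 D < +oo)%E).
Hypotheses (mP : measurable_fun [set: R2] P) (mQ : measurable_fun [set: R2] Q).

Lemma measurable_holo_form : measurable_form D (holo_form E P Q).
Proof.
have mA : measurable_fun [set: R2 * R2] (fun x => 1 < nsq x.2 < E).
  apply: measurable_and; apply: measurable_fun_ltr => //;
    by apply: measurableT_comp => //; exact: measurable_nsq.
have H (F : R * R -> R) : measurable_fun [set: R2] F ->
    measurable_fun [set: R2 * R2] (fun x => if 1 < nsq x.2 < E then F x.1 else 0).
  move=> mF; apply: measurable_fun_ifT => //.
  by apply: measurableT_comp.
move=> i; split; apply: measurable_funTS.
  rewrite (_ : (fun x => _) = fun x : X => if i == 1 then
    (if 1 < nsq x.2 < E then P x.1 else 0) else 0); last first.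
    by apply/funext => x; rewrite mxE; case: (i == 1) => //=; case: ifP.
  by case: (i == 1) => //; exact: H.
rewrite (_ : (fun x => _) = fun x : X => if i == 1 then
    (if 1 < nsq x.2 < E then Q x.1 else 0) else 0); last first.
  by apply/funext => x; rewrite mxE; case: (i == 1) => //=; case: ifP.
by case: (i == 1) => //; exact: H.
Qed.

Lemma sqnorm_holo_form (x : X) : sqnorm (holo_form E P Q) x =
  if 1 < nsq x.2 < E then P x.1 ^+ 2 + Q x.1 ^+ 2 else 0.
Proof.
rewrite /sqnorm big_ord_recl big_ord1 !mxE normc_sqr/= expr0n/= addr0 add0r.
by case: ifP => _; rewrite normc_sqr//= expr0n/= addr0.
Qed.

(** Tonelli: the slice over each z2 contributes at most [B], and the form vanishes
   over the complement of the annulus. *)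
Lemma holo_form_size (B : R) : 1 < E -> 0 <= B ->
  (forall z2, annulus E z2 -> exists S : set R2, [/\ measurable S,
     forall z, D (z, z2) -> S z &
     (\int[leb2]_(z in S) (P z ^+ 2 + Q z ^+ 2)%:E <= B%:E)%E]) ->
  (\int[leb4]_(x in D) (sqnorm (holo_form E P Q) x)%:E <= (B * (pi * (E - 1)))%:E)%E.
Proof.
move=> E1 B0 H; pose J := (fun x => (sqnorm (holo_form E P Q) x)%:E) \_ D.
have J0 x : (0 <= J x)%E.
  by rewrite /J patchE; case: ifPn => // _; rewrite lee_fin sqnorm_ge0.
have mJ : measurable_fun [set: R2 * R2] J.
  apply/(measurable_restrictT _ mD); apply/measurable_EFinP.
  by apply: measurable_sqnorm => //; exact: measurable_holo_form.
rewrite integral_mkcond -/J (@fubini_tonelli2 _ _ R2 R2 R leb2 leb2 J mJ J0).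
apply: (@le_trans _ _ (\int[leb2]_(z2 in annulus E) B%:E)%E).
  rewrite [leRHS]integral_mkcond; apply: ge0_le_integral => //.
  - by move=> z _; apply: integral_ge0.
  - exact: measurable_fun_fubini_tonelli_G.
  - by apply/(measurable_restrictT _ (measurable_annulus E)).
  move=> z2 _; rewrite patchE; case: ifPn => [/set_mem Az|nA]; last first.
    rewrite /fubini_G integral0_eq// => z _; rewrite /J patchE; case: ifPn => // _.
    by rewrite sqnorm_holo_form/= ifF//; apply/negP => h; move: nA; rewrite notin_setE; apply.
  have [S [mS DS BS]] := H z2 Az; apply: le_trans BS; rewrite [leRHS]integral_mkcond.
  have mPQ : measurable_fun [set: R2] (fun z => (P z ^+ 2 + Q z ^+ 2)%:E).
    by apply/measurable_EFinP; apply: measurable_funD; exact: measurable_funX.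
  apply: ge0_le_integral => //.
  - exact: (measurableT_comp mJ (pair2_measurable z2)).
  - by apply/(measurable_restrictT _ mS); exact: measurable_funTS.
  move=> z _; rewrite /J !patchE; case: ifPn => [/set_mem/DS Sz|_]; last first.
    by case: ifPn => // _; rewrite lee_fin addr_ge0 ?sqr_ge0.
  by rewrite ifT ?inE// sqnorm_holo_form/=; rewrite Az.
rewrite integral_cst; last exact: measurable_annulus.
have areaE := annulus_area E1.
by rewrite EFinM -areaE.
Qed.

End FormSize.

(** * The torsion function of an annulus *)

Section SoftPositivePart.
Context {R : realType}.
Implicit Types (d y : R).

(** A smooth version of the positive part of [y]. *)
Definition soft d y : R := y * flat_poly d 1 y.

Definition dsoft d y : R := if 0 < y then (1 + d / y) * expR (- (d / y)) else 0.

Lemma flat_poly1 d y : flat_poly d 1 y = if 0 < y then expR (- (d / y)) else 0.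
Proof. by rewrite /flat_poly hornerC mul1r. Qed.

Lemma flat_poly1_itv d y : 0 <= d -> 0 <= flat_poly d 1 y <= 1.
Proof.
move=> d0; rewrite flat_poly1; case: ifP => y0; last by rewrite lexx ler01.
by rewrite expR_ge0/= -expR0 ler_expR oppr_le0 divr_ge0// ltW.
Qed.

Lemma is_derive_soft d y : 0 < d -> is_derive y 1 (soft d) (dsoft d y).
Proof.
move=> d0; have h1 := @is_derive_id R R y 1.
have h2 := @is_derive_flat_poly R d 1 y d0.
have := @is_deriveM R R _ _ y 1 _ _ h1 h2.
move=> /is_derive_eq; apply; rewrite /GRing.scale/= mulr1 /dsoft /flat_poly.
case: ifP => y0; last by rewrite mulr0 addr0.
rewrite derivC subr0 hornerM hornerXn hornerZ !hornerC exprVn.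
by field; rewrite gt_eqF.
Qed.

Lemma dsoft_itv d y : 0 < d -> 0 <= dsoft d y <= 1.
Proof.
move=> d0; rewrite /dsoft; case: ifP => y0; last by rewrite lexx ler01.
have q0 : 0 < d / y by rewrite divr_gt0.
apply/andP; split; first by rewrite mulr_ge0 ?expR_ge0//; lra.
by rewrite expRN ler_pdivrMr ?expR_gt0// mul1r expR_ge1Dx.
Qed.

Lemma soft_ge d y : 0 <= d -> y - d <= soft d y.
Proof.
move=> d0; rewrite /soft flat_poly1; case: ifPn => y0; last by rewrite mulr0; lra.
have := expR_ge1Dx (- (d / y)); rewrite -(ler_pM2l y0); apply: le_trans.
by rewrite mulrDr mulr1 mulrN mulrCA divff ?gt_eqF// mulr1.
Qed.

Lemma soft_eq0 d y : y <= 0 -> soft d y = 0.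
Proof. by move=> y0; rewrite /soft flat_poly1 ltNge y0 mulr0. Qed.

End SoftPositivePart.

Section RadialProfile.
Context {R : realType}.
Variable E : R.
Hypothesis E_gt1 : 1 < E.

Definition kappa : R := (E - 1) / ln E.

(** The solution of [(s G')' = -1] that vanishes at 1 and at [E]. The Laplacian of
   [G(|z|^2)] is constant: up to a factor this is the torsion function of the
   annulus. *)
Definition torsion (s : R) : R := kappa * ln s - (s - 1).

Let lnE_gt0 : 0 < ln E. Proof. exact: ln_gt0. Qed.

Lemma kappa_lnE : kappa * ln E = E - 1.
Proof. by rewrite /kappa divfK// gt_eqF. Qed.

(** This bound and the next one are the two cases of [ln s < s - 1] that make the
   torsion function decrease to 0 with nonzero slope at both ends. *)
Lemma kappa_gt1 : 1 < kappa.
Proof.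
have E0 : 0 < E by rewrite (lt_trans _ E_gt1).
rewrite ltr_pdivlMr// mul1r.
have := expR_gt1Dx (lt0r_neq0 lnE_gt0); rewrite lnK ?posrE//; lra.
Qed.

Lemma kappa_ltE : kappa < E.
Proof.
have E0 : 0 < E by rewrite (lt_trans _ E_gt1).
have n0 : - ln E != 0 by rewrite oppr_eq0 gt_eqF.
have := expR_gt1Dx n0; rewrite expRN lnK ?posrE//.
rewrite /kappa ltr_pdivrMr// -(ltr_pM2l E0) divff ?gt_eqF//; lra.
Qed.

Let ln_le (s : R) : 0 < s -> ln s <= s - 1.
Proof. by move=> s0; have := expR_ge1Dx (ln s); rewrite lnK ?posrE//; lra. Qed.

Lemma torsion_le1 s : 0 < s -> torsion s <= (kappa - 1) * (s - 1).
Proof.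
move=> s0; have k1 := kappa_gt1; rewrite /torsion.
have : kappa * ln s <= kappa * (s - 1) by rewrite ler_pM2l ?ln_le//; lra.
lra.
Qed.

Lemma torsion_leE s : 0 < s -> torsion s <= (1 - kappa / E) * (E - s).
Proof.
move=> s0; have k1 := kappa_gt1; have E0 : 0 < E by rewrite (lt_trans _ E_gt1).
have sE : 0 < s / E by rewrite divr_gt0.
have : kappa * ln (s / E) <= kappa * (s / E - 1) by rewrite ler_pM2l ?ln_le//; lra.
rewrite ln_div ?posrE// mulrBr kappa_lnE /torsion.
have -> : (1 - kappa / E) * (E - s) = kappa * (s / E - 1) + (E - s).
  by field; rewrite gt_eqF.
lra.
Qed.

Let slopeE_gt0 : 0 < 1 - kappa / E.
Proof.
have E0 : 0 < E by rewrite (lt_trans _ E_gt1).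
by rewrite subr_gt0 ltr_pdivrMr// mul1r kappa_ltE.
Qed.

Lemma torsion_le0 s : 0 < s -> ~~ (1 < s < E) -> torsion s <= 0.
Proof.
move=> s0; rewrite negb_and -!leNgt => /orP[s1|sE].
  apply: (le_trans (torsion_le1 s0)); have k1 := kappa_gt1.
  by rewrite mulr_ge0_le0//; lra.
apply: (le_trans (torsion_leE s0)).
by rewrite mulr_ge0_le0//; [exact: ltW|lra].
Qed.

Lemma is_derive_torsion (s : R) : 0 < s -> is_derive s 1 torsion (kappa / s - 1).
Proof.
move=> s0; have h1 := is_derive1_ln s0.
have h2 := @is_deriveZ R R R _ kappa s 1 _ h1.
have h3 := @is_deriveB R R R _ _ s 1 _ _ (@is_derive_id R R s 1) (@is_derive_cst R R R 1 s 1).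
have := @is_deriveB R R R _ _ s 1 _ _ h2 h3.
by move=> /is_derive_eq; apply; rewrite /GRing.scale/= subr0.
Qed.

(** This is [2 G - s G'^2] with [G] the torsion function; [s G'^2] is the squared
   norm of the derivative of [G(|z|^2)] with respect to [conj z]. *)
Definition energy (s : R) : R :=
  2 * kappa * ln s - 2 * (s - 1) - (kappa ^+ 2 * s^-1 - 2 * kappa + s).

Lemma energyE s : 0 < s -> energy s = 2 * torsion s - s * (kappa / s - 1) ^+ 2.
Proof. by move=> s0; rewrite /energy /torsion; field; rewrite gt_eqF. Qed.

(** Adding this constant to the energy makes it nonnegative on the annulus, so
   that integrals of nonnegative functions suffice. *)
Definition energy_bound : R := 2 * (E - 1) + kappa ^+ 2 + E.

Lemma energy_ge s : 1 <= s <= E -> - energy_bound <= energy s.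
Proof.
move=> /andP[s1 sE]; have k1 := kappa_gt1; rewrite /energy /energy_bound.
have l0 : 0 <= 2 * kappa * ln s by rewrite mulr_ge0 ?ln_ge0//; lra.
have v0 : kappa ^+ 2 * s^-1 <= kappa ^+ 2.
  by rewrite ler_piMr ?sqr_ge0// invf_le1//; lra.
lra.
Qed.

(** Up to the factor [pi], the integral of the torsion function over the annulus.
   The energy has the same integral, since integration by parts gives
   [s G'^2] and [G] the same integral over [[1, E]]. *)
Definition torsion_integral : R := (E ^+ 2 - 1) / 2 - (E - 1) ^+ 2 / ln E.

Lemma measurable_energy : measurable_fun [set: R] energy.
Proof.
apply: measurable_funB.
  apply: measurable_funB; last by apply: measurable_funM => //; exact: measurable_funB.
  by apply: measurable_funM => //; exact: measurable_ln.
apply: measurable_funD => //; apply: measurable_funB => //.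
by apply: measurable_funM => //; exact: measurable_inv.
Qed.

Let energy_primitive (e s : R) : R :=
  2 * kappa * (s * ln s) - (s - 1) ^+ 2 - kappa ^+ 2 * ln s - s ^+ 2 / 2 + e * s.

Let is_derive_energy_primitive (e s : R) : 0 < s ->
  is_derive s 1 (energy_primitive e) (energy s + e).
Proof.
move=> s0; have hl := is_derive1_ln s0; have hi := @is_derive_id R R s 1.
have h1 := @is_deriveM R R _ _ s 1 _ _ hi hl.
have h2 := @is_deriveZ R R R _ (2 * kappa) s 1 _ h1.
have h3 := @is_deriveB R R R _ _ s 1 _ _ hi (@is_derive_cst R R R 1 s 1).
have h4 := @is_deriveM R R _ _ s 1 _ _ h3 h3.
have h5 := @is_deriveZ R R R _ (kappa ^+ 2) s 1 _ hl.
have h6 := @is_deriveZ R R R _ (2^-1) s 1 _ (@is_deriveM R R _ _ s 1 _ _ hi hi).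
have h7 := @is_deriveZ R R R _ e s 1 _ hi.
have h8 := @is_deriveB R R R _ _ s 1 _ _ h2 h4.
have h9 := @is_deriveB R R R _ _ s 1 _ _ h8 h5.
have h10 := @is_deriveB R R R _ _ s 1 _ _ h9 h6.
have := @is_deriveD R R R _ _ s 1 _ _ h10 h7.
rewrite (_ : _ + _ = energy_primitive e); last first.
  apply/funext => t; rewrite /energy_primitive !fctE.
  transitivity (2 * kappa * (t * ln t) - (t - 1) * (t - 1) - kappa ^+ 2 * ln t
    - 2^-1 * (t * t) + e * t); first by [].
  ring.
move=> /is_derive_eq; apply; rewrite /GRing.scale/= /energy !fctE; field.
by rewrite gt_eqF.
Qed.

Let continuous_energy (e s : R) : 0 < s -> {for s, continuous (fun s => energy s + e)}.
Proof.
move=> s0; have cl : {for s, continuous (@ln R)} by exact: continuous_ln.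
have cv : {for s, continuous (fun s : R => s^-1)} by apply: inv_continuous; rewrite gt_eqF.
have ci : {for s, continuous (fun s : R => s)} by [].
have cc (c : R) : {for s, continuous (fun _ : R => c)} by exact: cst_continuous.
apply: continuousD; last exact: cc.
apply: continuousB.
  apply: continuousB; first by apply: continuousM; [exact: cc|].
  by apply: continuousM; [exact: cc|apply: continuousB; [|exact: cc]].
apply: continuousD => //; apply: continuousB; last exact: cc.
by apply: continuousM; [exact: cc|].
Qed.

Lemma energy_integral (e : R) : energy_bound <= e ->
  (\int[@leb2 R]_(z in annulus E) (energy (nsq z) + e)%:E =
  (pi * (torsion_integral + e * (E - 1)))%:E)%E.
Proof.
move=> be; have pos (s : R) : 1 <= s <= E -> 0 < s.
  by move=> /andP[s1 _]; rewrite (lt_le_trans _ s1).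
rewrite (@annulus_integral _ (fun s => energy s + e) (energy_primitive e) _ E_gt1
  (fun s h => @is_derive_energy_primitive e s (pos s h))
  (fun s h => @continuous_energy e s (pos s h))); first last.
- by apply: measurable_funD => //; exact: measurable_energy.
- by move=> s /energy_ge h; lra.
- have E0 : 0 < E by rewrite (lt_trans _ E_gt1).
  congr (pi * _)%:E; rewrite /energy_primitive /torsion_integral ln1.
  have -> : kappa ^+ 2 * ln E = (E - 1) ^+ 2 / ln E by rewrite /kappa; field; rewrite gt_eqF.
  have -> : 2 * kappa * (E * ln E) = 2 * E * (E - 1) by rewrite -kappa_lnE; ring.
  by field; rewrite gt_eqF.
Qed.

End RadialProfile.

Section AnnularCutoff.
Context {R : realType}.
Local Notation X := (C2 R).
Implicit Types (x : X) (d : R).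
Variable E : R.
Hypothesis E_gt1 : 1 < E.

(** A truncation of the torsion function that is smooth and supported inside the
   open annulus. *)
Definition cutoff d (z : R * R) : R :=
  if 1 < nsq z < E then soft d (torsion E (nsq z) - d) else 0.

Let cutoffE d z : 0 < d -> 0 < nsq z -> cutoff d z = soft d (torsion E (nsq z) - d).
Proof.
move=> d0 z0; rewrite /cutoff; case: ifPn => // /(torsion_le0 E_gt1 z0) G0.
by rewrite soft_eq0//; lra.
Qed.

Lemma cutoff_support d : 0 < d -> exists e1 e2 : R, [/\ 0 < e1, 0 < e2 &
  forall z, cutoff d z != 0 -> 1 + e1 <= nsq z <= E - e2].
Proof.
move=> d0; have k1 := kappa_gt1 E_gt1; have kE := kappa_ltE E_gt1.
have E0 : 0 < E by rewrite (lt_trans _ E_gt1).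
have q1 : 0 < kappa E - 1 by lra.
have q2 : 0 < 1 - kappa E / E by rewrite subr_gt0 ltr_pdivrMr// mul1r.
(* Where the cutoff is nonzero, [d <= torsion E s]; the two linear bounds of the
   torsion function turn this into distances from 1 and from [E]. *)
exists (d / (kappa E - 1)), (d / (1 - kappa E / E)); split; rewrite ?divr_gt0// => z.
have [zs|] := boolP (1 < nsq z < E); last by rewrite /cutoff => /negbTE ->; rewrite eqxx.
have z0 : 0 < nsq z by move: zs => /andP[h _]; exact: lt_trans h.
rewrite cutoffE// => n0.
have Gd : d <= torsion E (nsq z).
  rewrite leNgt; apply/negP => Gd; move: n0; rewrite soft_eq0 ?eqxx//; lra.
apply/andP; split.
  have := le_trans Gd (torsion_le1 E_gt1 z0); rewrite -ler_pdivrMl// mulrC; lra.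
have := le_trans Gd (torsion_leE E_gt1 z0); rewrite -ler_pdivrMl// mulrC; lra.
Qed.

Let Cn_nsq n U : open U -> Cn_on n U (fun x : X => nsq x.2).
Proof.
move=> oU; rewrite (_ : (fun x : X => _) = fun x : X => x.2.1 * x.2.1 + x.2.2 * x.2.2).
  by apply: CnD => //; apply: CnM => //; (exact: Cn_x2 || exact: Cn_y2).
by apply/funext => x; rewrite /nsq !expr2.
Qed.

Lemma continuous_nsq2 : continuous (fun x : X => nsq x.2).
Proof. by move=> x; have := @Cn_nsq 0 setT openT; exact. Qed.

Let pos2 : set X := [set x | 0 < nsq x.2].
Let hole : set X := [set x | nsq x.2 < 1].

Let o_pos2 : open pos2.
Proof. by apply: (open_comp (f := fun x : X => nsq x.2)) (@open_gt R 0) => x _; exact: continuous_nsq2. Qed.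

Let o_hole : open hole.
Proof. by apply: (open_comp (f := fun x : X => nsq x.2)) (@open_lt R 1) => x _; exact: continuous_nsq2. Qed.

Let cutoff_hole d x : hole x -> cutoff d x.2 = 0.
Proof. by rewrite /hole /cutoff/= => h; rewrite ifF//; apply/negP => /andP[]; lra. Qed.

Let cover : pos2 `|` hole = setT.
Proof.
apply/seteqP; split=> // x _; rewrite /pos2 /hole/=.
by have [h|h] := ltP 0 (nsq x.2); [left|right; lra].
Qed.

Lemma smooth_cutoff d : 0 < d -> smooth_on setT (fun x : X => cutoff d x.2).
Proof.
move=> d0 n; rewrite -cover; apply: CnU; last first.
  by apply: (@Cn_ext _ _ _ (fun=> 0)) => //; [move=> x /cutoff_hole ->|exact: Cn_cst].
pose Gd (x : X) := kappa E * ln (nsq x.2) + (-1) * nsq x.2 + (1 - d).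
have cG : Cn_on n pos2 Gd.
  apply: CnD => //; last exact: Cn_cst.
  apply: CnD => //; apply: CnM => //; try exact: Cn_cst; try exact: Cn_nsq.
  exact: (Cn_comp1 smooth1_ln o_pos2 (fun x h => h) (Cn_nsq n o_pos2)).
apply: (@Cn_ext _ _ _ (fun x => Gd x * flat_poly d 1 (Gd x))) => //.
  move=> x x0; rewrite cutoffE// /soft.
  by rewrite (_ : torsion E (nsq x.2) - d = Gd x)// /Gd /torsion; ring.
apply: CnM => //.
exact: (Cn_comp1 (smooth1_flat_poly 1 d0) o_pos2 (fun x h => I) cG).
Qed.

Let is_derive_nsq2 x v : is_derive x v (fun x : X => nsq x.2) (2 * (x.2.1 * v.2.1 + x.2.2 * v.2.2)).
Proof.
have hX := is_derive_x2 x v; have hY := is_derive_y2 x v.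
have hXX := @is_deriveM R X _ _ x v _ _ hX hX.
have hYY := @is_deriveM R X _ _ x v _ _ hY hY.
have := @is_deriveD R X R _ _ x v _ _ hXX hYY.
have -> : (fun x : X => x.2.1) * (fun x : X => x.2.1) +
   (fun x : X => x.2.2) * (fun x : X => x.2.2) = (fun x : X => nsq x.2).
  by apply/funext => y; rewrite /nsq !expr2.
by move=> /is_derive_eq; apply; rewrite /GRing.scale/=; ring.
Qed.

Let derive_local (f g : X -> R) (U : set X) x v : open U -> U x ->
  (forall y, U y -> f y = g y) -> 'D_v f x = 'D_v g x.
Proof.
move=> oU Ux fg; apply: near_eq_derive.
by near=> y; apply: fg; near: y; exact: open_nbhs_nbhs.
Unshelve. all: by end_near. Qed.

Let derive_cutoff d x v : 0 < d -> 0 < nsq x.2 ->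
  'D_v (fun x : X => cutoff d x.2) x =
  dsoft d (torsion E (nsq x.2) - d) * (kappa E / nsq x.2 - 1)
  * (2 * (x.2.1 * v.2.1 + x.2.2 * v.2.2)).
Proof.
move=> d0 x0; have dn := is_derive_nsq2 x v.
have dfn : differentiable (fun x : X => nsq x.2) x by have [H _] := @Cn_nsq 1 setT openT; exact: H.
pose h (s : R) := soft d (torsion E s - d).
pose dh (s : R) := dsoft d (torsion E s - d) * (kappa E / s - 1).
have dhx : is_derive (nsq x.2) 1 h (dh (nsq x.2)).
  have h1 := is_derive_torsion E x0.
  have h2 := @is_deriveB R R R _ _ (nsq x.2) 1 _ _ h1 (@is_derive_cst R R R d (nsq x.2) 1).
  rewrite subr0 in h2.
  exact: (@is_derive1_comp R (soft d) (fun s => torsion E s - d) _ _ _ (is_derive_soft _ d0) h2).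
have [_ D] := derive_comp1 (h := h) (dh := dh) v dfn dhx.
apply: etrans (derive_local v o_pos2 x0 (fun y (y0 : pos2 y) => cutoffE d0 y0)) _.
by apply: etrans D _; rewrite (@derive_val _ _ _ _ _ _ _ dn).
Qed.

Definition grad2 d x : R := ('D_(dirx 1) (fun x : X => cutoff d x.2) x) ^+ 2 +
  ('D_(diry 1) (fun x : X => cutoff d x.2) x) ^+ 2.

Lemma grad2_out d x : 0 < d -> ~~ (1 < nsq x.2 < E) -> grad2 d x = 0.
Proof.
move=> d0 nA; rewrite /grad2; have [x0|x0] := ltP 0 (nsq x.2).
  rewrite !derive_cutoff// /dsoft; rewrite ifF ?mul0r ?expr0n ?addr0//.
  by have := torsion_le0 E_gt1 x0 nA => G0; apply/negP; lra.
have hx : hole x by rewrite /hole/=; lra.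
have D v : 'D_v (fun x : X => cutoff d x.2) x = 0.
  apply: etrans (derive_local v o_hole hx (g := fun=> 0) (fun y hy => cutoff_hole d hy)) _.
  exact: derive_cst.
by rewrite !D expr0n addr0.
Qed.

(** The truncation changes the value by at most [2 d] and does not increase the
   slope, as [0 <= dsoft <= 1]. *)
Lemma cutoff_energy d x : 0 < d -> 1 < nsq x.2 < E ->
  energy E (nsq x.2) - 4 * d <= 2 * cutoff d x.2 - 4^-1 * grad2 d x.
Proof.
move=> d0 /andP[x1 xE]; have x0 : 0 < nsq x.2 by lra.
rewrite /grad2 !derive_cutoff// energyE// cutoffE//=.
set s := nsq x.2 in x0 x1 xE *; set q := dsoft _ _; set y := torsion E s.
have /andP[q0 q1] : 0 <= q <= 1 by exact: dsoft_itv.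
have H : 4^-1 * ((q * (kappa E / s - 1) * (2 * (x.2.1 * 1 + x.2.2 * 0))) ^+ 2 +
    (q * (kappa E / s - 1) * (2 * (x.2.1 * 0 + x.2.2 * 1))) ^+ 2) =
    q ^+ 2 * (s * (kappa E / s - 1) ^+ 2).
  by rewrite /s /nsq; field; rewrite -/(nsq x.2) gt_eqF.
rewrite H.
have h1 := soft_ge (y - d) (ltW d0).
have h2 : q ^+ 2 * (s * (kappa E / s - 1) ^+ 2) <= s * (kappa E / s - 1) ^+ 2.
  by rewrite ler_piMl ?expr_le1// mulr_ge0 ?sqr_ge0// ltW.
lra.
Qed.

End AnnularCutoff.

(** * Test functions on the product of a lens and an annulus *)

Section Lens.
Context {R : realType}.
Local Notation X := (C2 R).
Local Notation R1 := (measurableTypeR R).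
Local Notation R2 := (R1 * R1)%type.
Implicit Types (x : X) (z : R * R).

(** The part common to the discs [disc th] with [0 <= th <= a]. *)
Definition lens (a : R) : set (R * R) := disc 0 `&` disc a.

(** This is [1 - |z - e^(i th)|^2], positive inside the disc. *)
Definition depth (th : R) z : R := 2 * (cos th * z.1 + sin th * z.2) - nsq z.

Definition lens_cutoff (a d : R) z : R :=
  flat_poly d 1 (depth 0 z - d) * flat_poly d 1 (depth a z - d).

Lemma measurable_lens a : measurable (lens a : set R2).
Proof. by apply: measurableI; exact: measurable_disc. Qed.

Lemma disc_depth th z : disc th z <-> 0 < depth th z.
Proof. by rewrite /disc/= /depth subr_gt0. Qed.

Lemma lens_cutoff_itv a d z : 0 <= d -> 0 <= lens_cutoff a d z <= 1.
Proof.
move=> d0; have /andP[h1 h2] := flat_poly1_itv (depth 0 z - d) d0.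
have /andP[h3 h4] := flat_poly1_itv (depth a z - d) d0.
by rewrite /lens_cutoff mulr_ge0//= mulr_ile1.
Qed.

Lemma lens_cutoff_support a d z : lens_cutoff a d z != 0 ->
  d <= depth 0 z /\ d <= depth a z.
Proof.
rewrite /lens_cutoff mulf_eq0 negb_or !flat_poly1 => /andP[].
by case: ifPn; rewrite ?eqxx// => h _; case: ifPn; rewrite ?eqxx// => h' _; split; lra.
Qed.

Lemma lens_cutoff_out a d z : 0 < d -> ~ lens a z -> lens_cutoff a d z = 0.
Proof.
move=> d0 nz; apply/eqP; apply/negP => /negP/lens_cutoff_support[h1 h2]; apply: nz.
by split; apply/disc_depth; lra.
Qed.

Let Cn_depth th n U : open U -> Cn_on n U (fun x : X => depth th x.1).
Proof.
move=> oU; rewrite (_ : (fun x : X => _) = fun x : X =>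
    (2 * cos th * x.1.1 + 2 * sin th * x.1.2) + (-1) * (x.1.1 * x.1.1 + x.1.2 * x.1.2)).
  have cX := @Cn_x1 R n U; have cY := @Cn_y1 R n U.
  have cC c := @Cn_cst R n U c.
  by apply: CnD => //; [apply: CnD|] => //; apply: CnM => //; apply: CnD => //; exact: CnM.
by apply/funext => x; rewrite /depth /nsq; ring.
Qed.

Lemma smooth_lens_cutoff a d : 0 < d ->
  smooth_on setT (fun x : X => lens_cutoff a d x.1).
Proof.
move=> d0 n.
have H th : Cn_on n setT (fun x : X => flat_poly d 1 (depth th x.1 + - d)).
  apply: (Cn_comp1 (smooth1_flat_poly 1 d0) openT (fun x h => I)).
  by apply: CnD; [exact: openT|exact: Cn_depth openT|exact: Cn_cst].
exact: (CnM openT (H 0) (H a)).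
Qed.

Lemma continuous_depth th : continuous (fun x : X => depth th x.1).
Proof. by move=> x; have := @Cn_depth th 0 setT openT; exact. Qed.

Lemma measurable_lens_cutoff a d : 0 < d -> measurable_fun [set: R2] (lens_cutoff a d).
Proof.
move=> d0; have c : continuous (fun x : X => lens_cutoff a d x.1).
  exact: smooth_continuous (smooth_lens_cutoff a d0).
have := measurableT_comp (continuous_measurable_C2 c) (pair2_measurable ((0, 0) : R2)).
exact.
Qed.

Let flat_ge (d y : R) : 0 < d -> 0 < y -> 1 - 2 / y * d <= flat_poly d 1 (y - d).
Proof.
move=> d0 y0; rewrite flat_poly1.
have E : 2 / y * d = d / (y / 2) by field; rewrite gt_eqF.
rewrite E; have [h|h] := lerP (y / 2) d.
  have : 1 <= d / (y / 2) by rewrite ler_pdivlMr ?mul1r// divr_gt0.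
  by case: ifP => _; have := expR_ge0 (- (d / (y - d))); lra.
rewrite ifT; last lra.
apply: le_trans (expR_ge1Dx _); rewrite lerD2l lerN2 ler_pM2l// lef_pV2 ?posrE; lra.
Qed.

(** The bound is linear in [d] for fixed [z], which gives convergence to 1 as
   [d] tends to 0. *)
Lemma lens_cutoff_ge a d z : 0 < d -> lens a z ->
  1 - (2 / depth 0 z + 2 / depth a z) * d <= lens_cutoff a d z.
Proof.
move=> d0 [/disc_depth y0 /disc_depth ya].
have u0 := flat_ge d0 y0; have v0 := flat_ge d0 ya.
have /andP[_ u1] := flat_poly1_itv (depth 0 z - d) (ltW d0).
have /andP[_ v1] := flat_poly1_itv (depth a z - d) (ltW d0).
have : 0 <= (1 - flat_poly d 1 (depth 0 z - d)) * (1 - flat_poly d 1 (depth a z - d)).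
  by rewrite mulr_ge0// subr_ge0.
move=> uv; rewrite /lens_cutoff [leLHS](_ : _ = 1 - 2 / depth 0 z * d - 2 / depth a z * d); last by ring.
move: u0 v0 u1 v1 uv; move: (2 / depth 0 z * d) (2 / depth a z * d).
move: (flat_poly d 1 (depth 0 z - d)) (flat_poly d 1 (depth a z - d)) => u v p q ? ? ? ?.
by rewrite (_ : (1 - u) * (1 - v) = 1 - u - v + u * v); [lra|ring].
Qed.

Lemma lens_cutoff_cvg a z : lens a z ->
  (fun n => lens_cutoff a (harmonic n) z) @ \oo --> (1 : R).
Proof.
move=> az; set C := 2 / depth 0 z + 2 / depth a z.
apply: (@squeeze_cvgr _ _ _ _ (fun n => 1 - C * harmonic n) (fun=> 1)).
- near=> n; have h0 : 0 < harmonic n :> R by exact: harmonic_gt0.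
  by rewrite lens_cutoff_ge//=; have /andP[_ ->] := lens_cutoff_itv a z (ltW h0).
- rewrite -[X in _ --> X]subr0 -(mulr0 C).
  apply: cvgB; first exact: cvg_cst.
  by apply: cvgM; [exact: cvg_cst|exact: cvg_harmonic].
- exact: cvg_cst.
Unshelve. all: by end_near. Qed.

End Lens.

Section TestFunction.
Context {R : realType}.
Local Notation X := (C2 R).
Local Notation Re := (@complex.Re R).
Local Notation Im := (@complex.Im R).
Implicit Types (x : X) (z : R * R).
Variables (D : set X) (E a : R) (W : set (R * R)) (P Q : R * R -> R).
Hypotheses (E_gt1 : 1 < E) (hW : holo W P Q).
Hypotheses (SW : lens a `<=` W)
  (SD : forall x, lens a x.1 -> annulus E x.2 -> D x).
Variable d : R.
Hypothesis d_gt0 : 0 < d.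

Local Notation chi := (lens_cutoff a d).
Local Notation g := (cutoff E d).

(** The function [chi(z1) g(z2) conj((P + i Q)(z1))]. *)
Definition lens_test : X -> R[i] := fun x =>
  (chi x.1 * P x.1 * g x.2) +i* (- (chi x.1 * Q x.1) * g x.2).

Let core : set X := [set x | d <= depth 0 x.1 /\ d <= depth a x.1].

Let closed_core : closed core.
Proof.
have c th : closed [set x : X | d <= depth th x.1].
  apply: (closed_comp (f := fun x : X => depth th x.1)) (@closed_ge R d) => x _.
  exact: continuous_depth.
exact: closedI (c 0) (c a).
Qed.

Let core_lens x : core x -> lens a x.1.
Proof. by move=> [h1 h2]; have h := d_gt0; split; apply/disc_depth; lra. Qed.

Let smooth_lens (F : R * R -> R) : (forall n, Cn_on n [set x : X | W x.1] (fun x => F x.1)) ->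
  smooth_on setT (fun x : X => chi x.1 * F x.1).
Proof.
move=> cF n; have [oW _ _ _ _] := hW.
have oC : open (~` core) by apply: closed_openC.
rewrite (_ : setT = [set x : X | W x.1] `|` ~` core); last first.
  apply/seteqP; split=> // x _; have [cx|] := pselect (core x); [left|by right].
  exact/SW/core_lens.
apply: CnU.
  by apply: CnM => //; apply: Cn_subset (smooth_lens_cutoff a d_gt0 n).
apply: (@Cn_ext _ _ _ (fun=> 0)) => //; last exact: Cn_cst.
move=> x cx; have [->|] := eqVneq (chi x.1) 0; first by rewrite mul0r.
by move/lens_cutoff_support => h; case: cx.
Qed.

Let A (x : X) := chi x.1 * P x.1.
Let B (x : X) := - (chi x.1 * Q x.1).

Let sA : smooth_on setT A.
Proof. by have [_ cP _ _ _] := hW; exact: smooth_lens. Qed.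

Let sB : smooth_on setT B.
Proof.
have [_ _ cQ _ _] := hW => n; have := smooth_lens cQ n.
rewrite (_ : B = fun x => (-1) * (chi x.1 * Q x.1)).
  by apply: CnM; [exact: openT|exact: Cn_cst].
by apply/funext => x; rewrite mulN1r.
Qed.

Let sg : smooth_on setT (fun x : X => g x.2). Proof. exact: smooth_cutoff. Qed.

Lemma lens_test_smooth : smooth_on setT (fun x => Re (lens_test x)) /\
  smooth_on setT (fun x => Im (lens_test x)).
Proof. by split=> n; apply: CnM; by [exact: openT|exact: sA|exact: sB|exact: sg]. Qed.

Let disc_bounded th z : 0 <= depth th z -> `|z.1| <= 2 /\ `|z.2| <= 2.
Proof.
rewrite /depth /nsq => h.
have cs := cos2Dsin2 th; set c := cos th in h cs; set s := sin th in h cs.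
have : (z.1 - c) ^+ 2 + (z.2 - s) ^+ 2 <= 1.
  have -> : (z.1 - c) ^+ 2 + (z.2 - s) ^+ 2 = z.1 ^+ 2 + z.2 ^+ 2 - 2 * (c * z.1 + s * z.2)
    + (c ^+ 2 + s ^+ 2) by ring.
  by rewrite cs; lra.
have c1 : c ^+ 2 <= 1 by rewrite -cs lerDl sqr_ge0.
have s1 : s ^+ 2 <= 1 by rewrite -cs lerDr sqr_ge0.
have le1 (t : R) : t ^+ 2 <= 1 -> -1 <= t <= 1.
  by move=> t1; rewrite -ler_norml -[leRHS]normr1 -ler_sqr ?nnegrE// !real_normK ?num_real ?expr1n.
move=> h1; have /le1 h2 : (z.1 - c) ^+ 2 <= 1 by rewrite (le_trans _ h1)// lerDl sqr_ge0.
have /le1 h3 : (z.2 - s) ^+ 2 <= 1 by rewrite (le_trans _ h1)// lerDr sqr_ge0.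
move: (le1 _ c1) (le1 _ s1) h2 h3 => /andP[? ?] /andP[? ?] /andP[? ?] /andP[? ?].
by rewrite !ler_norml; split; apply/andP; split; lra.
Qed.

Lemma test_function_lens_test : test_function D lens_test.
Proof.
have [sR sI] := lens_test_smooth; split=> //.
have [e1 [e2 [e10 e20 supp]]] := cutoff_support E_gt1 d_gt0.
pose shell : set X := [set x | 1 + e1 <= nsq x.2] `&` [set x | nsq x.2 <= E - e2].
have cn : continuous (fun x : X => nsq x.2). by exact: continuous_nsq2.
have closed_shell : closed shell.
  apply: closedI.
    by apply: (closed_comp (f := fun x : X => nsq x.2)) (@closed_ge R (1 + e1)) => x _; exact: cn.
  by apply: (closed_comp (f := fun x : X => nsq x.2)) (@closed_le R (E - e2)) => x _; exact: cn.
have shell_annulus x : shell x -> annulus E x.2.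
  by move=> [/= h1 h2]; apply/andP; split; lra.
pose C := 2 + E; pose I : set R := `[- C, C]%classic.
pose box : set X := (I `*` I) `*` (I `*` I).
have E1 := E_gt1.
have cbox : compact box.
  by apply: compact_setX; apply: compact_setX; exact: segment_compact.
exists (core `&` shell); split.
- apply: (@subclosed_compact _ _ box) => //; first exact: closedI.
  move=> x [[/= h1 _] rx]; have h0 := d_gt0.
  have [] := @disc_bounded 0 x.1 (le_trans (ltW h0) h1).
  rewrite !ler_norml => /andP[? ?] /andP[? ?].
  have /andP[_ nE] := shell_annulus _ rx.
  have bd (t u : R) : t ^+ 2 + u ^+ 2 < E -> - C <= t <= C.
    move=> tu; have : t ^+ 2 <= C ^+ 2.
      have := sqr_ge0 u; rewrite /C !expr2 in tu *; nra.
    have C0 : 0 <= C by rewrite /C; lra.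
    by rewrite -ler_norml -(ler_sqr (x := `|t|)) ?nnegrE// real_normK ?num_real.
  split; split; rewrite /I/= in_itv/=; try (by apply/andP; split; rewrite /C; lra).
    exact: bd nE.
  by move: nE; rewrite /nsq addrC; exact: bd.
- by move=> x [cx rx]; apply: SD; [exact: core_lens|exact: shell_annulus].
move=> x nK; rewrite /lens_test.
have [c0|] := eqVneq (chi x.1) 0; first by rewrite c0 !mul0r oppr0 mul0r.
move/lens_cutoff_support => cx; have [->|/supp/andP[g1 g2]] := eqVneq (g x.2) 0.
  by rewrite !mulr0.
by case: nK.
Qed.

Let derive_second (F h : X -> R) x v : v.1 = 0 ->
  (forall x x', x.1 = x'.1 -> F x = F x') -> derivable h x v ->
  'D_v (fun x => F x * h x) x = F x * 'D_v h x.
Proof.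
move=> v0 Fx dh; apply: (@etrans _ _ ('D_v (F x \*: h) x)); last exact: deriveZ.
rewrite /derive; congr (lim (_ @ 0^')); apply/funext => t /=.
congr (_ *: (_ - _)); rewrite (Fx _ x)//=.
by rewrite v0; apply: etrans (congr1 (fun w => w + x.1) (scaler0 _ t)) (add0r _).
Qed.

(** Only the factor [g] depends on z2, and it is real. *)
Lemma lens_test_energy x : sqnorm (slot (0 : 'I_1) (dzbar 1 lens_test)) x =
  chi x.1 ^+ 2 * (P x.1 ^+ 2 + Q x.1 ^+ 2) * (4^-1 * grad2 E d x).
Proof.
have dg v : derivable (fun x : X => g x.2) x v by exact: smooth_derivable.
have FA : forall x x' : X, x.1 = x'.1 -> A x = A x' by move=> y y' h; rewrite /A h.
have FB : forall x x' : X, x.1 = x'.1 -> B x = B x' by move=> y y' h; rewrite /B h.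
have eR v : v.1 = 0 -> 'D_v (fun y => Re (lens_test y)) x = A x * 'D_v (fun x : X => g x.2) x.
  by move=> v0; exact: (derive_second v0 FA (dg v)).
have eI v : v.1 = 0 -> 'D_v (fun y => Im (lens_test y)) x = B x * 'D_v (fun x : X => g x.2) x.
  by move=> v0; exact: (derive_second v0 FB (dg v)).
have hx : (dirx 1 : X).1 = 0 by [].
have hy : (diry 1 : X).1 = 0 by [].
rewrite /sqnorm big_ord1 mxE eqxx normc_sqr.
have reE : Re (conjc (dzbar 1 lens_test x)) = Re (dzbar 1 lens_test x) by case: (dzbar 1 lens_test x).
have imE : Im (conjc (dzbar 1 lens_test x)) = - Im (dzbar 1 lens_test x) by case: (dzbar 1 lens_test x).
rewrite reE imE dzbar_Re dzbar_Im.
rewrite (eR _ hx) (eR _ hy) (eI _ hx) (eI _ hy) /grad2 /A /B.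
move: ('D_(dirx 1) _ x) ('D_(diry 1) _ x) => p q.
by field.
Qed.

End TestFunction.

Section ProductIntegral.
Context {R : realType}.
Local Notation X := (C2 R).
Local Notation R1 := (measurableTypeR R).
Local Notation R2 := (R1 * R1)%type.
Local Notation leb2 := (@leb2 R).
Local Notation leb4 := (@leb4 R).

Lemma leb4_product (D : set X) (S B : set R2) (m n : R2 -> R) :
  measurable D -> measurable S -> measurable B ->
  measurable_fun setT m -> measurable_fun setT n ->
  (forall z, S z -> 0 <= m z) -> (forall z, B z -> 0 <= n z) ->
  (forall x : X, S x.1 -> B x.2 -> D x) ->
  (\int[leb4]_(x in D) ((m \_ S) x.1 * (n \_ B) x.2)%:E =
   \int[leb2]_(z in S) (m z)%:E * \int[leb2]_(z in B) (n z)%:E)%E.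
Proof.
move=> mD mS mB mm mn m0 n0 SBD.
have mmS : measurable_fun setT (m \_ S).
  by apply/(measurable_restrictT _ mS); exact: measurable_funTS.
have mnB : measurable_fun setT (n \_ B).
  by apply/(measurable_restrictT _ mB); exact: measurable_funTS.
have m0S z : 0 <= (m \_ S) z by rewrite patchE; case: ifPn => // /set_mem; exact: m0.
have n0B z : 0 <= (n \_ B) z by rewrite patchE; case: ifPn => // /set_mem; exact: n0.
pose J (x : R2 * R2) := ((m \_ S) x.1 * (n \_ B) x.2)%:E.
have J0 x : (0 <= J x)%E by rewrite lee_fin mulr_ge0.
have mJ : measurable_fun setT J.
  by apply/measurable_EFinP; apply: measurable_funM; exact: measurableT_comp.
rewrite integral_mkcond (_ : _ \_ D = J); last first.
  apply/funext => x; rewrite patchE; case: ifPn => //; rewrite notin_setE => nDx.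
  rewrite /J patchE; case: ifPn => [/set_mem Sx|_]; last by rewrite mul0r.
  rewrite patchE; case: ifPn => [/set_mem Bx|_]; last by rewrite mulr0.
  by case: nDx; exact: SBD.
rewrite (@fubini_tonelli2 _ _ R2 R2 R leb2 leb2 J mJ J0).
have E2 (F : R2 -> R) (U : set R2) : (\int[leb2]_(z in U) (F z)%:E = \int[leb2]_z ((F \_ U) z)%:E)%E.
  rewrite integral_mkcond; apply: eq_integral => z _; rewrite !patchE; by case: ifP.
rewrite (E2 m) (E2 n) -ge0_integralZl//; last 3 first.
- exact/measurable_EFinP.
- by move=> z _; rewrite lee_fin.
- by apply: integral_ge0 => z _; rewrite lee_fin.
apply: eq_integral => y _; rewrite /fubini_G /J/=.
under eq_integral do rewrite EFinM.
rewrite ge0_integralZr//; first exact/measurable_EFinP.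
- by move=> z _; rewrite lee_fin.
- by rewrite lee_fin.
Qed.

End ProductIntegral.

Section LowerBound.
Context {R : realType}.
Local Notation X := (C2 R).
Local Notation R1 := (measurableTypeR R).
Local Notation R2 := (R1 * R1)%type.
Local Notation leb2 := (@leb2 R).
Local Notation leb4 := (@leb4 R).
Variables (D : set X) (E a : R) (W : set (R * R)) (P Q : R * R -> R).
Hypotheses (mD : measurable D) (finD : (leb4 D < +oo)%E).
Hypotheses (E_gt1 : 1 < E) (hW : holo W P Q).
Hypotheses (SW : lens a `<=` W)
  (SD : forall x, lens a x.1 -> annulus E x.2 -> D x).
Hypotheses (mP : measurable_fun [set: R2] P) (mQ : measurable_fun [set: R2] Q).
Local Notation f := (holo_form E P Q).
Hypothesis (Lf : L2 D f).

Let q (z : R * R) : R := P z ^+ 2 + Q z ^+ 2.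

Let q0 z : 0 <= q z. Proof. by rewrite addr_ge0 ?sqr_ge0. Qed.

Let mq : measurable_fun [set: R2] q.
Proof. by apply: measurable_funD; exact: measurable_funX. Qed.

Variable M : R.
Hypothesis massM : (\int[leb2]_(z in lens a) (q z)%:E = M%:E)%E.

Section fixed_cutoff.
Variable d : R.
Hypothesis d_gt0 : 0 < d.
Local Notation chi := (lens_cutoff a d).
Local Notation phi := (lens_test E a P Q d).
Let sl := slot (0 : 'I_1) (dzbar 1 phi).
Let m (z : R2) : R := chi z * q z.

Let Md : R := fine (\int[leb2]_(z in lens a) (m z)%:E)%E.

Let d_ge0 : 0 <= d. Proof. exact: ltW. Qed.

Let m0 z : 0 <= m z.
Proof. by have /andP[h _] := lens_cutoff_itv a z d_ge0; rewrite mulr_ge0. Qed.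

Let m_le_q z : m z <= q z.
Proof. by have /andP[_ h] := lens_cutoff_itv a z d_ge0; rewrite ler_piMl. Qed.

Let mm : measurable_fun [set: R2] m.
Proof. by apply: measurable_funM => //; exact: measurable_lens_cutoff. Qed.

Let MdE : (\int[leb2]_(z in lens a) (m z)%:E = Md%:E)%E.
Proof.
rewrite /Md fineK// ge0_fin_numE; last by apply: integral_ge0 => z _; rewrite lee_fin.
apply: (@le_lt_trans _ _ (\int[leb2]_(z in lens a) (q z)%:E)%E); last by rewrite massM ltry.
apply: ge0_le_integral => //.
- exact: measurable_lens.
- by move=> z _; rewrite lee_fin.
- by apply/measurable_EFinP; exact: measurable_funTS.
- by apply/measurable_EFinP; exact: measurable_funTS.
- by move=> z _; rewrite lee_fin m_le_q.
Qed.

Let patch_m : m \_ (lens a) = m.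
Proof.
apply/funext => z; rewrite patchE; case: ifPn => //; rewrite notin_setE => nz.
by rewrite /m lens_cutoff_out ?mul0r.
Qed.

Let integral_weight (n : R2 -> R) : measurable_fun setT n ->
  (forall z, annulus E z -> 0 <= n z) ->
  (\int[leb4]_(x in D) (m x.1 * (n \_ (annulus E)) x.2)%:E =
   Md%:E * \int[leb2]_(z in annulus E) (n z)%:E)%E.
Proof.
move=> mn n0; rewrite -MdE -(@leb4_product _ D _ _ m n)//.
- by rewrite patch_m.
- exact: measurable_lens.
- exact: measurable_annulus.
Qed.

Let Y (x : X) : R := m x.1 * (((fun=> 1) : R2 -> R) \_ (annulus E)) x.2.

Let YE x : Y x = if 1 < nsq x.2 < E then m x.1 else 0.
Proof.
rewrite /Y patchE; case: ifPn => [/set_mem -> | ]; first by rewrite mulr1.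
by rewrite notin_setE => /negP/negbTE ->; rewrite mulr0.
Qed.

Let Y0 x : 0 <= Y x. Proof. by rewrite YE; case: ifP. Qed.

Let intY : (\int[leb4]_(x in D) (Y x)%:E = (Md * (pi * (E - 1)))%:E)%E.
Proof.
rewrite (@integral_weight (fun=> 1))// integral_cst; last exact: measurable_annulus.
have aE := annulus_area E_gt1.
by rewrite mul1e EFinM -aE.
Qed.

Let mY : measurable_fun [set: R2 * R2] Y.
Proof.
apply: measurable_funM; apply: measurableT_comp => //.
by apply/(measurable_restrictT _ (measurable_annulus E)).
Qed.

Let iY : leb4.-integrable D (EFin \o Y).
Proof.
apply/integrableP; split; first by apply/measurable_EFinP; exact: measurable_funTS.
under eq_integral do rewrite /comp abse_EFin ger0_norm//.
by rewrite intY ltry.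
Qed.

Let tphi : test_function D phi.
Proof. exact: (test_function_lens_test E_gt1 hW SW SD d_gt0). Qed.

Let tdphi : test_function D (dzbar 1 phi).
Proof. exact: test_function_dzbar. Qed.

Let Lsl : L2 D sl. Proof. exact: L2_slot. Qed.
Let Lphi : L2 D (slot (1 : 'I_2) phi). Proof. exact: L2_slot. Qed.

Let V (x : X) : R := 2 * rdot f (slot 1 phi) x - rdot sl sl x.

Let iV : leb4.-integrable D (EFin \o V).
Proof.
have i1 := integrable_rdot mD Lf Lphi; have i2 := integrable_rdot mD Lsl Lsl.
have i3 : leb4.-integrable D (EFin \o (fun x => 2 * rdot f (slot 1 phi) x)).
  exact: (integrableZl (mu := leb4) mD 2 i1).
exact: (integrableB (mu := leb4) mD i3 i2).
Qed.

(** The integrand [V] of [2 (f, phi) - |dphi / dzbar_2|^2] dominates the product of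
   [chi |P + i Q|^2] with [energy - 4 d], since [chi ^ 2 <= chi]. *)
Let V_ge x : Y x * (energy E (nsq x.2) + energy_bound E) <=
  V x + (energy_bound E + 4 * d) * Y x.
Proof.
have rE : rdot f (slot 1 phi) x = Y x * cutoff E d x.2.
  rewrite rdot_slot mxE YE/=; case: ifP => _; last by rewrite !mul0r.
  by rewrite cReM /lens_test/= /m /q; ring.
have sE : rdot sl sl x = chi x.1 * m x.1 * (4^-1 * grad2 E d x).
  rewrite -sqnormE; apply: etrans (lens_test_energy a P Q E_gt1 d_gt0 x) _.
  by rewrite /m /q; ring.
rewrite /V rE sE YE; case: ifPn => xA; last first.
  by rewrite grad2_out// !mul0r !mulr0 !addr0 subr0.
have h := cutoff_energy E_gt1 d_gt0 xA.
have /andP[c0 c1] := lens_cutoff_itv a x.1 d_ge0.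
have g0 : 0 <= 4^-1 * grad2 E d x by rewrite mulr_ge0// addr_ge0 ?sqr_ge0.
have h1 : chi x.1 * m x.1 * (4^-1 * grad2 E d x) <= m x.1 * (4^-1 * grad2 E d x).
  by rewrite -mulrA ler_piMl// mulr_ge0.
have h2 := ler_wpM2l (m0 x.1) h.
rewrite -subr_ge0 in h1; rewrite -subr_ge0 in h2.
rewrite -subr_ge0 (le_trans (addr_ge0 h1 h2))// le_eqVlt; apply/orP; left; apply/eqP; ring.
Qed.

(** Expanding [0 <= |u + w|^2], where [w] is the derivative of the test function,
   bounds [|u|^2] from below by [- 2 (u, w) - |w|^2], and [- (u, w)] is the pairing
   of [f] with the test function. *)
Lemma cutoff_lower_bound (N : @cform R 2 -> @cform R 2) :
  dbar_Neumann_operator D N -> dbar1 D f (fun=> 0) ->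
  Md * (pi * torsion_integral E - 4 * d * (pi * (E - 1))) <=
  L2norm D f * L2norm D (N f).
Proof.
move=> hN df0; have [u [Lu uE uN]] := minimal_solution mD finD hN df0.
apply: le_trans uN; rewrite L2norm_sqr.
have := ip_ge0 D (fun x => (1%:C)%C *: sl x + u x).
rewrite ip_expand// mul1r expr1n mul1r.
have -> : ip D u sl = - ip D f (slot 1 phi) by exact: uE.
have VE : (\int[leb4]_(x in D) V x)%R = 2 * ip D f (slot 1 phi) - ip D sl sl.
  have i1 := integrable_rdot mD Lf Lphi; have i2 := integrable_rdot mD Lsl Lsl.
  rewrite /ip -RintegralZl// -RintegralB//; exact: (integrableZl (mu := leb4) mD 2 i1).
suff : Md * (pi * torsion_integral E - 4 * d * (pi * (E - 1))) <=
    (\int[leb4]_(x in D) V x)%R by rewrite VE; lra.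
have mw : measurable_fun [set: R2] (fun z => energy E (nsq z) + energy_bound E).
  apply: measurable_funD => //; apply: measurableT_comp; first exact: measurable_energy.
  exact: measurable_nsq.
have w0 z : annulus E z -> 0 <= energy E (nsq z) + energy_bound E.
  move=> /andP[h1 h2]; have : - energy_bound E <= energy E (nsq z).
    by apply: energy_ge => //; apply/andP; split; exact: ltW.
  lra.
have iw := integral_weight mw w0.
rewrite (energy_integral E_gt1 (lexx _)) in iw.
pose c0 := energy_bound E + 4 * d.
have IV : ((\int[leb4]_(x in D) V x)%R + c0 * (Md * (pi * (E - 1))))%:E =
    (\int[leb4]_(x in D) (V x + c0 * Y x)%:E)%E.
  have H := @integralD _ _ R leb4 D mD (EFin \o V) (fun x => c0%:E * (Y x)%:E)%E iV (integrableZl (mu := leb4) mD c0 iY).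
  apply: etrans (esym H); rewrite integralZl// intY EFinD EFinM /Rintegral fineK//.
  exact: integrable_fin_num.
have : (Md%:E * (pi * (torsion_integral E + energy_bound E * (E - 1)))%:E <=
   ((\int[leb4]_(x in D) V x)%R + c0 * (Md * (pi * (E - 1))))%:E)%E.
  rewrite IV -iw; apply: ge0_le_integral => //.
  - move=> x _; rewrite lee_fin mulr_ge0// patchE; case: ifPn => // /set_mem; exact: w0.
  - apply/measurable_EFinP; apply: measurable_funTS; apply: measurable_funM.
      exact: measurableT_comp.
    apply: measurableT_comp => //; apply/(measurable_restrictT _ (measurable_annulus E)).
    exact: measurable_funTS.
  - apply/measurable_EFinP; apply: measurable_funD.
      by have /integrableP[/measurable_EFinP] := iV.
    by apply: measurable_funM => //; exact: measurable_funTS.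
  move=> x _; rewrite lee_fin; apply: le_trans (V_ge x).
  rewrite YE patchE /annulus/=; case: ifPn => [/set_mem -> //|].
  by rewrite notin_setE => /negP/negbTE ->; rewrite mulr0 mul0r.
rewrite -EFinM lee_fin /c0 -subr_ge0 => h; rewrite -subr_ge0.
by apply: le_trans h _; rewrite le_eqVlt; apply/orP; left; apply/eqP; ring.
Qed.

End fixed_cutoff.

(** Dominated convergence as the cutoffs exhaust the lens and the annulus. *)
Lemma lens_lower_bound (N : @cform R 2 -> @cform R 2) :
  dbar_Neumann_operator D N -> dbar1 D f (fun=> 0) ->
  M * (pi * torsion_integral E) <= L2norm D f * L2norm D (N f).
Proof.
move=> hN df0.
pose d n : R := harmonic n.
have d0 n : 0 < d n by exact: harmonic_gt0.
have H n := cutoff_lower_bound (d0 n) hN df0.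
pose I n := (\int[leb2]_(z in lens a) (lens_cutoff a (d n) z * q z)%:E)%E.
have Icvg : I @ \oo --> M%:E.
  rewrite -massM; apply: (@dominated_cvg _ _ _ leb2 (lens a) (measurable_lens a) _ _ (EFin \o q)) => //.
  - move=> n; apply/measurable_EFinP; apply: measurable_funM; last exact: measurable_funTS.
    by apply: measurable_funTS; exact: measurable_lens_cutoff.
  - move=> z az; apply: cvg_EFin; first by near=> n.
    rewrite -[X in _ --> X](mul1r (q z)); apply: cvgM; last exact: cvg_cst.
    exact: lens_cutoff_cvg.
  - apply/integrableP; split; first by apply/measurable_EFinP; exact: measurable_funTS.
    under eq_integral do rewrite /comp abse_EFin ger0_norm//.
    by rewrite massM ltry.
  - move=> n z _; have /andP[c0 c1] := lens_cutoff_itv a z (ltW (d0 n)).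
    by rewrite /comp abse_EFin lee_fin normrM !ger0_norm// ler_piMl.
have [_ Mcvg] := (fine_cvgP _ _).1 Icvg.
have dcvg : d @ \oo --> (0 : R) by exact: cvg_harmonic.
apply: (@ler_cvg_to _ \oo _ _ (fun n => fine (I n) * (pi * torsion_integral E - 4 * d n * (pi * (E - 1))))
  (fun=> L2norm D f * L2norm D (N f))).
- have Mcvg2 : (fun n => fine (I n)) @ \oo --> M by exact: Mcvg.
  apply: cvgM; first exact: Mcvg2.
  rewrite -[X in _ --> X]subr0; apply: cvgB; first exact: cvg_cst.
  rewrite -(mul0r (pi * (E - 1))); apply: cvgM; last exact: cvg_cst.
  by rewrite -(mulr0 4); apply: cvgM; [exact: cvg_cst|].
- exact: cvg_cst.
- by near=> n; exact: H.
Unshelve. all: by end_near. Qed.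

End LowerBound.

(** * Masses of the forms with poles *)

Section PoleMass.
Context {R : realType}.
Local Notation leb2 := (@leb2 R).
Variables (a t : R).
Hypotheses (a_gt0 : 0 < a) (a_pi : a < pi) (t_gt0 : 0 < t) (t_le1 : t <= 1).
Let ca := cos (a / 2).
Local Notation dist2 := (dsq (pole a t)).

Let ca_gt0 : 0 < ca.
Proof.
have h1 := a_gt0; have h2 := a_pi; have h3 := pi_gt0 R.
by apply: cos_gt0_pihalf; apply/andP; split; lra.
Qed.

Lemma dsq_ge0 (p z : R * R) : 0 <= dsq p z.
Proof. by rewrite addr_ge0 ?sqr_ge0. Qed.

Let k1 (s : R) : R := `|s^-1|.
Let k2 (s : R) : R := (Num.sqrt s)^-1.

Let k1E z : k1 (dist2 z) = (dist2 z)^-1.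
Proof. by rewrite /k1 ger0_norm// invr_ge0 dsq_ge0. Qed.

Let dk1 (s : R) : 0 < s -> is_derive s 1 (@ln R) (k1 s).
Proof.
move=> s0; rewrite /k1 gtr0_norm ?invr_gt0//; exact: is_derive1_ln.
Qed.

Let ck1 (s : R) : 0 < s -> {for s, continuous k1}.
Proof.
move=> s0; apply: (continuous_comp (f := fun s : R => s^-1) (g := Num.norm)).
  by apply: inv_continuous; rewrite gt_eqF.
exact: norm_continuous.
Qed.

Let mk1 : measurable_fun [set: R] k1.
Proof. by apply: measurableT_comp; [exact: normr_measurable|exact: measurable_inv]. Qed.

(** The primitive of [1 / s] is the logarithm. The absolute value in [k1] only
   serves to have a nonnegative function on the whole line. *)
Lemma disc_dsq_inv th : 0 <= th <= a ->
  (\int[leb2]_(z in disc th) ((dist2 z)^-1)%:E <=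
   (pi / 2 * (ln 9 - 2 * ln ca - 2 * ln t))%:E)%E.
Proof.
move=> tha.
have := disc_mass_le a_gt0 a_pi t_gt0 t_le1 dk1 ck1 (fun s => normr_ge0 _) mk1 tha.
under eq_integral do rewrite k1E.
rewrite (_ : ln ((t * cos (a / 2)) ^+ 2) = 2 * ln ca + 2 * ln t).
  by move=> /le_trans; apply; rewrite lee_fin le_eqVlt; apply/orP; left; apply/eqP; ring.
by rewrite lnXn ?mulr_gt0// lnM ?posrE// mulr_natl; ring.
Qed.

Lemma lens_dsq_inv (b g : R) : 0 < b -> g = ca - b * sin (a / 2) -> 0 < g ->
  ((atan b * (2 * ln (g / (1 + b ^+ 2)) - ln (4 * (1 + b ^+ 2) / g ^+ 2) - 2 * ln t))%:E <=
   \int[leb2]_(z in lens a) ((dist2 z)^-1)%:E)%E.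
Proof.
move=> b0 gE g0.
have b2 : 0 < 1 + b ^+ 2 by rewrite ltr_pwDl// sqr_ge0.
pose s0 := 4 * (1 + b ^+ 2) * t ^+ 2 / g ^+ 2; pose s1 := (g / (1 + b ^+ 2)) ^+ 2.
have s0_gt0 : 0 < s0 by rewrite !(mulr_gt0, exprn_gt0, invr_gt0).
have s1_gt0 : 0 < s1 by rewrite exprn_gt0// divr_gt0.
have -> : 2 * ln (g / (1 + b ^+ 2)) - ln (4 * (1 + b ^+ 2) / g ^+ 2) - 2 * ln t = ln s1 - ln s0.
  have -> : s0 = 4 * (1 + b ^+ 2) / g ^+ 2 * t ^+ 2 by rewrite /s0; ring.
  have q0 : 0 < 4 * (1 + b ^+ 2) / g ^+ 2 by rewrite divr_gt0 ?exprn_gt0 ?mulr_gt0.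
  have w0 : 0 < g / (1 + b ^+ 2) by rewrite divr_gt0.
  move: q0 w0; rewrite /s1; move: (4 * _ / _) (g / _) => q w q0 w0.
  rewrite lnXn// (lnM (x := q)) ?posrE ?exprn_gt0// lnXn//.
  by rewrite opprD addrA -(mulr_natl (ln w)) -(mulr_natl (ln t)).
have [s01|s10] := ltP s0 s1; last first.
  apply: (@le_trans _ _ 0%E).
    rewrite lee_fin mulr_ge0_le0//; first by rewrite -(atan0 R) le_atan// ltW.
    by rewrite subr_le0 ler_ln ?posrE.
  by apply: integral_ge0 => z _; rewrite lee_fin invr_ge0 dsq_ge0.
have := cone_mass_ge a_gt0 a_pi t_gt0 dk1 ck1 (fun s => normr_ge0 _) mk1 b0 gE g0 s01.
by under eq_integral do rewrite k1E.
Qed.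

Let dk2 (s : R) : 0 < s -> is_derive s 1 (fun s : R => 2 * Num.sqrt s) (k2 s).
Proof.
move=> s0; have h := is_derive1_sqrt s0.
have := @is_deriveZ R R R _ 2 s 1 _ h.
move=> /is_derive_eq; apply; rewrite /GRing.scale/= /k2; field.
by rewrite gt_eqF// sqrtr_gt0.
Qed.

Let ck2 (s : R) : 0 < s -> {for s, continuous k2}.
Proof.
move=> s0; apply: (continuous_comp (f := Num.sqrt) (g := fun s : R => s^-1)).
  exact: sqrt_continuous.
by apply: inv_continuous; rewrite gt_eqF// sqrtr_gt0.
Qed.

Lemma measurable_inv_sqrt : measurable_fun [set: R] (fun s : R => (Num.sqrt s)^-1).
Proof.
apply: measurableT_comp; first exact: measurable_inv.
by apply: continuous_measurable_fun; exact: sqrt_continuous.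
Qed.

Lemma disc_dsq_inv_sqrt th : 0 <= th <= a ->
  (\int[leb2]_(z in disc th) ((Num.sqrt (dist2 z))^-1)%:E <= (3 * pi)%:E)%E.
Proof.
move=> tha.
have k20 s : 0 <= k2 s by rewrite invr_ge0 sqrtr_ge0.
have := disc_mass_le a_gt0 a_pi t_gt0 t_le1 dk2 ck2 k20 measurable_inv_sqrt tha.
move=> /le_trans; apply; rewrite lee_fin.
have s9 : Num.sqrt 9 = 3 :> R.
  by rewrite (_ : 9 = 3 ^+ 2) ?sqrtr_sqr ?ger0_norm//; ring.
rewrite s9 -subr_ge0 (_ : _ - _ = pi * Num.sqrt ((t * cos (a / 2)) ^+ 2)); last by field.
by rewrite mulr_ge0 ?sqrtr_ge0// pi_ge0.
Qed.

End PoleMass.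

Section PoleSequence.
Context {R : realType}.
Local Notation R1 := (measurableTypeR R).
Local Notation R2 := (R1 * R1)%type.
Local Notation leb2 := (@leb2 R).
Implicit Types (z p : R * R).

Lemma inv_abs2 p z : invRe p z ^+ 2 + invIm p z ^+ 2 = (dsq p z)^-1.
Proof.
rewrite /invRe /invIm !exprMn sqrrN -mulrDl -/(dsq p z) expr2 mulrA.
by have [->|d0] := eqVneq (dsq p z) 0; [rewrite invr0 !mulr0|rewrite mulfV// mul1r].
Qed.

(** Cauchy-Schwarz in the plane. *)
Lemma inv_cross p p' z :
  `|invRe p z * invRe p' z + invIm p z * invIm p' z| <=
  (Num.sqrt (dsq p z))^-1 * (Num.sqrt (dsq p' z))^-1.
Proof.
rewrite -!sqrtrV ?dsq_ge0// -sqrtrM ?invr_ge0 ?dsq_ge0// -sqrtr_sqr ler_wsqrtr//.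
rewrite -!inv_abs2 -subr_ge0.
by rewrite (_ : _ - _ = (invRe p z * invIm p' z - invIm p z * invRe p' z) ^+ 2) ?sqr_ge0//; ring.
Qed.

Lemma measurable_invRe p : measurable_fun [set: R2] (invRe p).
Proof.
apply: measurable_funM; first exact: measurable_funB.
by apply: measurableT_comp; [exact: measurable_inv|exact: measurable_dsq].
Qed.

Lemma measurable_invIm p : measurable_fun [set: R2] (invIm p).
Proof.
apply: measurable_funM; first by apply: measurableT_comp => //; exact: measurable_funB.
by apply: measurableT_comp; [exact: measurable_inv|exact: measurable_dsq].
Qed.

Variable a : R.
Hypotheses (a_gt0 : 0 < a) (a_pi : a < pi).
Let ca := cos (a / 2).

Definition pole_dist (n : nat) : R := expR (- n.+1%:R).
Definition pole_weight (n : nat) : R := Num.sqrt (harmonic n).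
Local Notation center n := (pole a (pole_dist n)).

(** The mass of [1 / (z - center n)] grows like [n], the logarithm of the distance
   of the pole; the weight compensates this growth. *)
Definition poleRe n z : R := pole_weight n * invRe (center n) z.
Definition poleIm n z : R := pole_weight n * invIm (center n) z.

Let ca_gt0 : 0 < ca.
Proof.
have h1 := a_gt0; have h2 := a_pi; have h3 := pi_gt0 R.
by apply: cos_gt0_pihalf; apply/andP; split; lra.
Qed.

Let h0 n : 0 < harmonic n :> R. Proof. exact: harmonic_gt0. Qed.

Let r0 n : 0 < pole_dist n. Proof. exact: expR_gt0. Qed.

Let r1 n : pole_dist n <= 1.
Proof. by rewrite /pole_dist -(expR0 R) ler_expR oppr_le0. Qed.

Let w2 n : pole_weight n ^+ 2 = harmonic n.
Proof. by rewrite sqr_sqrtr// ltW. Qed.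

Let w0 n : 0 <= pole_weight n. Proof. exact: sqrtr_ge0. Qed.

Let hr n : harmonic n * (2 * ln (pole_dist n)) = -2 :> R.
Proof. by rewrite /pole_dist expRK mulrCA mulrN mulVf ?pnatr_eq0// mulrN1. Qed.

Lemma measurable_poleRe n : measurable_fun [set: R2] (poleRe n).
Proof. by apply: measurable_funM => //; exact: measurable_invRe. Qed.

Lemma measurable_poleIm n : measurable_fun [set: R2] (poleIm n).
Proof. by apply: measurable_funM => //; exact: measurable_invIm. Qed.

Let A n z : R := harmonic n * (dsq (center n) z)^-1.

Let AE n z : poleRe n z ^+ 2 + poleIm n z ^+ 2 = A n z.
Proof.
rewrite /A -inv_abs2 -w2 /poleRe /poleIm; ring.
Qed.

Let A0 n z : 0 <= A n z.
Proof. by rewrite -AE addr_ge0 ?sqr_ge0. Qed.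

Let mA n : measurable_fun [set: R2] (A n).
Proof.
apply: measurable_funM => //.
by apply: measurableT_comp; [exact: measurable_inv|exact: measurable_dsq].
Qed.

Let mV n : measurable_fun [set: R2] (fun z : R2 => (dsq (center n) z)^-1).
Proof. by apply: measurableT_comp; [exact: measurable_inv|exact: measurable_dsq]. Qed.

Let integral_A (S : set R2) n : measurable S ->
  (\int[leb2]_(z in S) (A n z)%:E =
   (harmonic n)%:E * \int[leb2]_(z in S) ((dsq (center n) z)^-1)%:E)%E.
Proof.
move=> mS; rewrite -ge0_integralZl//.
- by apply/measurable_EFinP; exact: measurable_funTS.
- by move=> z _; rewrite lee_fin invr_ge0 dsq_ge0.
- by rewrite lee_fin ltW.
Qed.

(** Together with [lens_const] this is the part of the masses that stays bounded
   before normalisation. *)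
Definition disc_const : R := pi / 2 * (ln 9 - 2 * ln ca).

Let disc_A n th : 0 <= th <= a ->
  (\int[leb2]_(z in disc th) (A n z)%:E <= (pi + disc_const * harmonic n)%:E)%E.
Proof.
move=> tha; rewrite integral_A; last exact: measurable_disc.
have := disc_dsq_inv a_gt0 a_pi (r0 n) (r1 n) tha.
move/(lee_wpmul2l (_ : 0 <= (harmonic n)%:E)%E) => H.
apply: le_trans (H _) _; first by rewrite lee_fin ltW.
rewrite -EFinM lee_fin le_eqVlt; apply/orP; left; apply/eqP.
rewrite mulrCA mulrBr (hr n) /disc_const -/ca; by field.
Qed.

Lemma pole_disc_mass n th : 0 <= th <= a ->
  (\int[leb2]_(z in disc th) (poleRe n z ^+ 2 + poleIm n z ^+ 2)%:E <=
   (pi + disc_const * harmonic n)%:E)%E.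
Proof. by move=> tha; under eq_integral do rewrite AE; exact: disc_A. Qed.

Variables (b g : R).
Hypotheses (b_gt0 : 0 < b) (gE : g = ca - b * sin (a / 2)) (g_gt0 : 0 < g).

Definition lens_const : R :=
  atan b * (2 * ln (g / (1 + b ^+ 2)) - ln (4 * (1 + b ^+ 2) / g ^+ 2)).

Let lens_A n : ((2 * atan b + lens_const * harmonic n)%:E <=
  \int[leb2]_(z in lens a) (A n z)%:E)%E.
Proof.
rewrite integral_A; last exact: measurable_lens.
have := lens_dsq_inv a_gt0 a_pi (r0 n) b_gt0 gE g_gt0.
move/(lee_wpmul2l (_ : 0 <= (harmonic n)%:E)%E) => H.
apply: le_trans (H _); last by rewrite lee_fin ltW.
rewrite -EFinM lee_fin le_eqVlt; apply/orP; left; apply/eqP.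
rewrite mulrCA [in RHS]mulrBr (hr n) /lens_const.
move: (2 * ln _ - ln _) => u; ring.
Qed.

Section pair.
Variables k l : nat.

Definition pairRe z : R := - pole_weight k * invRe (center k) z + pole_weight l * invRe (center l) z.
Definition pairIm z : R := - pole_weight k * invIm (center k) z + pole_weight l * invIm (center l) z.

Lemma measurable_pairRe : measurable_fun [set: R2] pairRe.
Proof. by apply: measurable_funD; apply: measurable_funM => //; exact: measurable_invRe. Qed.

Lemma measurable_pairIm : measurable_fun [set: R2] pairIm.
Proof. by apply: measurable_funD; apply: measurable_funM => //; exact: measurable_invIm. Qed.

Definition cross_const : R := 2 * pole_weight k / (pole_dist k * ca).

Let C z : R := cross_const * pole_weight l * (Num.sqrt (dsq (center l) z))^-1.

Let rca : 0 < pole_dist k * ca. Proof. by rewrite mulr_gt0. Qed.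

Let cc0 : 0 <= cross_const * pole_weight l.
Proof. by apply: mulr_ge0 => //; apply: divr_ge0; [exact: mulr_ge0|exact: ltW]. Qed.

Let C0 z : 0 <= C z.
Proof. by rewrite mulr_ge0// invr_ge0 sqrtr_ge0. Qed.

Let mS : measurable_fun [set: R2] (fun z : R2 => (Num.sqrt (dsq (center l) z))^-1).
Proof. exact: (measurableT_comp (@measurable_inv_sqrt R) (measurable_dsq (center l))). Qed.

Let mC : measurable_fun [set: R2] C.
Proof. exact: measurable_funM. Qed.

Let q z : R := pairRe z ^+ 2 + pairIm z ^+ 2.

Let q0 z : 0 <= q z. Proof. by rewrite addr_ge0 ?sqr_ge0. Qed.

Let mq : measurable_fun [set: R2] q.
Proof.
by apply: measurable_funD; apply: measurable_funX; [exact: measurable_pairRe|exact: measurable_pairIm].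
Qed.

(** On the discs [1 / (z - center k)] is bounded, so that the cross term is at most
   a constant depending on [k] times [pole_weight l / |z - center l|]. The latter
   function has a bounded integral up to the factor [pole_weight l], which tends
   to 0. *)
Let pair_cross th z : 0 <= th <= a -> disc th z -> `|q z - (A k z + A l z)| <= C z.
Proof.
move=> tha dz.
have -> : q z - (A k z + A l z) = - (2 * pole_weight k * pole_weight l *
    (invRe (center k) z * invRe (center l) z + invIm (center k) z * invIm (center l) z)).
  by rewrite -!AE /q /pairRe /pairIm /poleRe /poleIm; ring.
rewrite normrN normrM ger0_norm ?mulr_ge0//.
apply: (le_trans (ler_wpM2l _ (inv_cross _ _ _))); first by rewrite !mulr_ge0.
have dk := disc_pole_dist a_gt0 a_pi (r0 k) tha dz.
have le : (Num.sqrt (dsq (center k) z))^-1 <= (pole_dist k * ca)^-1.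
  have s : pole_dist k * ca <= Num.sqrt (dsq (center k) z).
    by rewrite -[leLHS](ger0_norm (ltW rca)) -sqrtr_sqr ler_wsqrtr.
  by rewrite lef_pV2 ?posrE// (lt_le_trans rca).
rewrite /C /cross_const mulrA; apply: ler_wpM2r; first by rewrite invr_ge0 sqrtr_ge0.
rewrite (_ : 2 * pole_weight k / (pole_dist k * ca) * pole_weight l = 2 * pole_weight k * pole_weight l * (pole_dist k * ca)^-1).
  by rewrite ler_wpM2l// !mulr_ge0.
by ring.
Qed.

Let integral_C (S : set R2) th : measurable S -> 0 <= th <= a -> S `<=` disc th ->
  (\int[leb2]_(z in S) (C z)%:E <= (cross_const * pole_weight l * (3 * pi))%:E)%E.
Proof.
move=> mSS tha Sd.
apply: (@le_trans _ _ (\int[leb2]_(z in disc th) (C z)%:E)%E).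
  apply: ge0_subset_integral => //; first exact: measurable_disc.
    by apply/measurable_EFinP; exact: measurable_funTS.
  by move=> z _; rewrite lee_fin.
under eq_integral do rewrite EFinM.
rewrite ge0_integralZl//.
- rewrite (EFinM (cross_const * pole_weight l)); apply: lee_wpmul2l; first by rewrite lee_fin.
  exact: (disc_dsq_inv_sqrt a_gt0 a_pi (r0 l) (r1 l) tha).
- exact: measurable_disc.
- by apply/measurable_EFinP; exact: measurable_funTS. 
Qed.

Let integral3 (S : set R2) (u v w : R2 -> R) : measurable S ->
  measurable_fun setT u -> measurable_fun setT v -> measurable_fun setT w ->
  (forall z, 0 <= u z) -> (forall z, 0 <= v z) -> (forall z, 0 <= w z) ->
  (\int[leb2]_(z in S) (u z + v z + w z)%:E = \int[leb2]_(z in S) (u z)%:E +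
   \int[leb2]_(z in S) (v z)%:E + \int[leb2]_(z in S) (w z)%:E)%E.
Proof.
move=> mSS mu mv mw u0 v0 w0'.
have mE (f : R2 -> R) : measurable_fun setT f -> measurable_fun S (EFin \o f).
  by move=> mf; apply/measurable_EFinP; exact: measurable_funTS.
under eq_integral do rewrite EFinD.
rewrite ge0_integralD//; last 4 first.
- by move=> z _; rewrite lee_fin addr_ge0.
- by apply: mE; exact: measurable_funD.
- by move=> z _; rewrite lee_fin.
- exact: mE.
congr (_ + _)%E; under eq_integral do rewrite EFinD.
rewrite ge0_integralD//; try exact: mE; by move=> z _; rewrite lee_fin.
Qed.

Lemma pair_disc_mass th : 0 <= th <= a ->
  (\int[leb2]_(z in disc th) (pairRe z ^+ 2 + pairIm z ^+ 2)%:E <=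
   (2 * pi + disc_const * (harmonic k + harmonic l) +
    cross_const * pole_weight l * (3 * pi))%:E)%E.
Proof.
move=> tha; have mdisc := @measurable_disc R th.
apply: (@le_trans _ _ (\int[leb2]_(z in disc th) (A k z + A l z + C z)%:E)%E).
  apply: ge0_le_integral => //.
  - by move=> z _; rewrite lee_fin; exact: q0.
  - by apply/measurable_EFinP; exact: measurable_funTS.
  - by apply/measurable_EFinP; apply: measurable_funTS; do 2!apply: measurable_funD => //.
  move=> z dz; rewrite lee_fin; have := pair_cross tha dz.
  by rewrite ler_distl => /andP[_]; rewrite addrC.
rewrite integral3//.
have -> : 2 * pi + disc_const * (harmonic k + harmonic l) + cross_const * pole_weight l * (3 * pi) =
  (pi + disc_const * harmonic k) + (pi + disc_const * harmonic l) + cross_const * pole_weight l * (3 * pi) by ring.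
rewrite 2!EFinD; apply: leeD; last exact: (integral_C (th := th)).
by apply: leeD; exact: disc_A.
Qed.

Lemma pair_lens_mass (M : R) :
  (\int[leb2]_(z in lens a) (pairRe z ^+ 2 + pairIm z ^+ 2)%:E = M%:E)%E ->
  4 * atan b + lens_const * (harmonic k + harmonic l) <=
  M + cross_const * pole_weight l * (3 * pi).
Proof.
move=> ME; have mlens := @measurable_lens R a.
have a0 : (0 : R) <= 0 <= a by apply/andP; split=> //; exact: ltW.
have H : (\int[leb2]_(z in lens a) (A k z + A l z + 0)%:E <=
    \int[leb2]_(z in lens a) (q z + C z + 0)%:E)%E.
  apply: ge0_le_integral => //.
  - by move=> z _; rewrite lee_fin !addr_ge0.
  - by apply/measurable_EFinP; apply: measurable_funTS; do 2!apply: measurable_funD => //.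
  - by apply/measurable_EFinP; apply: measurable_funTS; do 2!apply: measurable_funD => //.
  move=> z [d0z _]; rewrite lee_fin !addr0; have := pair_cross a0 d0z.
  by rewrite ler_distl => /andP[+ _]; rewrite lerBlDr.
move: H; rewrite (integral3 (w := fun=> 0))// (integral3 (u := q) (w := fun=> 0))//.
rewrite integral0 !adde0 ME => H.
have HC := integral_C mlens a0 (fun z (zS : lens a z) => zS.1).
have := le_trans (leeD (lens_A k) (lens_A l)) (le_trans H (leeD (lexx M%:E) HC)).
rewrite -!EFinD lee_fin; apply: le_trans; rewrite le_eqVlt; apply/orP; left; apply/eqP; ring.
Qed.

End pair.
End PoleSequence.

(** * The essential norm estimate *)

Section SliceBound.
Context {R : realType}.
Local Notation X := (C2 R).
Local Notation R1 := (measurableTypeR R).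
Local Notation R2 := (R1 * R1)%type.
Local Notation leb2 := (@leb2 R).
Local Notation leb4 := (@leb4 R).
Variables (M beta r eta : R).
Hypotheses (beta_gt0 : 0 < beta) (eta_gt1 : 1 < eta) (eta_r : eta < r).
Let a := 2 * beta * ln eta.
Let E := eta ^+ 2.
Let D : set X := worm M beta r.
Hypothesis (a_pi : a < pi).

Let a_gt0 : 0 < a. Proof. by rewrite !mulr_gt0// ln_gt0. Qed.

Let E_gt1 : 1 < E.
Proof. by rewrite /E expr2; have h := eta_gt1; nra. Qed.

Let Er : E <= r ^+ 2.
Proof. by have h := eta_gt1; have h' := eta_r; rewrite /E ler_sqr ?nnegrE//; lra. Qed.

Lemma worm_slice_disc x : D x -> annulus E x.2 ->
  exists2 th, 0 <= th <= a & disc th x.1.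
Proof.
move=> Dx Ax; exists (wind beta x.2); first exact: wind_itv.
exact: ((worm_slice M beta Er Ax).1 Dx).
Qed.

Lemma lens_sub_worm x : lens a x.1 -> annulus E x.2 -> D x.
Proof.
move=> lx Ax; apply: (worm_slice M beta Er Ax).2.
by apply: extreme_discs_sub lx => //; exact: wind_itv.
Qed.

Hypotheses (mD : measurable D).

Lemma worm_holo_form_size (P Q : R * R -> R) (B : R) :
  measurable_fun [set: R2] P -> measurable_fun [set: R2] Q ->
  (forall th, 0 <= th <= a ->
     (\int[leb2]_(z in disc th) (P z ^+ 2 + Q z ^+ 2)%:E <= B%:E)%E) ->
  L2 D (holo_form E P Q) /\ L2norm D (holo_form E P Q) ^+ 2 <= B * (pi * (E - 1)).
Proof.
move=> mP mQ HB.
have B0 : 0 <= B.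
  have h0 : 0 <= a <= a by rewrite lexx andbT ltW.
  rewrite -lee_fin; apply: le_trans (HB a h0).
  by apply: integral_ge0 => z _; rewrite lee_fin addr_ge0 ?sqr_ge0.
have H : (\int[leb4]_(x in D) (sqnorm (holo_form E P Q) x)%:E <= (B * (pi * (E - 1)))%:E)%E.
  apply: holo_form_size => // z2 Az2; exists (disc (wind beta z2)); split.
  - exact: measurable_disc.
  - by move=> z Dz; exact: ((worm_slice M beta (x := (z, z2)) Er Az2).1 Dz).
  - by apply: HB; exact: wind_itv.
have L : L2 D (holo_form E P Q).
  by split; [exact: measurable_holo_form|exact: le_lt_trans H (ltry _)].
split=> //; rewrite /L2norm sqr_sqrtr; last first.
  by apply: Rintegral_ge0 => x _; exact: sqnorm_ge0.
rewrite -lee_fin /Rintegral fineK//.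
rewrite ge0_fin_numE; first exact: le_lt_trans H (ltry _).
by apply: integral_ge0 => x _; rewrite lee_fin sqnorm_ge0.
Qed.

Lemma pair_form k l : (fun x => ((-1)%:C)%C *: holo_form E (poleRe a k) (poleIm a k) x
    + holo_form E (poleRe a l) (poleIm a l) x) = holo_form E (pairRe a k l) (pairIm a k l).
Proof.
apply/funext => x; apply/rowP => i; rewrite !mxE.
case: ifP => _; last by rewrite mulr0 addr0.
apply: cplx_eq; rewrite ?cReD ?cImD ?cReM ?cImM/= /pairRe /pairIm /poleRe /poleIm; ring.
Qed.

Lemma pair_lower_bound (N : @cform R 2 -> @cform R 2) (k l : nat) (m : R) :
  (leb4 D < +oo)%E -> dbar_Neumann_operator D N ->
  (\int[leb2]_(z in lens a) (pairRe a k l z ^+ 2 + pairIm a k l z ^+ 2)%:E = m%:E)%E ->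
  L2 D (holo_form E (pairRe a k l) (pairIm a k l)) ->
  m * (pi * torsion_integral E) <= L2norm D (holo_form E (pairRe a k l) (pairIm a k l)) *
    L2norm D (N (holo_form E (pairRe a k l) (pairIm a k l))).
Proof.
move=> finD hN Hm L.
pose W : set (R * R) := [set z | 0 < dsq (pole a (pole_dist k)) z] `&`
  [set z | 0 < dsq (pole a (pole_dist l)) z].
have hW : holo W (pairRe a k l) (pairIm a k l) by apply: holo_comb; exact: holo_inv.
have ca : 0 < cos (a / 2).
  have h1 := a_gt0; have h2 := a_pi; have h3 := pi_gt0 R.
  by apply: cos_gt0_pihalf; apply/andP; split; lra.
have dW th z : 0 <= th <= a -> disc th z -> W z.
  move=> tha dz; have pos n : 0 < dsq (pole a (pole_dist n)) z.
    have rn : 0 < pole_dist n :> R by exact: expR_gt0.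
    by apply: lt_le_trans (disc_pole_dist a_gt0 a_pi rn tha dz); rewrite exprn_gt0// mulr_gt0.
  by split; exact: pos.
have DW x : D x -> annulus E x.2 -> W x.1.
  by move=> Dx Ax; have [th tha dx] := worm_slice_disc Dx Ax; exact: dW tha dx.
have SW : lens a `<=` W.
  move=> z [d0 _]; apply: (dW 0) => //; apply/andP; split=> //; exact: ltW.
have df := holo_form_closed hW DW mD finD L.
apply: (lens_lower_bound mD finD E_gt1 hW SW lens_sub_worm) => //.
- exact: measurable_pairRe.
- exact: measurable_pairIm.
Qed.

End SliceBound.

Section Assembly.
Context {R : realType}.
Local Notation leb2 := (@leb2 R).

Lemma pole_weight_cvg : @pole_weight R @ \oo --> (0 : R).
Proof.
rewrite -(sqrtr0 R).
apply: (@continuous_cvg _ _ _ _ _ (@harmonic R : nat -> R) (@Num.sqrt R : R -> R) 0).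
  exact: sqrt_continuous.
exact: cvg_harmonic.
Qed.

(** Half-openings below [(pi - a) / 2] meet the positivity condition of
   [cone_mass_ge], because [cos (a / 2) - tan alpha sin (a / 2)] is
   [cos (alpha + a / 2) / cos alpha]. *)
Lemma cone_slope (a alpha : R) : 0 < a -> a < pi -> 0 < alpha -> alpha + a / 2 < pi / 2 ->
  [/\ 0 < tan alpha, 0 < cos (a / 2) - tan alpha * sin (a / 2) & atan (tan alpha) = alpha].
Proof.
move=> a0 api al0 ala; have p0 := pi_gt0 R.
have c0 : 0 < cos alpha by apply: cos_gt0_pihalf; apply/andP; split; lra.
have s0 : 0 < sin alpha by apply: sin_gt0_pi; apply/andP; split; lra.
split.
- by rewrite divr_gt0.
- have -> : cos (a / 2) - tan alpha * sin (a / 2) = cos (alpha + a / 2) / cos alpha.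
    by rewrite cosD /tan; field; rewrite gt_eqF.
  by rewrite divr_gt0//; apply: cos_gt0_pihalf; apply/andP; split; lra.
- by apply: tanK; rewrite in_itv/=; apply/andP; split; lra.
Qed.

Lemma eventually_small (u : nat -> R) (C e : R) : u @ \oo --> (0 : R) -> 0 < e ->
  exists n0, forall n, (n0 <= n)%N -> C * u n <= e.
Proof.
move=> u0 e0; have : (fun n => C * u n) @ \oo --> (0 : R).
  by rewrite -(mulr0 C); apply: cvgM => //; exact: cvg_cst.
move=> /cvgrPdist_le/(_ _ e0)[n0 _ Hn0]; exists n0 => n /Hn0/=.
by rewrite sub0r normrN; apply: le_trans; exact: ler_norm.
Qed.

(** The bounds of the two masses of a pair of poles tend to their limits when
   first [l] and then [k] tends to infinity; [essential_norm_ge] takes the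
   quotient. *)
Lemma worm_essential_norm_ge (M beta r eta : R) (N : @cform R 2 -> @cform R 2) :
  0 < beta -> 1 < eta -> eta < expR (pi / (2 * beta)) -> eta < r ->
  smooth_bounded_pseudoconvex_domain (worm M beta r) ->
  dbar_Neumann_operator (worm M beta r) N ->
  ((worm_bound beta eta)%:E <= essential_norm (worm M beta r) N)%E.
Proof.
move=> b0 e1 epi er [_ oD _ bD _] hN.
have p0 := pi_gt0 R.
have e0 : 0 < eta by rewrite (lt_trans _ e1).
have l0 : 0 < ln eta by exact: ln_gt0.
pose a := 2 * beta * ln eta; pose E := eta ^+ 2.
have a0 : 0 < a by rewrite !mulr_gt0.
have api : a < pi.
  have b2 : 0 < 2 * beta by rewrite mulr_gt0.
  have : ln eta < pi / (2 * beta) by rewrite -ltr_expR lnK ?posrE.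
  by rewrite ltr_pdivlMr// mulrC.
have E1 : 1 < E by rewrite /E expr2; nra.
have mD := open_measurable_C2 oD.
have finD := bounded_finite_leb4 mD bD.
have [bN _ _ _] := hN.
(* This half-opening makes [2 alpha / pi] the last factor of the bound; it is less
   than [(pi - a) / 2] as [pi < pi + a]. *)
pose alpha := pi * (pi - a) / (2 * (pi + a)).
have pa : 0 < pi + a by lra.
have al0 : 0 < alpha by rewrite !(mulr_gt0, invr_gt0)//; lra.
have ala : alpha + a / 2 < pi / 2.
  rewrite /alpha -subr_gt0 (_ : _ - _ = a * (pi - a) / (2 * (pi + a))).
    by rewrite !(mulr_gt0, invr_gt0)//; lra.
  have F (p : R) : 0 < p + a -> p / 2 - (p * (p - a) / (2 * (p + a)) + a / 2) =
      a * (p - a) / (2 * (p + a)) by move=> h; field; rewrite gt_eqF.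
  exact: F.
have [tan0 g0 tanE] := cone_slope a0 api al0 ala.
pose f n := holo_form E (poleRe a n) (poleIm a n).
pose T := pi * torsion_integral E; pose Ar := pi * (E - 1).
have Ar0 : 0 < Ar by rewrite mulr_gt0//; lra.
have tha0 : (0 : R) <= 0 <= a by apply/andP; split=> //; exact: ltW.
have fsize n := worm_holo_form_size (M := M) b0 e1 er mD (measurable_poleRe a n)
  (measurable_poleIm a n) (fun th h => pole_disc_mass a0 api n h).
have -> : worm_bound beta eta = (4 * alpha * T) / (2 * pi * Ar).
  have En : E - 1 != 0 by rewrite subr_eq0 gt_eqF.
  rewrite /worm_bound /T /Ar /alpha /torsion_integral lnXn// -/E -/a.
  have F (p L : R) : 0 < p -> 0 < p + a -> 0 < L ->
      ((E + 1) / 2 - (E - 1) / (2 * L)) * ((p - a) / (p + a)) =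
      4 * (p * (p - a) / (2 * (p + a))) * (p * ((E ^+ 2 - 1) / 2 - (E - 1) ^+ 2 / (2 * L)))
      / (2 * p * (p * (E - 1))).
    by move=> h1 h2 h3; field; rewrite En !gt_eqF.
  by rewrite -(mulr_natl (ln eta)); exact: F.
pose C := `|disc_const a| + `|lens_const (tan alpha) (cos (a / 2) - tan alpha * sin (a / 2))|.
have C0 : 0 <= C by rewrite addr_ge0.
(* [A] and [B] are the limits of the lower bound of [|N h| |h|] and of the upper
   bound of [|h|^2] for a pair of poles. *)
apply: (@essential_norm_ge R _ mD 2 N f (4 * alpha * T) (2 * pi * Ar)
  (Num.sqrt ((pi + `|disc_const a|) * Ar)) bN).
- by apply: mulr_gt0 => //; exact: mulr_gt0.
- by move=> n; have [] := fsize n.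
- move=> n; have [_ H] := fsize n.
  rewrite -(ger0_norm (L2norm_ge0 _ (f n))) -sqrtr_sqr ler_wsqrtr//.
  apply: (le_trans H); rewrite ler_pM2r// lerD2l.
  apply: (@le_trans _ _ (`|disc_const a| * harmonic n)).
    by apply: ler_wpM2r; [exact/ltW/harmonic_gt0|exact: ler_norm].
  by rewrite ler_piMr// /harmonic invf_le1 ?ler1n.
move=> e e_gt0; pose e' := e / (`|T| + Ar).
have Tr0 : 0 < `|T| + Ar by rewrite ltr_wpDl.
have e'0 : 0 < e' by rewrite divr_gt0.
have e'4 : 0 < e' / 4 by rewrite divr_gt0.
have [k0 Hk0] := eventually_small C (@cvg_harmonic R) e'4.
exists k0 => k /Hk0 hk.
have [l0' Hl0] := eventually_small (cross_const a k * (3 * pi)) pole_weight_cvg e'4.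
exists (maxn k0 l0') => l; rewrite geq_max => /andP[/Hk0 hl /Hl0 wl] h.
have -> : h = holo_form E (pairRe a k l) (pairIm a k l) by exact: pair_form.
have wl' : cross_const a k * pole_weight l * (3 * pi) <= e' / 4.
  by rewrite mulrAC.
have small (c : R) n : `|c| <= C -> C * harmonic n <= e' / 4 -> `|c * harmonic n| <= e' / 4.
  move=> cC; apply: le_trans; rewrite normrM (gtr0_norm (harmonic_gt0 _)).
  by rewrite ler_wpM2r// ltW// harmonic_gt0.
have dC : `|disc_const a| <= C by rewrite lerDl.
have lC : `|lens_const (tan alpha) (cos (a / 2) - tan alpha * sin (a / 2))| <= C by rewrite lerDr.
have := small _ _ dC hk; have := small _ _ dC hl; have := small _ _ lC hk; have := small _ _ lC hl.
rewrite !ler_norml => /andP[ll _] /andP[lk _] /andP[_ dl] /andP[_ dk].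
pose B := 2 * pi + disc_const a * (harmonic k + harmonic l) + cross_const a k * pole_weight l * (3 * pi).
have Bmass th : 0 <= th <= a ->
    (\int[leb2]_(z in disc th) (pairRe a k l z ^+ 2 + pairIm a k l z ^+ 2)%:E <= B%:E)%E.
  by move=> tha; exact: (pair_disc_mass a0 api k l tha).
have [Lh nh] := worm_holo_form_size (M := M) b0 e1 er mD (measurable_pairRe a k l)
  (measurable_pairIm a k l) Bmass.
have Be : B <= 2 * pi + e' by rewrite /B mulrDr; lra.
have eE : e = e' * `|T| + e' * Ar by rewrite -mulrDr /e' divfK// gt_eqF.
have eT : 0 <= e' * `|T| by rewrite mulr_ge0// ltW.
have eA : 0 <= e' * Ar by rewrite mulr_ge0// ltW.
split; last first.
  apply: (le_trans nh); apply: (@le_trans _ _ ((2 * pi + e') * Ar)); first by rewrite ler_pM2r.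
  by rewrite mulrDl lerD2l; lra.
(* A lower bound of the mass gives one of the product only if [T] is positive. *)
have [T0|T0] := lerP T 0.
  apply: (@le_trans _ _ 0); last by rewrite mulr_ge0// L2norm_ge0.
  have : 4 * alpha * T <= 0 by rewrite mulr_ge0_le0// mulr_ge0// ltW.
  lra.
pose m := fine (\int[leb2]_(z in lens a) (pairRe a k l z ^+ 2 + pairIm a k l z ^+ 2)%:E)%E.
have pos z : 0 <= pairRe a k l z ^+ 2 + pairIm a k l z ^+ 2 by rewrite addr_ge0 ?sqr_ge0.
have mE : (\int[leb2]_(z in lens a) (pairRe a k l z ^+ 2 + pairIm a k l z ^+ 2)%:E = m%:E)%E.
  rewrite /m fineK// ge0_fin_numE; last by apply: integral_ge0 => z _; rewrite lee_fin.
  apply: le_lt_trans (ltry B); apply: le_trans (Bmass 0 tha0).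
  apply: ge0_subset_integral.
  - exact: measurable_lens.
  - exact: measurable_disc.
  - apply/measurable_EFinP; apply: measurable_funTS; apply: measurable_funD; apply: measurable_funX.
      exact: measurable_pairRe.
    exact: measurable_pairIm.
  - by move=> z _; rewrite lee_fin.
  - by move=> z [].
have low := pair_lower_bound b0 e1 er api mD finD hN mE Lh.
have mass := pair_lens_mass a0 api tan0 erefl g0 mE.
rewrite tanE in mass.
have me : 4 * alpha - e' <= m by rewrite mulrDr in mass; lra.
rewrite [leRHS]mulrC; apply: le_trans low.
apply: (@le_trans _ _ ((4 * alpha - e') * T)); last by rewrite ler_pM2r.
by rewrite gtr0_norm// in eE; rewrite mulrBl; lra.
Qed.

End Assembly.

Theorem theorem2 (R : realType) (beta r M : R) (N : @cform R 2 -> @cform R 2)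
  (hr : 1 < r) (hbeta : 0 < beta) (hM : 0 < M)
  (hworm : smooth_bounded_pseudoconvex_domain (worm M beta r))
  (hN : dbar_Neumann_operator (worm M beta r) N) :
  (ereal_sup [set (worm_bound beta eta)%:E | eta in
     [set eta : R | 1 < eta /\ eta < Num.min (expR (pi / (2 * beta))) r]%R]
   <= essential_norm (worm M beta r) N)%E.
Proof.
apply: ge_ereal_sup => _ [eta [e1 e2] <-]; move: e2; rewrite lt_min => /andP[epi er].
exact: worm_essential_norm_ge.
Qed.
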